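(* Let $(\mu+\phi,\nu+X)$ be a Jacobi bialgebroid on a vector bundle $A\to M$. Then: 1. The assignment $C^\infty(M)\to C^\infty(M)$, $f\mapsto\{\{\mu,X\},f\}$ is a vector field $\underline E$ on $M$. This vector field is also given by the assignment $f\mapsto-\{\{\nu,\phi\},f\}$. 2. The assignment $C^\infty(M)\times C^\infty(M)\to C^\infty(M)$, $(f,g)\mapsto\{\{\mu,f\},\{\nu,g\}\}$ is a bivector field $\underline\pi$ on $M$. 3. The pair $(\underline\pi,-\underline E)$ is a Jacobi structure on $TM$.
   Context: **Big bracket.** For a vector bundle $A\to M$ of rank $d$ over an $n$-manifold, $\mathcal F_A=\bigoplus_{k,l\in\mathbb N}\mathcal F_A^{k,l}$ denotes the bigraded algebra of functions on the graded manifold $T^*\Pi A$. Locally it is generated, over the smooth functions of coordinates $x_1,\dots,x_n$ of $M$ (bi-degree $(0,0)$), by $p^1,\dots,p^n$ (bi-degree $(1,1)$), $\xi_1,\dots,\xi_d$ (bi-degree $(0,1)$, a local frame of $A^*$) and $\theta^1,\dots,\theta^d$ (bi-degree $(1,0)$, the dual local frame of $A$), with polynomial dependence in the $p^i$. It is graded commutative for the total degree: $F_1F_2=(-1)^{(k_1+l_1)(k_2+l_2)}F_2F_1$ for $F_i\in\mathcal F_A^{k_i,l_i}$. The big bracket $\{\cdot,\cdot\}$ is the canonical graded Poisson bracket, of bi-degree $(-1,-1)$, satisfying $\{F_1,F_2\}=-(-1)^{(k_1+l_1)(k_2+l_2)}\{F_2,F_1\}$, $\{F_1,F_2F_3\}=\{F_1,F_2\}F_3+(-1)^{(k_1+l_1)(k_2+l_2)}F_2\{F_1,F_3\}$,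 $\{F_1,\{F_2,F_3\}\}=\{\{F_1,F_2\},F_3\}+(-1)^{(k_1+l_1)(k_2+l_2)}\{F_2,\{F_1,F_3\}\}$, with $\{p^i,x_i\}=\{\theta^j,\xi_j\}=1$ and all other brackets of coordinates vanishing. One identifies $\mathcal F_A^{0,0}=C^\infty(M)$, $\mathcal F_A^{k,0}=\Gamma(\wedge^kA)$, $\mathcal F_A^{0,k}=\Gamma(\wedge^kA^* )$ (as graded algebras, the product being the wedge product); for $\xi\in\Gamma(A^* ),\theta\in\Gamma(A)$ one has $\{\xi,\theta\}=\{\theta,\xi\}=\xi(\theta)$. $\mathrm{id}_A:=\sum_j\xi_j\theta^j\in\mathcal F_A^{1,1}$. There is a canonical isomorphism $\mathcal F_A\simeq\mathcal F_{A^*}$ of graded Poisson algebras exchanging $\mathcal F_A^{k,l}$ and $\mathcal F_{A^*}^{l,k}$; it is used to regard structures on $A^*$ as elements of $\mathcal F_A$. **Jacobi bialgebroids.** $\Gamma(\bigwedge A)=\bigoplus_k\Gamma(\wedge^kA)$. A pre-Jacobi algebroid on $A$ is a function $\mu+\phi$ with $\mu\in\mathcal F_A^{1,2}$, $\phi\in\Gamma(A^* )$; its bracket on $\Gamma(\bigwedge A)$ is $[P,Q]_{\mu,\phi}:=\{\{P,\mu+\mathrm{id}_A\phi\},Q\}-P\{\phi,Q\}+\{P,\phi\}Q$. It is a Jacobi algebroid if $\{\mu+\phi,\mu+\phi\}=0$. A pre-Jacobi algebroid on $A^*$ is a function $\nu+X$ with $\nu\in\mathcal F_A^{2,1}$,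 $X\in\Gamma(A)$; its differential on $\Gamma(\bigwedge A)$ is $\mathsf d_{\nu,X}(P):=\{\nu,P\}+XP$. The pair $(\mu+\phi,\nu+X)$ is a Jacobi bialgebroid if $\mu+\phi$ is a Jacobi algebroid, $\mathsf d_{\nu,X}^2=0$, and $\mathsf d_{\nu,X}[a,b]_{\mu,\phi}=[\mathsf d_{\nu,X}a,b]_{\mu,\phi}+(-1)^{k-1}[a,\mathsf d_{\nu,X}b]_{\mu,\phi}$ for all $k$, $a\in\Gamma(\wedge^kA)$, $b\in\Gamma(\bigwedge A)$. **Jacobi structures.** A Lie algebroid on a vector bundle $B$ is $\mu_B\in\mathcal F_B^{1,2}$ with $\{\mu_B,\mu_B\}=0$; its bracket on $\Gamma(\bigwedge B)$ is $[P,Q]_{\mu_B}=\{\{P,\mu_B\},Q\}$. A Jacobi structure on the Lie algebroid $\mu_B$ is a pair $(\pi,E)$, $\pi\in\Gamma(\wedge^2B)$, $E\in\Gamma(B)$, with $[\pi,\pi]_{\mu_B}=-2E\pi$ and $[E,\pi]_{\mu_B}=0$ (where $E\pi=E\wedge\pi$). ''A Jacobi structure on $TM$'' refers to $B=TM$ with its standard Lie algebroid structure; $[\cdot,\cdot]$ is then the Schouten bracket extending the Lie bracket of vector fields, with $[V,f]=V[f]$ and $[P,QR]=[P,Q]R+(-1)^{(k-1)l}Q[P,R]$ for $P$ of degree $k$, $Q$ of degree $l$. A bivector field is identified with the skew-symmetric biderivation it defines, with $(V\wedge W)[f,g]=V[f]W[g]-V[g]W[f]$ for vector fields $V,W$.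 *)

(* Defs.v *)
From HB Require Import structures.
From mathcomp Require Import all_boot all_order all_algebra.
From mathcomp Require Import all_classical all_reals all_analysis.
(* The notations of mpoly clash with those of mathcomp-analysis. *)
From mathcomp Require Import -(notations) freeg.
From mathcomp Require Import -(notations) mpoly.
Import Order.TTheory GRing.Theory Num.Theory.
Import numFieldNormedType.Exports.

Set Implicit Arguments.
Unset Strict Implicit.
Unset Printing Implicit Defensive.

Local Open Scope ring_scope.

(** * Smooth functions on open subsets of R^n *)

Definition pderiv (R : realType) (n : nat) (a : 'I_n) (f : 'rV[R]_n -> R) :
  'rV[R]_n -> R := fun y => 'D_(delta_mx 0 a) f y.

(* [U] is meant to be open; [f] is total and its values off [U] are
   irrelevant.  Differentiability of all the iterated partial derivatives is
   equivalent to their existence and continuity. *)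
Definition smooth_on (R : realType) (n : nat) (U : set 'rV[R]_n)
    (f : 'rV[R]_n -> R) : Prop :=
  forall (s : seq 'I_n) (y : 'rV[R]_n), U y ->
    differentiable (foldr (@pderiv R n) f s) y.

Lemma near_eq_differentiable (R : numFieldType) (V W : normedModType R)
    (f g : V -> W) (x : V) :
  (\forall z \near x, f z = g z) -> differentiable f x -> differentiable g x.
Proof.
move=> fg df; have [cdf dfE] := (diff_locallyP _ _).1 df.
have gE : g \o shift x = cst (g x) + 'd f x +o_ (0 : V) id.
  apply/eqaddoP => _/posnumP[e].
  have /eqaddoP/(_ e%:num (gt0 e)) := dfE.
  have fg0 : \forall z \near (0 : V), f (z + x) = g (z + x).
    by move: fg; rewrite (near_shift 0) subr0.
  apply: filterS2 fg0 => z fgz.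
  by rewrite !fctE /= fgz (nbhs_singleton fg).
by apply/diff_locallyP; rewrite (diff_unique cdf gE).
Qed.

Lemma differentiable_rV (R : realType) (m n : nat)
    (f : 'rV[R]_m -> 'rV[R]_n) (y : 'rV[R]_m) :
  (forall b, differentiable (fun z => f z 0 b) y) -> differentiable f y.
Proof.
move=> df; have -> : f = \sum_b (fun z => f z 0 b *: delta_mx 0 b).
  apply/funext => z; rewrite fct_sumE [LHS]row_sum_delta.
  by apply: eq_bigr.
by apply: differentiable_sum => b; exact: differentiableZl.
Qed.

Lemma derive_rV (R : realType) (m n : nat) (h : 'rV[R]_m -> 'rV[R]_n)
    (y v : 'rV[R]_m) :
  (forall b, differentiable (fun z => h z 0 b) y) ->
  'D_v h y = \sum_b 'D_v (fun z => h z 0 b) y *: delta_mx 0 b.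
Proof.
move=> dh.
have hE : h = \sum_b (fun z => h z 0 b *: delta_mx 0 b).
  by apply/funext => z; rewrite fct_sumE [LHS]row_sum_delta.
rewrite [in LHS]hE derive_sum; last first.
  by move=> b; apply/diff_derivable/differentiableZl.
apply: eq_bigr => b _; rewrite deriveE; last exact: differentiableZl.
by rewrite diffZl // deriveE.
Qed.

Lemma pderiv_comp (R : realType) (m n : nat) (h : 'rV[R]_m -> 'rV[R]_n)
    (g : 'rV[R]_n -> R) (y : 'rV[R]_m) (a : 'I_m) :
  (forall b, differentiable (fun z => h z 0 b) y) -> differentiable g (h y) ->
  pderiv a (g \o h) y =
  \sum_b pderiv a (fun z => h z 0 b) y * pderiv b g (h y).
Proof.
move=> dh dg; have dh' := differentiable_rV dh.
rewrite {1}/pderiv deriveE; last exact: differentiable_comp.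
rewrite diff_comp //= -[X in 'd g _ X](deriveE _ dh') derive_rV //.
rewrite linear_sum; apply: eq_bigr => b _.
by rewrite linearZ /= /pderiv [in RHS](deriveE _ dg).
Qed.

Section SmoothOn.
Variables (R : realType) (n : nat).
Implicit Types (U : set 'rV[R]_n) (f g : 'rV[R]_n -> R).

Lemma eq_iter_pderiv U f g (s : seq 'I_n) : open U ->
  (forall y, U y -> f y = g y) ->
  forall y, U y -> foldr (@pderiv R n) f s y = foldr (@pderiv R n) g s y.
Proof.
move=> oU fg; elim: s => [|a s IH] y Uy //=; first exact: fg.
apply: near_eq_derive; have := open_nbhs_nbhs (conj oU Uy).
by apply: filterS => z; exact: IH.
Qed.

Lemma eq_smooth_on U f g : open U -> (forall y, U y -> f y = g y) ->
  smooth_on U f -> smooth_on U g.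
Proof.
move=> oU fg sf s y Uy; apply: near_eq_differentiable (sf s y Uy).
have := open_nbhs_nbhs (conj oU Uy).
by apply: filterS => z; exact: eq_iter_pderiv.
Qed.

Lemma smooth_on_pderiv U f (a : 'I_n) :
  smooth_on U f -> smooth_on U (pderiv a f).
Proof.
by move=> sf s y Uy; have := sf (rcons s a) y Uy; rewrite foldr_rcons.
Qed.

Lemma smooth_on_sub U U' f : (forall y, U' y -> U y) ->
  smooth_on U f -> smooth_on U' f.
Proof. by move=> UU sf s y /UU; exact: sf. Qed.

End SmoothOn.

(** * Manifolds and vector bundles *)

Record manifold (R : realType) (n : nat) := Manifold {
  mcarrier :> topologicalType;
  mhausdorff : hausdorff_space mcarrier;
  msecond_countable : @second_countable mcarrier;
  chart_index : Type;
  chart_dom : chart_index -> set mcarrier;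
  chart : chart_index -> mcarrier -> 'rV[R]_n;
  chart_inv : chart_index -> 'rV[R]_n -> mcarrier;
  chart_dom_open : forall i, open (chart_dom i);
  chart_img_open : forall i, open (chart i @` chart_dom i)%classic;
  chart_cover : forall x, exists i, chart_dom i x;
  chartK : forall i x, chart_dom i x -> chart_inv i (chart i x) = x;
  chart_continuous : forall i x, chart_dom i x ->
    {for x, continuous (chart i)};
  chart_inv_continuous : forall i y, (chart i @` chart_dom i)%classic y ->
    {for y, continuous (chart_inv i)};
  chart_smooth : forall i j b,
    smooth_on (chart i @` (chart_dom i `&` chart_dom j))%classic
      (fun y => chart j (chart_inv i y) 0 b)
}.

Definition chart_img (R : realType) (n : nat) (M : manifold R n)
  (i : chart_index M) : set 'rV[R]_n := (chart i @` chart_dom i)%classic.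

Definition smooth (R : realType) (n : nat) (M : manifold R n) (f : M -> R) :
  Prop := forall i : chart_index M, smooth_on (chart_img i) (f \o chart_inv i).

(* The atlas of the base is taken to trivialize the bundle.  If
   theta_i^1, .., theta_i^d is the local frame over the i-th chart domain, then
   theta_j^a = \sum_b (vb_trans j i a b) theta_i^b on the overlaps. *)
Record vbundle (R : realType) (n : nat) (M : manifold R n) (d : nat) :=
  VBundle {
  vb_trans : chart_index M -> chart_index M -> M -> 'M[R]_d;
  vb_trans_id : forall i x, chart_dom i x -> vb_trans i i x = 1%:M;
  vb_trans_cocycle : forall i j k x,
    chart_dom i x -> chart_dom j x -> chart_dom k x ->
    vb_trans k i x = vb_trans k j x *m vb_trans j i x;
  vb_trans_smooth : forall i j a b,
    smooth_on (chart j @` (chart_dom i `&` chart_dom j))%classic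
      (fun y => vb_trans j i (chart_inv j y) a b)
}.

(** ** The tangent bundle *)

(* jacobian j i x a b = d(x_i)_b / d(x_j)_a, so that the coordinate frames
   satisfy d/d(x_j)_a = \sum_b (jacobian j i x a b) d/d(x_i)_b. *)
Definition jacobian (R : realType) (n : nat) (M : manifold R n)
    (j i : chart_index M) (x : M) : 'M[R]_n :=
  \matrix_(a, b) pderiv a (fun y => chart i (chart_inv j y) 0 b) (chart j x).

Section Charts.
Variables (R : realType) (n : nat) (M : manifold R n).
Implicit Types i j k : chart_index M.

Lemma open_chart_overlap j i :
  open (chart j @` (chart_dom i `&` chart_dom j))%classic.
Proof.
rewrite openE => _ [x [xi xj] <-].
have yj : chart_img j (chart j x) by exists x.
have nj := open_nbhs_nbhs (conj (@chart_img_open _ _ M j) yj).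
have ni : nbhs (chart j x) (chart_inv j @^-1` chart_dom i)%classic.
  apply: (@chart_inv_continuous _ _ M j _ yj); rewrite chartK //.
  exact: open_nbhs_nbhs (conj (chart_dom_open i) xi).
rewrite /interior; apply: filterS2 nj ni => _ [z zj <-] /=.
by rewrite chartK // => zi; exists z.
Qed.

Lemma jacobian_id i x : chart_dom i x -> jacobian i i x = 1%:M.
Proof.
move=> xi; apply/matrixP => a b; rewrite !mxE /pderiv.
have yi : chart_img i (chart i x) by exists x.
rewrite (@near_eq_derive _ _ _ _ (fun z : 'rV[R]_n => z 0 b)); last first.
  have := open_nbhs_nbhs (conj (@chart_img_open _ _ M i) yi).
  by apply: filterS => _ [z zi <-]; rewrite chartK.
have := derive_rV (h := id) (y := chart i x) (delta_mx 0 a).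
rewrite derive_id => /(_ (fun b => differentiable_coord _ _ _)).
move=> /(congr1 (fun v : 'rV[R]_n => v 0 b)); rewrite !mxE summxE (bigD1 b) //=.
rewrite big1 ?addr0 => [|c cb].
  by rewrite !mxE !eqxx /= mulr1 eq_sym => <-.
by rewrite !mxE eqxx /= eq_sym (negPf cb) mulr0.
Qed.

Lemma jacobian_cocycle i j k x :
  chart_dom i x -> chart_dom j x -> chart_dom k x ->
  jacobian k i x = jacobian k j x *m jacobian j i x.
Proof.
move=> xi xj xk; apply/matrixP => a b; rewrite !mxE.
have near_k : \forall z \near chart k x,
    (chart k @` (chart_dom j `&` chart_dom k))%classic z.
  by apply: open_nbhs_nbhs; split; [exact: open_chart_overlap|exists x].
rewrite /pderiv (@near_eq_derive _ _ _ _ ((fun y => chart i (chart_inv j y) 0 b)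
    \o (fun y => chart j (chart_inv k y)))); last first.
  by apply: filterS near_k => _ [z [zj zk] <-] /=; rewrite !chartK.
rewrite -/(pderiv _ _ _) pderiv_comp.
- by apply: eq_bigr => c _; rewrite !mxE chartK.
- move=> c; apply: (@chart_smooth _ _ M k j c [::]); by exists x.
- rewrite chartK //; apply: (@chart_smooth _ _ M j i b [::]); by exists x.
Qed.

Lemma jacobian_smooth i j a b :
  smooth_on (chart j @` (chart_dom i `&` chart_dom j))%classic
    (fun y => jacobian j i (chart_inv j y) a b).
Proof.
apply: (@eq_smooth_on _ _ _ (pderiv a (fun y => chart i (chart_inv j y) 0 b))).
- exact: open_chart_overlap.
- by move=> _ [z [zi zj] <-]; rewrite mxE chartK.
- by apply: smooth_on_pderiv; rewrite setIC; exact: chart_smooth.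
Qed.

End Charts.

Definition tangent_bundle (R : realType) (n : nat) (M : manifold R n) :
  vbundle M n :=
  VBundle (@jacobian_id R n M) (@jacobian_cocycle R n M)
    (@jacobian_smooth R n M).

(** * The graded algebra of a coordinate domain *)

(* [galg K n d] is K[p^1,..,p^n] (x) Lambda(xi_1,..,xi_d,theta^1,..,theta^d).
   The odd generators are indexed by 'I_(d + d): [lshift d a] stands for xi_a
   and [rshift d a] for theta^a.  The value of an element at
   S : {set 'I_(d + d)} is the coefficient of the product of the odd generators
   of S taken in increasing order. *)
Notation galg K n d := {ffun {set 'I_(d + d)} -> mpoly n K}.

Section GradedAlgebra.
Variables (K : comNzRingType) (n d : nat).
Implicit Types u v : galg K n d.
Local Notation oset := {set 'I_(d + d)}.

Definition gconst (c : K) : galg K n d :=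
  [ffun S : oset => if S == finset.set0 then mpolyC n c else 0].

Definition gp (a : 'I_n) : galg K n d :=
  [ffun S : oset =>
     if S == finset.set0 then mpolyX K (mnm1 a) else 0].

Definition godd (e : 'I_(d + d)) : galg K n d := 
  [ffun S : oset => (S == [set e])%:R].

Definition gxi (a : 'I_d) : galg K n d := godd (lshift d a).
Definition gtheta (a : 'I_d) : galg K n d := godd (rshift d a).

(* Number of transpositions that sort the concatenation of S and T. *)
Definition inversions (S T : oset) : nat :=
  #|[set st in finset.setX S T | (st.2 < st.1)%N]|.

Definition gmul u v : galg K n d :=
  [ffun W : oset => \sum_(S : oset | S \subset W)
     (-1) ^+ inversions S (W :\: S) * (u S * v (W :\: S))].

Definition dp (a : 'I_n) u : galg K n d := [ffun S : oset => mderiv a (u S)].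

(* Left and right derivatives with respect to an odd generator. *)
Definition dleft (e : 'I_(d + d)) u : galg K n d :=
  [ffun S : oset =>
     if e \in S then 0 else (-1) ^+ inversions [set e] S * u (e |: S)].
Definition dright (e : 'I_(d + d)) u : galg K n d :=
  [ffun S : oset =>
     if e \in S then 0 else (-1) ^+ inversions S [set e] * u (e |: S)].

Definition odd_weight (h : 'I_d -> 'I_(d + d)) (S : oset) : nat :=
  #|[set a | h a \in S]|.

(* The substitution p^a |-> P a, e |-> Q e (for e an odd generator). *)
Definition gsubst (P : 'I_n -> galg K n d) (Q : 'I_(d + d) -> galg K n d) u :
  galg K n d :=
  \sum_(S : oset) \sum_(m <- msupp (u S))
    gmul (gconst (mcoeff m (u S)))
      (gmul (\big[gmul/gconst 1]_(a < n) iter (m a) (gmul (P a)) (gconst 1))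
            (\big[gmul/gconst 1]_(e <- enum S) Q e)).

End GradedAlgebra.

Notation "u ** v" := (gmul u v) (at level 40, left associativity) : ring_scope.

(* The functions F_A over a coordinate domain, in terms of the coordinates. *)
Notation lfun R n d := (galg ('rV[R]_n -> R) n d).

Section LocalFunctions.
Variables (R : realType) (n d : nat).
Implicit Types u v : lfun R n d.
Local Notation oset := {set 'I_(d + d)}.

Definition geval (y : 'rV[R]_n) u : galg R n d :=
  [ffun S : oset => map_mpoly (fun f : 'rV[R]_n -> R => f y) (u S)].

Definition dx (a : 'I_n) u : lfun R n d :=
  [ffun S : oset => \sum_(m <- msupp (u S))
     (pderiv a (mcoeff m (u S)) : 'rV[R]_n -> R) *: mpolyX _ m].

(* The bracket with {p^a, x_a} = {theta^a, xi_a} = 1. *)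
Definition lbracket u v : lfun R n d :=
  \sum_(a < n) (dp a u ** dx a v - dx a u ** dp a v) +
  \sum_(a < d) (dright (rshift d a) u ** dleft (lshift d a) v +
                dright (lshift d a) u ** dleft (rshift d a) v).

End LocalFunctions.

(** * The bigraded algebra F_A and the big bracket *)

(* Local expressions, one for each chart. *)
Definition lfamily (R : realType) (n : nat) (M : manifold R n) (d : nat)
  (A : vbundle M d) : Type := chart_index M -> lfun R n d.

HB.instance Definition _ (R : realType) (n : nat) (M : manifold R n) (d : nat)
  (A : vbundle M d) :=
  GRing.Zmodule.copy (lfamily A) (chart_index M -> lfun R n d).

Section BigBracket.
Variables (R : realType) (n : nat) (M : manifold R n).
Variables (d : nat) (A : vbundle M d).

Implicit Types F G : lfamily A.

(* The values of the coefficients off the chart images are irrelevant. *)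
Definition fequiv F G : Prop := forall i (y : 'rV[R]_n),
  chart_img i y -> geval y (F i) = geval y (G i).

(* The coordinates of T^*Pi A over the j-th chart in terms of those over the
   i-th one: xi_j and theta_j are dual frames, and p_j^a is the momentum of
   (x_j)_a, i.e. the derivation d/d(x_j)_a of functions of (x_j, xi_j).  Since
   (xi_i)_c = \sum_b g_b,c (xi_j)_b for g = vb_trans A j i, one has
   d/d(x_j)_a = \sum_b d(x_i)_b/d(x_j)_a d/d(x_i)_b
              + \sum_(b, c) dg_b,c/d(x_j)_a (xi_j)_b d/d(xi_i)_c
   and theta_i^c is the momentum d/d(xi_i)_c of (xi_i)_c. *)
Definition trans_xi (i j : chart_index M) (x : M) (b : 'I_d) : galg R n d :=
  \sum_c gconst n d (vb_trans A i j x c b) ** gxi R n c.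

Definition trans_theta (i j : chart_index M) (x : M) (b : 'I_d) : galg R n d :=
  \sum_c gconst n d (vb_trans A j i x b c) ** gtheta R n c.

Definition trans_p (i j : chart_index M) (x : M) (a : 'I_n) : galg R n d :=
  \sum_b gconst n d (jacobian j i x a b) ** gp R d b +
  \sum_b \sum_c
    gconst n d
      (pderiv a (fun y => vb_trans A j i (chart_inv j y) b c) (chart j x)) **
      (trans_xi i j x b ** gtheta R n c).

Definition trans_odd (i j : chart_index M) (x : M) (e : 'I_(d + d)) :
  galg R n d :=
  match fintype.split e with
  | inl b => trans_xi i j x b
  | inr b => trans_theta i j x b
  end.

Definition compatible F : Prop := forall i j x,
  chart_dom i x -> chart_dom j x ->
  geval (chart i x) (F i) =
  gsubst (trans_p i j x) (trans_odd i j x) (geval (chart j x) (F j)).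

Definition smooth_family F : Prop := forall i S m,
  smooth_on (chart_img i) (mcoeff m (F i S)).

(* F_A^{k,l} *)
Definition bihom (k l : nat) F : Prop :=
  [/\ smooth_family F, compatible F &
      forall i y S m, chart_img i y -> mcoeff m (F i S) y != 0 ->
        k = (mdeg m + odd_weight (@rshift d d) S)%N /\
        l = (mdeg m + odd_weight (@lshift d d) S)%N].

(* The sections of the exterior algebra of A: the direct sum of the
   F_A^{k,0}. *)
Definition multisection F : Prop :=
  exists N (F_ : nat -> lfamily A),
    (forall k, bihom k 0 (F_ k)) /\ F = \sum_(k < N) F_ k.

Definition fmul F G : lfamily A := fun i => F i ** G i.

Definition big_bracket F G : lfamily A := fun i => lbracket (F i) (G i).

Definition id_family : lfamily A :=
  fun=> \sum_(a < d) gxi _ n a ** gtheta _ n a.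

(* The function on M with the given expressions in the charts. *)
Definition of_local (h : chart_index M -> 'rV[R]_n -> R) : lfamily A :=
  fun i => gconst n d (h i).

Definition of_fun (f : M -> R) : lfamily A :=
  of_local (fun i => f \o chart_inv i).

End BigBracket.

Notation "F =~= G" := (fequiv F G) (at level 70, no associativity).
Notation "F '*f' G" := (fmul F G) (at level 40, left associativity).
Notation "<{ F , G }>" := (big_bracket F G).

(** * Lie algebroids and Jacobi bialgebroids *)

Section Algebroids.
Variables (R : realType) (n : nat) (M : manifold R n).
Variables (d : nat) (A : vbundle M d).
Implicit Types mu phi nu X P Q pi E : lfamily A.

Definition pre_jacobi_algebroid mu phi : Prop := bihom 1 2 mu /\ bihom 0 1 phi.

Definition jacobi_bracket mu phi P Q : lfamily A :=
  <{ <{ P, mu + id_family A *f phi }>, Q }>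
  - P *f <{ phi, Q }> + <{ P, phi }> *f Q.

Definition jacobi_algebroid mu phi : Prop :=
  pre_jacobi_algebroid mu phi /\ <{ mu + phi, mu + phi }> =~= 0.

Definition pre_jacobi_algebroid_dual nu X : Prop :=
  bihom 2 1 nu /\ bihom 1 0 X.

Definition jacobi_diff nu X P : lfamily A := <{ nu, P }> + X *f P.

Definition jacobi_bialgebroid mu phi nu X : Prop :=
  [/\ jacobi_algebroid mu phi,
      pre_jacobi_algebroid_dual nu X,
      (forall P, multisection P ->
         jacobi_diff nu X (jacobi_diff nu X P) =~= 0) &
      (forall k a b, bihom k 0 a -> multisection b ->
         jacobi_diff nu X (jacobi_bracket mu phi a b) =~=
         jacobi_bracket mu phi (jacobi_diff nu X a) b
         (* (-1)^(k-1) *)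
         + (jacobi_bracket mu phi a (jacobi_diff nu X b)) *~ ((-1) ^+ k.+1))].

Definition lie_algebroid mu : Prop := bihom 1 2 mu /\ <{ mu, mu }> =~= 0.

Definition lie_bracket mu P Q : lfamily A := <{ <{ P, mu }>, Q }>.

Definition jacobi_structure mu pi E : Prop :=
  [/\ lie_algebroid mu, bihom 2 0 pi, bihom 1 0 E,
      lie_bracket mu pi pi =~= - (E *f pi) *+ 2 &
      lie_bracket mu E pi =~= 0].

End Algebroids.

(** * Vector fields, bivector fields and Jacobi structures on a manifold *)

Section TangentBundle.
Variables (R : realType) (n : nat) (M : manifold R n).
Let TM := tangent_bundle M.

(* Over a chart, theta^a is the vector field d/dx_a and xi_a is dx_a.  The
   derived bracket of this function is the Schouten bracket:
   {{V, tangent_mu}, f} = V[f]. *)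
Definition tangent_mu : lfamily TM := fun=> \sum_(a < n) gp _ n a ** gxi _ n a.

(* V[f], in the charts. *)
Definition vf_apply (V : lfamily TM) (f : M -> R) (i : chart_index M) :
    'rV[R]_n -> R :=
  fun y => \sum_(a < n)
    mcoeff mnm0 (V i [set rshift n a]) y * pderiv a (f \o chart_inv i) y.

(* P[f, g], in the charts: the coefficient of theta^a theta^b (a < b) is
   applied through
   (d/dx_a /\ d/dx_b)[f, g] = df/dx_a dg/dx_b - dg/dx_a df/dx_b. *)
Definition bivf_apply (P : lfamily TM) (f g : M -> R) (i : chart_index M) :
    'rV[R]_n -> R :=
  fun y => \sum_(a < n) \sum_(b < n | (a < b)%N)
    mcoeff mnm0 (P i [set rshift n a; rshift n b]) y *
    (pderiv a (f \o chart_inv i) y * pderiv b (g \o chart_inv i) y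
     - pderiv a (g \o chart_inv i) y * pderiv b (f \o chart_inv i) y).

Variables (d : nat) (A : vbundle M d).

(* The assignment T on C^oo(M), resp. on pairs of elements of C^oo(M), with
   values in F_A^{0,0} = C^oo(M), is the vector field V, resp. the bivector
   field P. *)
Definition is_vector_field (T : (M -> R) -> lfamily A) (V : lfamily TM) :
    Prop :=
  bihom 1 0 V /\
  forall f, smooth f -> T f =~= of_local A (vf_apply V f).

Definition is_bivector_field (T : (M -> R) -> (M -> R) -> lfamily A)
    (P : lfamily TM) : Prop :=
  bihom 2 0 P /\
  forall f g, smooth f -> smooth g -> T f g =~= of_local A (bivf_apply P f g).

End TangentBundle.

Arguments tangent_mu {R n} M.

(* Main.v *)
From HB Require Import structures.
Require Import Defs.
From mathcomp Require Import all_boot all_order all_algebra.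
From mathcomp Require Import all_classical all_reals all_analysis.
From mathcomp Require Import -(notations) freeg.
From mathcomp Require Import -(notations) mpoly.
From mathcomp Require Import zify ring lra.
Import Order.TTheory GRing.Theory Num.Theory.
Import numFieldNormedType.Exports.
Set Implicit Arguments.
Unset Strict Implicit.
Unset Printing Implicit Defensive.
Local Open Scope ring_scope.

(** The theorem reduces to identities between coefficients over one chart, which
  all come from a bracket on functions: [{f, g} = [df, g]], where [d] is the
  differential of [(nu, X)] and [[., .]] the bracket of [(mu, phi)].  This is
  [fun_bracket].

  - The compatibility of [d] with the bracket of two functions says that this
    bracket is skew symmetric, [fun_bracket_anti], since [[f, g] = 0].
  - The compatibility for [df] and [g], together with [ddf = 0], says that
    [d{f, g} = [df, dg]].  Now [{mu + phi, mu + phi} = 0] means that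
    [V |-> [V, .]] represents the sections on the functions, [act_bracket], so the
    Jacobi identity holds, [fun_bracket_jacobi].

  Both [d] and the action of sections are of first order in the function, so in
  coordinates [{f, g}] is a combination of [df dg], [f dg], [g df] and [f g].
  Its coefficients are products of the anchors of [mu] and [nu] with each other
  and with [X] and [phi], and the skew symmetry reduces it to
  [{f, g} = - pi(df, dg) + f E(g) - g E(f)], [fun_bracket_base], where
  [pi = base_pi] is the product of the two anchors and [E = base_E] is both the
  image of [X] and minus the image of [phi].  Applied to coordinate functions and
  to the constant 1, the Jacobi identity becomes the coordinate form of
  [[pi, pi] = 2 E pi] and [[E, pi] = 0], [base_pi_jacobi] and [base_E_jacobi].

  There are three further ingredients.  The axioms speak of global functions, and
  germs of functions on a chart extend to the manifold by means of bump functions,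
  [smooth_extension].  The anchors transform with the jacobian on one side and
  the transition matrices of [A], or their inverses, on the other side; the latter
  cancel in [pi] and in [E], which are therefore tensors on the base, [base_pi_trans]
  and [base_E_trans].  Finally the Schouten bracket is computed in coordinates from
  its definition as a derived bracket, [schoutenE]. *)

(** * Smooth functions *)

Section PartialDerivatives.
Variables (R : realType) (n : nat).
Implicit Types (U V : set 'rV[R]_n) (f g h : 'rV[R]_n -> R) (y : 'rV[R]_n).

Lemma near_eq_pderiv a f g y :
  (\forall z \near y, f z = g z) -> pderiv a f y = pderiv a g y.
Proof. exact: near_eq_derive. Qed.

Lemma eq_on_pderiv U a f g : open U -> (forall y, U y -> f y = g y) ->
  forall y, U y -> pderiv a f y = pderiv a g y.
Proof. by move=> oU fg y Uy; exact: (eq_iter_pderiv [:: a] oU fg). Qed.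

Lemma pderiv_cst a (c : R) y : pderiv a (fun=> c) y = 0.
Proof. exact: derive_cst. Qed.

Lemma pderivD a f g y : differentiable f y -> differentiable g y ->
  pderiv a (f + g) y = pderiv a f y + pderiv a g y.
Proof. by move=> df dg; rewrite /pderiv deriveD //; exact: diff_derivable. Qed.

Lemma pderivN a f y : differentiable f y -> pderiv a (- f) y = - pderiv a f y.
Proof. by move=> df; rewrite /pderiv deriveN //; exact: diff_derivable. Qed.

Lemma pderivM a f g y : differentiable f y -> differentiable g y ->
  pderiv a (f * g) y = pderiv a f y * g y + f y * pderiv a g y.
Proof.
move=> df dg; rewrite /pderiv deriveM; do ?exact: diff_derivable.
by rewrite addrC /GRing.scale /= [g y * _]mulrC.
Qed.

Lemma pderiv_sum a m (f : 'I_m -> 'rV[R]_n -> R) y :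
  (forall k, differentiable (f k) y) ->
  pderiv a (\sum_k f k) y = \sum_k pderiv a (f k) y.
Proof.
by move=> df; rewrite /pderiv derive_sum // => k; exact: diff_derivable.
Qed.

Lemma pderiv_coord a b y :
  pderiv a (fun z : 'rV[R]_n => z 0 b) y = (b == a)%:R.
Proof.
rewrite /pderiv; have := derive_rV (h := id) (y := y) (delta_mx 0 a).
rewrite derive_id => /(_ (fun b => differentiable_coord _ _ _)).
move=> /(congr1 (fun v : 'rV[R]_n => v 0 b)); rewrite !mxE summxE (bigD1 b) //=.
rewrite big1 ?addr0 => [|c cb].
  by rewrite !mxE !eqxx /= mulr1 => <-.
by rewrite !mxE eqxx /= eq_sym (negPf cb) mulr0.
Qed.

(** The iterated derivatives of a product or of a composite involve all the
  lower ones of both factors, so the closure properties of smoothness are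
  proved by induction on the order of differentiability. *)
Definition smooth_upto N U f : Prop := forall s : seq 'I_n, (size s <= N)%N ->
  forall y, U y -> differentiable (foldr (@pderiv R n) f s) y.

Lemma smooth_onP U f : smooth_on U f <-> forall N, smooth_upto N U f.
Proof.
split=> [sf N s _ y Uy|sf s y Uy]; first exact: sf.
exact: sf (leqnn (size s)) _ Uy.
Qed.

Lemma smooth_upto0 U f :
  smooth_upto 0 U f <-> forall y, U y -> differentiable f y.
Proof.
split=> [sf y Uy|df s]; first exact: (sf [::]).
by rewrite leqn0 => /nilP -> y; exact: df.
Qed.

Lemma smooth_uptoS N U f : smooth_upto N.+1 U f <->
  (forall y, U y -> differentiable f y) /\
  forall a, smooth_upto N U (pderiv a f).
Proof.
split=> [sf|[df sf]].
  split=> [y Uy|a s sN y Uy]; first exact: (sf [::]).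
  by have := sf (rcons s a); rewrite size_rcons foldr_rcons; exact.
elim/last_ind => [|s a _] sN y Uy; first exact: df.
by rewrite foldr_rcons; apply: sf Uy; rewrite size_rcons in sN.
Qed.

Lemma smooth_upto_diff N U f y : smooth_upto N U f -> U y -> differentiable f y.
Proof. by move=> sf Uy; exact: (sf [::]). Qed.

Lemma smooth_uptoW N U f : smooth_upto N.+1 U f -> smooth_upto N U f.
Proof. by move=> sf s sN y Uy; apply: sf => //; exact: leqW. Qed.

Lemma eq_smooth_upto N U f g : open U -> (forall y, U y -> f y = g y) ->
  smooth_upto N U f -> smooth_upto N U g.
Proof.
move=> oU fg sf s sN y Uy; apply: near_eq_differentiable (sf s sN y Uy).
have := open_nbhs_nbhs (conj oU Uy).
by apply: filterS => z; exact: eq_iter_pderiv.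
Qed.

Lemma smooth_upto_cst N U (c : R) : smooth_upto N U (fun=> c).
Proof.
elim: N c => [|N IH] c.
  by apply/smooth_upto0 => y _; exact: differentiable_cst.
apply/smooth_uptoS; split=> [y _|a]; first exact: differentiable_cst.
have -> : pderiv a (fun=> c) = (fun=> 0) by apply/funext => y; rewrite pderiv_cst.
exact: IH.
Qed.

Lemma smooth_uptoD N U f g : open U ->
  smooth_upto N U f -> smooth_upto N U g -> smooth_upto N U (f + g).
Proof.
move=> oU; elim: N f g => [|N IH] f g.
  move=> /smooth_upto0 df /smooth_upto0 dg; apply/smooth_upto0 => y Uy.
  exact: differentiableD (df _ Uy) (dg _ Uy).
move=> /smooth_uptoS[df sf] /smooth_uptoS[dg sg]; apply/smooth_uptoS.
split=> [y Uy|a]; first exact: differentiableD (df _ Uy) (dg _ Uy).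
apply: eq_smooth_upto (IH _ _ (sf a) (sg a)) => // y Uy.
by rewrite pderivD //; [exact: df|exact: dg].
Qed.

Lemma smooth_uptoM N U f g : open U ->
  smooth_upto N U f -> smooth_upto N U g -> smooth_upto N U (f * g).
Proof.
move=> oU; elim: N f g => [|N IH] f g.
  move=> /smooth_upto0 df /smooth_upto0 dg; apply/smooth_upto0 => y Uy.
  exact: differentiableM (df _ Uy) (dg _ Uy).
move=> sf' sg'; move: (sf') (sg').
move=> /smooth_uptoS[df sf] /smooth_uptoS[dg sg]; apply/smooth_uptoS.
split=> [y Uy|a]; first exact: differentiableM (df _ Uy) (dg _ Uy).
apply: eq_smooth_upto (smooth_uptoD oU (IH _ _ (sf a) (smooth_uptoW sg'))
  (IH _ _ (smooth_uptoW sf') (sg a))) => // y Uy.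
by rewrite pderivM //; [exact: df|exact: dg].
Qed.

Lemma smooth_on_diff U f y : smooth_on U f -> U y -> differentiable f y.
Proof. by move=> sf Uy; exact: (sf [::]). Qed.

Lemma smooth_on_cst U (c : R) : smooth_on U (fun=> c).
Proof. by apply/smooth_onP => N; exact: smooth_upto_cst. Qed.

Lemma smooth_onD U f g : open U ->
  smooth_on U f -> smooth_on U g -> smooth_on U (f + g).
Proof.
move=> oU /smooth_onP sf /smooth_onP sg.
by apply/smooth_onP => N; exact: smooth_uptoD.
Qed.

Lemma smooth_onM U f g : open U ->
  smooth_on U f -> smooth_on U g -> smooth_on U (f * g).
Proof.
move=> oU /smooth_onP sf /smooth_onP sg.
by apply/smooth_onP => N; exact: smooth_uptoM.
Qed.

Lemma smooth_onN U f : open U -> smooth_on U f -> smooth_on U (- f).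
Proof.
move=> oU sf; rewrite -mulN1r; apply: smooth_onM => //.
by apply: eq_smooth_on (smooth_on_cst (-1)).
Qed.

Lemma smooth_onB U f g : open U ->
  smooth_on U f -> smooth_on U g -> smooth_on U (f - g).
Proof. by move=> oU sf sg; apply: smooth_onD => //; exact: smooth_onN. Qed.

Lemma smooth_onMn U f m : open U -> smooth_on U f -> smooth_on U (f *+ m).
Proof.
move=> oU sf; rewrite -mulr_natr; apply: smooth_onM => //.
have -> : (m%:R : 'rV[R]_n -> R) = fun=> m%:R.
  elim: m => [|m IH]; first by apply/funext.
  by rewrite -natr1 IH; apply/funext => y; rewrite -[RHS]natr1.
exact: smooth_on_cst.
Qed.

Lemma smooth_on_sum (I : Type) (r : seq I) (P : pred I)
    (f : I -> 'rV[R]_n -> R) U : open U ->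
  (forall k, P k -> smooth_on U (f k)) -> smooth_on U (\sum_(k <- r | P k) f k).
Proof.
move=> oU sf; elim/big_ind: _ => //; first exact: (smooth_on_cst 0).
by move=> *; exact: smooth_onD.
Qed.

Lemma smooth_on_coord U b : smooth_on U (fun z : 'rV[R]_n => z 0 b).
Proof.
apply/smooth_onP => -[|N].
  by apply/smooth_upto0 => y _; exact: differentiable_coord.
apply/smooth_uptoS; split=> [y _|a]; first exact: differentiable_coord.
rewrite (_ : pderiv a _ = (fun=> (b == a)%:R)); first exact: smooth_upto_cst.
by apply/funext => y; rewrite pderiv_coord.
Qed.

Lemma smooth_on_local U f :
  (forall y, U y -> exists2 V, open V /\ V y & smooth_on V f) -> smooth_on U f.
Proof. by move=> loc s y /loc[V [_ Vy]]; exact. Qed.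

(** An infinitely differentiable function of one variable is given with its
  successive derivatives [phi 1, phi 2, ..] to keep the chain rule explicit. *)
Lemma smooth_on_comp1 U (phi : nat -> R -> R) f : open U ->
  (forall k (t : R), is_derive t 1 (phi k) (phi k.+1 t)) ->
  smooth_on U f -> smooth_on U (phi 0 \o f).
Proof.
move=> oU dphi /smooth_onP sf; apply/smooth_onP.
have diffphi k (t : R) : differentiable (phi k) t.
  by apply/derivable1_diffP; have [] := dphi k t.
suff smooth_phi N k : smooth_upto N U (phi k \o f) by move=> N; exact: smooth_phi.
elim: N k => [|N IH] k.
  apply/smooth_upto0 => y Uy; apply: differentiable_comp => //.
  exact: smooth_upto_diff (sf 0%N) Uy.
apply/smooth_uptoS; split=> [y Uy|a].
  by apply: differentiable_comp => //; exact: smooth_upto_diff (sf 0%N) Uy.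
have /smooth_uptoS[_ sdf] := sf N.+1.
apply: eq_smooth_upto (smooth_uptoM oU (IH k.+1) (sdf a)) => // y Uy.
have df := smooth_upto_diff (sf 0%N) Uy.
have [_ dkE] := dphi k (f y).
rewrite /pderiv [in RHS]deriveE; last exact: differentiable_comp.
rewrite diff_comp //= diff1E // derive1E dkE -deriveE //.
by rewrite /GRing.scale /= [RHS]mulrC.
Qed.

End PartialDerivatives.

Lemma smooth_upto_comp (R : realType) (m n N : nat) (V : set 'rV[R]_m)
    (U : set 'rV[R]_n) (h : 'rV[R]_m -> 'rV[R]_n) (g : 'rV[R]_n -> R) :
  open V -> (forall y, V y -> U (h y)) ->
  (forall b, smooth_on V (fun z => h z 0 b)) -> smooth_upto N U g ->
  smooth_upto N V (g \o h).
Proof.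
move=> oV VU sh; have dh y : V y -> differentiable h y.
  by move=> Vy; apply: differentiable_rV => b; exact: smooth_on_diff Vy.
elim: N g => [|N IH] g sg.
  apply/smooth_upto0 => y Vy; apply: differentiable_comp; first exact: dh.
  exact: smooth_upto_diff sg (VU _ Vy).
apply/smooth_uptoS; split=> [y Vy|a].
  apply: differentiable_comp; first exact: dh.
  exact: smooth_upto_diff sg (VU _ Vy).
have /smooth_uptoS[_ sdg] := sg.
have : smooth_upto N V (\sum_b pderiv a (fun z => h z 0 b) * (pderiv b g \o h)).
  elim/big_ind: _; first exact: (smooth_upto_cst 0).
    by move=> *; exact: smooth_uptoD.
  move=> b _; apply: smooth_uptoM => //; last exact: IH.
  exact: (smooth_onP _ _).1 (smooth_on_pderiv _ (sh b)) N.
apply: eq_smooth_upto => // y Vy; rewrite fct_sumE pderiv_comp //.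
  by move=> b; exact: smooth_on_diff Vy.
exact: smooth_upto_diff sg (VU _ Vy).
Qed.

Lemma smooth_on_comp (R : realType) (m n : nat) (V : set 'rV[R]_m)
    (U : set 'rV[R]_n) (h : 'rV[R]_m -> 'rV[R]_n) (g : 'rV[R]_n -> R) :
  open V -> (forall y, V y -> U (h y)) ->
  (forall b, smooth_on V (fun z => h z 0 b)) -> smooth_on U g ->
  smooth_on V (g \o h).
Proof.
move=> oV VU sh /smooth_onP sg; apply/smooth_onP => N.
exact: smooth_upto_comp VU sh (sg N).
Qed.

(** * Flat functions and test functions *)

Section Flat.
Variable R : realType.
Implicit Types (p : {poly R}) (t x : R).

(** The polynomial factor in [1/t] makes the family stable under differentiation,
  so that its members are smooth. *)
Definition flat p t : R := if 0 < t then p.[t^-1] * expR (- t^-1) else 0.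

(** The [m]-th power of [x / m <= 1 + x / m <= expR (x / m)]. *)
Lemma exprn_le_expR m x : 0 <= x -> x ^+ m <= m%:R ^+ m * expR x.
Proof.
move=> x0; case: m => [|m]; first by rewrite !expr0 mul1r -expR0 ler_expR.
have -> : expR x = expR (x / m.+1%:R) ^+ m.+1.
  by rewrite -expRM_natl mulrC divfK.
rewrite -exprMn lerXn2r ?nnegrE ?mulr_ge0 ?expR_ge0 //.
rewrite mulrC -ler_pdivrMr ?ltr0Sn //.
by apply: le_trans (expR_ge1Dx _); rewrite lerDr.
Qed.

Lemma horner_expRN_bounded p :
  exists C : R, forall x : R, 0 <= x -> `|p.[x] * expR (- x) : R| <= C.
Proof.
exists (\sum_(i < size p) `|p`_i| * i%:R ^+ i) => x x0.
rewrite normrM (ger0_norm (expR_ge0 _)) expRN ler_pdivrMr ?expR_gt0 //.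
rewrite horner_coef (le_trans (ler_norm_sum _ _ _)) // mulr_suml ler_sum // => i _.
rewrite normrM -mulrA ler_wpM2l // ger0_norm ?exprn_ge0 //.
exact: exprn_le_expR.
Qed.

(** A function that is quadratically small at 0 has derivative 0 there; this is
  the case of [flat p], which is [t ^ 2] times a bounded function for [t > 0]. *)
Lemma is_derive_quadratic (f : R -> R) (C : R) :
  (forall h : R, `|f h : R| <= C * h ^+ 2) -> is_derive (0 : R) 1 f 0.
Proof.
move=> fC; have f0 : f 0 = 0.
  by apply/normr0_eq0/le_anti; rewrite normr_ge0 andbT (le_trans (fC 0)) // expr0n mulr0.
have C0 : 0 <= C by have := le_trans (normr_ge0 _) (fC 1); rewrite expr1n mulr1.
have cvg0 : ((fun h : R => h^-1 *: ((f \o shift 0) (h *: 1) - f 0)) @ 0^' --> (0 : R))%classic.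
  apply/cvgr0Pnorm_lt => e e0; near=> h.
  have h0 : h != 0 by near: h; exact: nbhs_dnbhs_neq.
  rewrite /= f0 subr0 addr0 normrZ [_ *: 1]mulr1 normfV mulrC.
  rewrite ltr_pdivrMr ?normr_gt0 //; apply: (le_lt_trans (fC h)).
  rewrite -real_normK ?num_real // expr2 mulrA ltr_pM2r ?normr_gt0 //.
  apply: le_lt_trans (_ : (C + 1) * `|h| < e).
    by rewrite ler_wpM2r // lerDl.
  rewrite mulrC -ltr_pdivlMr ?ltr_pwDr //.
  near: h; apply: dnbhs0_lt; rewrite divr_gt0 // ltr_pwDr //.
by apply: DeriveDef; [apply/cvg_ex; exists 0|exact: cvg_lim cvg0].
Unshelve. all: by end_near. Qed.

Lemma is_derive_flat p t :
  is_derive t 1 (flat p) (flat ('X^2 * (p - p^`())) t).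
Proof.
case: (ltgtP t 0) => [t0|t0|->].
- have -> : flat ('X^2 * (p - p^`())) t = 0 by rewrite /flat ltNge ltW.
  apply: (@near_eq_is_derive _ _ _ (fun=> 0)).
  near=> z; rewrite /flat ltNge ltW //.
  by near: z; exact: lt_nbhsl.
- have tn0 : t != 0 by rewrite gt_eqF.
  apply: (@near_eq_is_derive _ _ _
    ((horner p \o GRing.inv) * (expR \o (-%R \o GRing.inv)))).
    near=> z; rewrite /flat ifT //.
    by near: z; exact: lt_nbhsr.
  have dV : is_derive t 1 (GRing.inv : R -> R) (- t^-2).
    have := @is_deriveV _ id t 1 1 tn0 (is_derive_id _ _).
    by rewrite /GRing.scale /= mulr1.
  have dN : is_derive t 1 (-%R \o GRing.inv : R -> R) (t^-2).
    have := @is_deriveN _ _ _ _ _ _ _ dV; rewrite opprK; exact.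
  have dE : is_derive t 1 (expR \o (-%R \o GRing.inv)) (expR (- t^-1) * t^-2).
    exact: is_derive1_comp.
  have dp : is_derive (t^-1) 1 (horner p) p^`().[t^-1].
    apply: DeriveDef; first exact: derivable_horner.
    by rewrite -derive1E -derivE.
  have dP : is_derive t 1 (horner p \o GRing.inv) (p^`().[t^-1] * - t^-2).
    exact: is_derive1_comp.
  apply: is_derive_eq.
  rewrite /flat t0 !hornerE /GRing.scale /= exprVn; ring.
- have -> : flat ('X^2 * (p - p^`())) 0 = 0 by rewrite /flat ltxx.
  have [C Cq] := horner_expRN_bounded ('X^2 * p).
  have C0 : 0 <= C := le_trans (normr_ge0 _) (Cq 0 (lexx _)).
  apply: (@is_derive_quadratic _ C) => h; rewrite /flat.
  case: ltP => h0; last by rewrite normr0 mulr_ge0 // sqr_ge0.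
  have hV : 0 <= h^-1 by rewrite invr_ge0 ltW.
  have : `|p.[h^-1] * expR (- h^-1)| / h ^+ 2 <= C.
    apply: le_trans (Cq _ hV); rewrite !hornerE exprVn.
    rewrite -[_ * _ * expR _]mulrA [leRHS]normrM.
    by rewrite (ger0_norm (_ : 0 <= h ^- 2)) ?invr_ge0 ?sqr_ge0 // mulrC.
  by rewrite ler_pdivrMr ?exprn_gt0.
Unshelve. all: by end_near. Qed.

Definition flat_step : R -> R := flat 1.

Lemma flat_step_gt0 t : 0 < t -> 0 < flat_step t.
Proof. by move=> t0; rewrite /flat_step /flat t0 hornerE mul1r expR_gt0. Qed.

Lemma flat_step_le0 t : t <= 0 -> flat_step t = 0.
Proof. by move=> t0; rewrite /flat_step /flat ltNge t0. Qed.

Lemma flat_step_homo t t' : t <= t' -> flat_step t <= flat_step t'.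
Proof.
move=> tt'; have [t0|t0] := leP t 0.
  rewrite flat_step_le0 //; have [/flat_step_le0->//|t'0] := leP t' 0.
  exact/ltW/flat_step_gt0.
have t'0 := lt_le_trans t0 tt'.
by rewrite /flat_step /flat t0 t'0 !hornerE ?mul1r ler_expR lerN2 lef_pV2.
Qed.

Lemma smooth_on_flat_step n (U : set 'rV[R]_n) (f : 'rV[R]_n -> R) : open U ->
  smooth_on U f -> smooth_on U (flat_step \o f).
Proof.
move=> oU sf.
apply: (smooth_on_comp1 (phi := fun k =>
  flat (iter k (fun p => 'X^2 * (p - p^`())) 1))) => // k t.
exact: is_derive_flat.
Qed.

(** The inner step function vanishes where [|z - y|^2 <= r^2 / 4], which makes
  the outer one constant there; its value where [|z - y|^2 >= r^2] is large
  enough to bring the argument of the outer one below 0.  The norm is the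
  Euclidean one, whose square is smooth; it dominates the norm of the ball. *)
Lemma bump_exists n (y : 'rV[R]_n) (r : R) : 0 < r ->
  exists chi : 'rV[R]_n -> R, [/\ smooth_on [set: 'rV[R]_n] chi,
    (\forall z \near y, chi z = 1) &
    forall z, ~ closed_ball y r z -> chi z = 0].
Proof.
move=> r0.
pose q (z : 'rV[R]_n) : R := \sum_b (z 0 b - y 0 b) ^+ 2.
pose w (z : 'rV[R]_n) : R := flat_step (4 * q z - r ^+ 2).
pose M := flat_step (3 * r ^+ 2).
have M0 : 0 < M by rewrite flat_step_gt0 // mulr_gt0 // exprn_gt0.
pose chi (z : 'rV[R]_n) : R := flat_step (M - w z) / flat_step M.
have sq : smooth_on [set: 'rV[R]_n] q.
  have -> : q = \sum_b ((fun z : 'rV[R]_n => z 0 b) - (fun=> y 0 b)) *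
                       ((fun z : 'rV[R]_n => z 0 b) - (fun=> y 0 b)).
    by apply/funext => z; rewrite fct_sumE; apply: eq_bigr => b _.
  apply: smooth_on_sum => [|b _]; first exact: openT.
  by apply: smooth_onM; [exact: openT| |]; apply: smooth_onB;
    do ?[exact: openT|exact: smooth_on_coord|exact: smooth_on_cst].
exists chi; split.
- have -> : chi = (flat_step \o ((fun=> M) - (flat_step \o
      ((fun=> 4) * q - (fun=> r ^+ 2))))) * (fun=> (flat_step M)^-1) by [].
  have oT := @openT 'rV[R]_n.
  apply: smooth_onM => //; last exact: smooth_on_cst.
  apply: smooth_on_flat_step => //.
  apply: smooth_onB => //; first exact: smooth_on_cst.
  apply: smooth_on_flat_step => //.
  apply: smooth_onB => //; last exact: smooth_on_cst.
  by apply: smooth_onM => //; exact: smooth_on_cst.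
- have qc : {for y, continuous q}.
    by apply: differentiable_continuous; exact: smooth_on_diff sq _.
  have qy : q y = 0 by rewrite /q big1 // => b _; rewrite subrr expr0n.
  have r4 : 0 < r ^+ 2 / 4 by rewrite divr_gt0 // exprn_gt0.
  have : \forall z \near y, q z < r ^+ 2 / 4.
    by apply: (qc [set t | t < r ^+ 2 / 4]%classic); rewrite qy; exact: lt_nbhsl.
  apply: filterS => z qz; rewrite /chi /w [flat_step (4 * _ - _)]flat_step_le0.
    by rewrite subr0 divff // gt_eqF // flat_step_gt0.
  by rewrite subr_le0 mulrC -ler_pdivlMr // ltW.
- move=> z nz; rewrite /chi [X in X / _]flat_step_le0 ?mul0r // subr_le0.
  apply: flat_step_homo.
  suff : r ^+ 2 <= q z by move=> rq; lra.
  apply: contra_notT nz; rewrite -ltNge => qr.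
  rewrite closed_ballE // /closed_ball_ /= /Num.Def.normr /= mx_normrE.
  apply: (bigmax_le _ (ltW r0)) => -[i b] _ /=; rewrite ord1 !mxE -normrN opprB.
  have {qr} : (z 0 b - y 0 b) ^+ 2 <= r ^+ 2.
    apply: le_trans (ltW qr); rewrite /q (bigD1 b) //= lerDl sumr_ge0 // => c _.
    exact: sqr_ge0.
  by move: (_ - _) => t t2; rewrite ler_norml; apply/andP; split; nra.
Qed.

End Flat.

(** * Symmetry of the second derivatives *)

Section Schwarz.
Variables (R : realType) (n : nat).
Implicit Types (f : 'rV[R]_n -> R) (y : 'rV[R]_n).

Lemma is_derive_line f (y v : 'rV[R]_n) (t : R) :
  differentiable f (y + t *: v) ->
  is_derive t 1 (fun s : R => f (y + s *: v)) ('D_v f (y + t *: v)).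
Proof.
move=> /(@diff_derivable _ _ _ _ _ v) df.
have quotE : (fun h : R => h^-1 *: (((fun s : R => f (y + s *: v)) \o shift t)
      (h *: 1) - f (y + t *: v))) =
    (fun h : R => h^-1 *: ((f \o shift (y + t *: v)) (h *: v) - f (y + t *: v))).
  apply/funext => h; rewrite /= [h *: 1]mulr1 scalerDl.
  by rewrite [h *: v + (y + _)]addrCA [h *: v + t *: v]addrC.
by apply: DeriveDef; rewrite /derivable /derive quotE.
Qed.

(** The second difference is the increment over [0, h] of
  [t |-> f (y + h eb + t ea) - f (y + t ea)]; the mean value theorem reduces it to
  an increment of [pderiv a f], and the differentiability of the latter at [y]
  suffices to estimate it. *)
Lemma second_difference f (a b : 'I_n) y :
  (\forall z \near y, differentiable f z) -> differentiable (pderiv a f) y ->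
  forall e : R, 0 < e -> exists2 k : R, 0 < k & forall h : R, 0 < h -> h < k ->
  `|f (y + h *: delta_mx 0 a + h *: delta_mx 0 b) - f (y + h *: delta_mx 0 a)
    - f (y + h *: delta_mx 0 b) + f y - h ^+ 2 * pderiv b (pderiv a f) y|
  <= e * h ^+ 2.
Proof.
move=> df dg e e0; set ea := delta_mx 0 a; set eb := delta_mx 0 b.
set g := pderiv a f.
pose N : R := `|ea| + `|eb| + 1.
have N0 : 0 < N by rewrite ltr_pwDr // addr_ge0.
have [_ gE] := (diff_locallyP _ _).1 dg.
have e2 : 0 < e / (2 * N) by rewrite divr_gt0 // mulr_gt0.
have /eqaddoP/(_ _ e2) := gE.
move/nbhs_norm0P => [k1 /= k10 k1P].
have [k2 /= k20 k2P] : exists2 k2 : R, 0 < k2 &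
    forall z, `|z| < k2 -> differentiable f (y + z).
  move: df; rewrite (near_shift 0) subr0 => /nbhs_norm0P[k /= k0 kP].
  by exists k => // z /kP; rewrite /= addrC.
exists (Num.min k1 k2 / N) => [|h h0 hk].
  by rewrite divr_gt0 // lt_min k10.
have {hk} [hk1 hk2] : N * h < k1 /\ N * h < k2.
  by move: hk; rewrite ltr_pdivlMr // mulrC lt_min => /andP[].
have small (c s : R) : 0 <= c <= h -> 0 <= s <= h -> `|c *: ea + s *: eb| <= N * h.
  move=> /andP[c0 ch] /andP[s0 sh].
  apply: le_trans (ler_normD _ _) _; rewrite !normrZ !ger0_norm //.
  have := normr_ge0 ea; have := normr_ge0 eb; rewrite /N.
  by move: (`|ea|) (`|eb|) => A B; nra.
have rem (c s : R) : 0 <= c <= h -> 0 <= s <= h ->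
    `|g (y + (c *: ea + s *: eb)) - g y - 'd g y (c *: ea + s *: eb)|
    <= e / 2 * h.
  move=> ch sh; have := small _ _ ch sh; set z := _ + _ => zN.
  have := k1P z (le_lt_trans zN hk1); rewrite !fctE /= [z + y]addrC opprD addrA.
  move/le_trans; apply; apply: le_trans (_ : e / (2 * N) * (N * h) <= _).
    by rewrite ler_wpM2l // ltW.
  by rewrite le_eqVlt; apply/orP; left; apply/eqP; field; rewrite gt_eqF.
pose phi (t : R) := f (y + h *: eb + t *: ea) - f (y + t *: ea).
have dphi (t : R) : 0 <= t <= h -> is_derive t 1 phi
    (g (y + (t *: ea + h *: eb)) - g (y + (t *: ea + 0 *: eb))).
  move=> th; have hh : 0 <= h <= h by rewrite lexx ltW.
  have d1 := k2P _ (le_lt_trans (small _ _ th hh) hk2).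
  have z0 : 0 <= (0 : R) <= h by rewrite lexx ltW.
  have d2 := k2P _ (le_lt_trans (small _ _ th z0) hk2).
  rewrite scale0r addr0 in d2 *; rewrite [t *: ea + _]addrC addrA in d1 *.
  apply: is_deriveB; exact: is_derive_line.
have [||c ch phiE] := @MVT _ phi
    (fun t => g (y + (t *: ea + h *: eb)) - g (y + (t *: ea + 0 *: eb))) 0 h h0.
- by move=> t /[!in_itv] /= /andP[/ltW t0 /ltW th]; apply: dphi; rewrite t0.
- apply: continuous_in_subspaceT => t /[!inE] /=; rewrite in_itv /= => th.
  apply/differentiable_continuous/derivable1_diffP.
  by have [] := dphi _ th.
move: ch; rewrite in_itv /= => /andP[/ltW c0 /ltW ch].
have cc : 0 <= c <= h by rewrite c0.
have hh : 0 <= h <= h by rewrite lexx ltW.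
have z0 : 0 <= (0 : R) <= h by rewrite lexx ltW.
have := rem _ _ cc hh; have := rem _ _ cc z0.
have -> : pderiv b g y = 'd g y eb by rewrite /pderiv deriveE.
rewrite !linearD !linearZ /= scale0r addr0.
move: phiE; rewrite /phi !scale0r !addr0 subr0 => phiE.
have -> : f (y + h *: ea + h *: eb) - f (y + h *: ea) - f (y + h *: eb) + f y =
   f (y + h *: eb + h *: ea) - f (y + h *: ea) - (f (y + h *: eb) - f y).
  by rewrite [y + h *: ea + h *: eb]addrAC; ring.
rewrite phiE.
move: (g (y + c *: ea)) (g (y + (c *: ea + h *: eb))) ('d g y ea) ('d g y eb).
move=> G1 G2 A B; rewrite /GRing.scale /= !ler_norml => /andP[H1 H2] /andP[H3 H4].
by apply/andP; split; nra.
Qed.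

(** The second difference is symmetric in [a] and [b], and both mixed derivatives
  approximate it up to [o(h ^ 2)]. *)
Lemma pderivC (U : set 'rV[R]_n) f a b y : open U -> smooth_on U f -> U y ->
  pderiv a (pderiv b f) y = pderiv b (pderiv a f) y.
Proof.
move=> oU sf Uy.
have df : \forall z \near y, differentiable f z.
  have := open_nbhs_nbhs (conj oU Uy).
  by apply: filterS => z; exact: smooth_on_diff sf.
have dp c : differentiable (pderiv c f) y := sf [:: c] _ Uy.
apply/eqP; rewrite -subr_eq0 -normr_le0; apply/ler_addgt0Pr => e e0.
have e2 : 0 < e / 2 by rewrite divr_gt0.
have [k1 k10 H1] := second_difference b df (dp a) e2.
have [k2 k20 H2] := second_difference a df (dp b) e2.
pose h := Num.min k1 k2 / 2.
have h0 : 0 < h by rewrite divr_gt0 // lt_min k10.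
have [hk1 hk2] : h < k1 /\ h < k2.
  have : h < Num.min k1 k2 by rewrite ltr_pdivrMr // mulr_natr mulr2n ltrDl lt_min k10.
  by rewrite lt_min => /andP[].
have := H1 _ h0 hk1; have := H2 _ h0 hk2.
rewrite [y + h *: delta_mx 0 b + _]addrAC.
move: (f _) (f _) (f _) (f y) (pderiv b _ y) (pderiv a _ y) => F1 F2 F3 F4 P Q.
rewrite add0r !ler_norml => /andP[A1 A2] /andP[A3 A4].
have h2 : 0 < h ^+ 2 by rewrite exprn_gt0.
by apply/andP; split; rewrite -(ler_pM2r h2); nra.
Qed.

End Schwarz.

(** * Global functions with a prescribed germ *)

Section Extension.
Variables (R : realType) (n : nat) (M : manifold R n).

(** A smooth function on a chart domain is cut off by a bump function whose
  support corresponds to a compact, hence closed, subset of [M]; it can then be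
  extended by 0. *)
Lemma smooth_extension (i : chart_index M) (y : 'rV[R]_n) (g : 'rV[R]_n -> R) :
  chart_img i y -> smooth_on (chart_img i) g ->
  exists2 f : M -> R, smooth f &
    \forall z \near y, (f \o chart_inv i) z = g z.
Proof.
move=> Uy sg; have oU := @chart_img_open _ _ M i.
have [r r0 rU] : exists2 r : R, 0 < r & (closed_ball y r `<=` chart_img i)%classic.
  have /nbhs_closedballP[r rU] := open_nbhs_nbhs (conj oU Uy).
  by exists r%:num.
have [chi [schi chi1 chi0]] := bump_exists y r0.
pose K := (chart_inv i @` closed_ball y r)%classic.
have cK : closed K.
  apply: compact_closed; first exact: mhausdorff.
  apply: continuous_compact; last first.
    apply: bounded_closed_compact; last exact: closed_ball_closed.
    exists (`|y| + r); split; first exact: num_real.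
    move=> N yrN z /=; rewrite closed_ballE // /closed_ball_ /= => yz.
    apply: le_trans (ltW yrN); rewrite -[z](subKr y).
    by apply: le_trans (ler_normB _ _) _; apply: lerD.
  apply: continuous_in_subspaceT => z /[!inE] /rU.
  exact: chart_inv_continuous.
pose f (x : M) := if `[< chart_dom i x >] then chi (chart i x) * g (chart i x) else 0.
have fE x : chart_dom i x -> f x = chi (chart i x) * g (chart i x).
  by move=> xi; rewrite /f asboolT.
have f0 x : ~ K x -> f x = 0.
  rewrite /f; case: asboolP => // xi Kx; rewrite chi0 ?mul0r // => cx.
  by apply: Kx; exists (chart i x) => //; rewrite chartK.
exists f.
  move=> j; apply: smooth_on_local => _ [x xj <-].
  have [xi|xi] := pselect (chart_dom i x).
    exists (chart j @` (chart_dom i `&` chart_dom j))%classic.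
      by split; [exact: open_chart_overlap|exists x].
    apply: (@eq_smooth_on _ _ _ ((chi * g) \o (chart i \o chart_inv j))).
    - exact: open_chart_overlap.
    - by move=> _ [z [zi zj] <-] /=; rewrite chartK // fE.
    - apply: smooth_on_comp (smooth_onM _ (smooth_on_sub _ schi) sg) => //.
      + exact: open_chart_overlap.
      + by move=> _ [z [zi zj] <-] /=; rewrite chartK //; exists z.
      + by move=> b; rewrite setIC; exact: chart_smooth.
  (* Off the domain of the chart, [f] vanishes on the complement of [K]. *)
  exists (chart_img j `&` chart_inv j @^-1` ~` K)%classic.
    split; last first.
      split; first by exists x.
      rewrite /= chartK // => -[z /rU zU xE]; apply: xi.
      by move: zU xE => [x' xi' <-]; rewrite chartK // => <-.
    rewrite openE => w [wj nKw]; apply: filterI.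
      exact: open_nbhs_nbhs (conj (@chart_img_open _ _ M j) wj).
    apply: (@chart_inv_continuous _ _ M j _ wj).
    by apply: open_nbhs_nbhs; split => //; exact: closed_openC.
  apply: (@eq_smooth_on _ _ _ (fun=> 0)); last exact: smooth_on_cst.
    rewrite openE => w [wj nKw]; apply: filterI.
      exact: open_nbhs_nbhs (conj (@chart_img_open _ _ M j) wj).
    apply: (@chart_inv_continuous _ _ M j _ wj).
    by apply: open_nbhs_nbhs; split => //; exact: closed_openC.
  by move=> w [_ nKw] /=; rewrite f0.
have := open_nbhs_nbhs (conj oU Uy); move: chi1; apply: filterS2.
move=> w chiw [x xi xw]; rewrite -xw in chiw *.
by rewrite /= chartK // fE // chiw mul1r.
Qed.

End Extension.

(** * The algebra of a coordinate domain *)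

Section Inversions.
Variable N : nat.
Implicit Types (S T W : {set 'I_(N + N)}) (s t : 'I_(N + N)).

Lemma inversions0l T : @inversions N finset.set0 T = 0%N.
Proof. by apply: eq_card0 => st; rewrite !inE. Qed.

Lemma inversions0r S : @inversions N S finset.set0 = 0%N.
Proof. by apply: eq_card0 => st; rewrite !inE andbF. Qed.

Lemma inversionsUl S S' T : [disjoint S & S'] ->
  @inversions N (S :|: S') T = (inversions S T + inversions S' T)%N.
Proof.
move=> dS; rewrite /inversions -[RHS]cardsUI.
rewrite [X in _ = (_ + X)%N]eq_card0 => [|[s t]].
  rewrite [RHS]addn0; apply: eq_card => -[s t]; rewrite !inE /=.
  by case: (s \in S); case: (s \in S') => //=; rewrite ?orbb ?orbF.
rewrite !inE /=; have := disjointFr dS (x := s).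
by case: (s \in S) => [->|]; rewrite ?andbF.
Qed.

Lemma inversionsUr S T T' : [disjoint T & T'] ->
  @inversions N S (T :|: T') = (inversions S T + inversions S T')%N.
Proof.
move=> dT; rewrite /inversions -[RHS]cardsUI.
rewrite [X in _ = (_ + X)%N]eq_card0 => [|[s t]].
  rewrite [RHS]addn0; apply: eq_card => -[s t]; rewrite !inE /=.
  by case: (s \in S); case: (t \in T); case: (t \in T'); rewrite /= ?orbb ?orbF.
rewrite !inE /=; have := disjointFr dT (x := t).
by case: (t \in T) => [->|_]; rewrite /= ?andbF.
Qed.

Lemma inversions11 s t : @inversions N [set s] [set t] = (t < s)%N.
Proof.
rewrite /inversions; case: ltnP => ts.
  rewrite (_ : [set _ in _ | _] = [set (s, t)]) ?cards1 //.
  apply/finset.setP => -[a b]; rewrite !inE /= xpair_eqE.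
  by case: eqP => //= ->; case: eqP => //= ->.
apply: eq_card0 => -[a b]; rewrite !inE /=.
by case: eqP => //= ->; case: eqP => //= ->; rewrite ltnNge ts.
Qed.

(** Each pair in [S * T] is an inversion for exactly one of the two orders. *)
Lemma inversionsC S T : [disjoint S & T] ->
  (@inversions N S T + inversions T S = #|S| * #|T|)%N.
Proof.
move=> dST; rewrite -cardsX.
rewrite -[RHS](cardsID [set st : 'I_(N + N) * 'I_(N + N) | (st.2 < st.1)%N]).
congr (_ + _)%N; first by apply: eq_card => st; rewrite !inE.
have swapI : injective (fun st : 'I_(N + N) * 'I_(N + N) => (st.2, st.1)).
  by move=> [a b] [c e] [-> ->].
rewrite /inversions -[LHS](card_imset _ swapI).
apply: eq_card => -[s t]; rewrite !inE /=; apply/imsetP/idP.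
  move=> [[a b]]; rewrite !inE /= => /andP[/andP[aT bS] ab] [-> ->].
  by rewrite aT bS -leqNgt ltnW.
move=> /andP[]; rewrite -leqNgt => st /andP[sS tT].
exists (t, s) => //; rewrite !inE /= tT sS /= ltn_neqAle st andbT.
apply: contraTneq tT => /val_inj <-.
by rewrite (disjointFr dST).
Qed.

End Inversions.

Section GradedAlgebraTheory.
Variables (K : comNzRingType) (n d : nat).
Local Notation G := (galg K n d).
Local Notation oset := {set 'I_(d + d)}.
Implicit Types (u v w : G) (S T W : oset) (s t : 'I_(d + d)) (c : K).

Lemma gmulE u v W : (u ** v) W =
  \sum_(S : oset | S \subset W) (-1) ^+ inversions S (W :\: S) * (u S * v (W :\: S)).
Proof. by rewrite ffunE. Qed.

Lemma scale_signE m (p : mpoly n K) : (-1) ^+ m *: p = (-1) ^+ m * p.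
Proof. by rewrite -[in LHS]signr_odd -[in RHS]signr_odd scaler_sign mulr_sign. Qed.

Lemma gmulDl u u' v : (u + u') ** v = u ** v + u' ** v.
Proof.
apply/ffunP => W; rewrite [RHS]ffunE !gmulE -big_split /=; apply: eq_bigr => S _.
by rewrite ffunE mulrDl mulrDr.
Qed.

Lemma gmulDr u v v' : u ** (v + v') = u ** v + u ** v'.
Proof.
apply/ffunP => W; rewrite [RHS]ffunE !gmulE -big_split /=; apply: eq_bigr => S _.
by rewrite ffunE mulrDr mulrDr.
Qed.

Lemma gmulZl c u v : (c *: u) ** v = c *: (u ** v).
Proof.
apply/ffunP => W; rewrite [RHS]ffunE !gmulE scaler_sumr; apply: eq_bigr => S _.
by rewrite ffunE scalerAr -scalerAl.
Qed.

Lemma gmulZr c u v : u ** (c *: v) = c *: (u ** v).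
Proof.
apply/ffunP => W; rewrite [RHS]ffunE !gmulE scaler_sumr; apply: eq_bigr => S _.
by rewrite ffunE -!scalerAr.
Qed.

Lemma gmulNl u v : (- u) ** v = - (u ** v).
Proof. by rewrite -scaleN1r gmulZl scaleN1r. Qed.

Lemma gmulNr u v : u ** (- v) = - (u ** v).
Proof. by rewrite -scaleN1r gmulZr scaleN1r. Qed.

Lemma gmul0l v : 0 ** v = 0.
Proof. by have := gmulZl 0 0 v; rewrite !scale0r. Qed.

Lemma gmul0r u : u ** 0 = 0.
Proof. by have := gmulZr 0 u 0; rewrite !scale0r. Qed.

Lemma gmul_suml (I : Type) (r : seq I) (P : pred I) (F : I -> G) v :
  (\sum_(i <- r | P i) F i) ** v = \sum_(i <- r | P i) F i ** v.
Proof. by elim/big_rec2: _ => [|i x y _ <-]; rewrite ?gmul0l ?gmulDl. Qed.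

Lemma gmul_sumr (I : Type) (r : seq I) (P : pred I) (F : I -> G) u :
  u ** (\sum_(i <- r | P i) F i) = \sum_(i <- r | P i) u ** F i.
Proof. by elim/big_rec2: _ => [|i x y _ <-]; rewrite ?gmul0r ?gmulDr. Qed.

(** The elements without odd generators act coefficientwise. *)
Definition gpoly (q : mpoly n K) : G := [ffun S : oset => if S == finset.set0 then q else 0].

Lemma gpoly_mull q u W : (gpoly q ** u) W = q * u W.
Proof.
rewrite gmulE (bigD1 finset.set0) ?finset.sub0set //= big1 ?addr0 => [|S /andP[_ S0]].
  by rewrite finset.setD0 inversions0l mul1r ffunE eqxx.
by rewrite ffunE (negPf S0) mul0r mulr0.
Qed.

Lemma gpoly_mulr q u W : (u ** gpoly q) W = q * u W.
Proof.
rewrite gmulE (bigD1 W) //= big1 ?addr0 => [|S /andP[SW /negP nSW]].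
  by rewrite finset.setDv inversions0r mul1r ffunE eqxx mulrC.
rewrite ffunE ifF ?mulr0 //; apply/negP => /eqP WS0; apply: nSW.
by rewrite finset.eqEsubset SW -finset.setD_eq0 WS0 eqxx.
Qed.

Lemma gconst_mull c u : gconst n d c ** u = c *: u.
Proof.
apply/ffunP => W; rewrite (gpoly_mull (mpolyC n c)) ffunE.
by rewrite mul_mpolyC.
Qed.

Lemma gconst_mulr c u : u ** gconst n d c = c *: u.
Proof.
apply/ffunP => W; rewrite (gpoly_mulr (mpolyC n c)) ffunE.
by rewrite mul_mpolyC.
Qed.

Lemma gmul1l u : gconst n d 1 ** u = u.
Proof. by rewrite gconst_mull scale1r. Qed.

Lemma gmul1r u : u ** gconst n d 1 = u.
Proof. by rewrite gconst_mulr scale1r. Qed.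

(** Both bracketings sum over the ordered partitions of an index set into three
  blocks, with a sign that counts the inversions between the blocks. *)
Lemma gmulA u v w : u ** (v ** w) = u ** v ** w.
Proof.
apply/ffunP => W; rewrite !gmulE.
under eq_bigr => S SW do rewrite gmulE mulr_sumr mulr_sumr.
under [RHS]eq_bigr => S SW do rewrite gmulE mulr_suml mulr_sumr.
rewrite [RHS](exchange_big_dep (fun S : oset => S \subset W)) /=; last first.
  by move=> V S VW SV; exact: fintype.subset_trans SV VW.
apply: eq_bigr => S SW.
rewrite [RHS](reindex_onto (fun T => S :|: T) (fun V => V :\: S)) /=; last first.
  by move=> V /andP[_ SV]; rewrite -[RHS](finset.setID V S) (finset.setIidPr SV).
rewrite [RHS](eq_bigl (fun T : oset => T \subset W :\: S)) => [|T]; last first.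
  rewrite finset.subUset SW finset.subsetUl andbT /= finset.subsetD.
  rewrite finset.setDUl finset.setDv finset.set0U; congr (_ && _).
  exact/eqP/finset.setDidPl.
apply: eq_bigr => T TWS; have := TWS; rewrite finset.subsetD => /andP[TW dTS].
have -> : (S :|: T) :\: S = T.
  by rewrite finset.setDUl finset.setDv finset.set0U; apply/finset.setDidPl.
have -> : W :\: (S :|: T) = W :\: S :\: T by rewrite finset.setDDl.
have {1}-> : W :\: S = T :|: W :\: S :\: T.
  by rewrite -{1}[W :\: S](finset.setID _ T) (finset.setIidPr TWS).
set A := W :\: S :\: T.
rewrite inversionsUr ?inversionsUl //; first last.
- by rewrite -finset.setI_eq0 finset.setIC finset.setIDAC finset.setDIl finset.setDv finset.setI0.
- by rewrite disjoint_sym.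
rewrite !exprD; move: (_ ^+ inversions S T) (_ ^+ inversions S A) => x y.
by move: (_ ^+ inversions T A) (u S) (v T) (w A) => z p q r; ring.
Qed.

Lemma big_subsetU1 (F : oset -> mpoly n K) s W : s \notin W ->
  \sum_(S : oset | S \subset s |: W) F S =
  \sum_(S : oset | S \subset W) F S + \sum_(S : oset | S \subset W) F (s |: S).
Proof.
move=> sW; rewrite (bigID (fun S : oset => s \notin S)) /=; congr (_ + _).
  apply: eq_bigl => S; apply/andP/idP => [[SW sS]|SW].
    apply/fintype.subsetP => t tS; have /fintype.subsetP/(_ _ tS) := SW.
    by rewrite !inE => /orP[/eqP ts|//]; rewrite -ts tS in sS.
  split; first exact: fintype.subset_trans SW (finset.subsetUr _ _).
  by apply: contra sW => /(fintype.subsetP SW).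
rewrite (reindex_onto (fun S => s |: S) (fun S => S :\ s)) /=; last first.
  by move=> S /andP[_]; rewrite negbK => sS; rewrite finset.setD1K.
apply: eq_bigl => S; rewrite !inE eqxx /= andbT.
apply/andP/idP => [[SW /eqP SE]|SW].
  have sS : s \notin S by rewrite -SE !inE eqxx.
  apply/fintype.subsetP => t tS; have /fintype.subsetP/(_ t) := SW.
  rewrite !inE tS orbT => /(_ isT) /orP[/eqP ts|//].
  by rewrite -ts tS in sS.
split; first exact: finset.setUS.
have sS : s \notin S by apply: contra sW => /(fintype.subsetP SW).
by apply/eqP/finset.setU1K.
Qed.

Lemma big_subset0 (F : oset -> mpoly n K) :
  \sum_(S : oset | S \subset finset.set0) F S = F finset.set0.
Proof.
rewrite (eq_bigl (pred1 finset.set0)) ?big_pred1_eq // => S.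
by rewrite finset.subset0.
Qed.

Lemma gmul_set0 u v : (u ** v) finset.set0 = u finset.set0 * v finset.set0.
Proof. by rewrite gmulE big_subset0 finset.setDv inversions0l mul1r. Qed.

Lemma gmul_set1 u v s : (u ** v) [set s] =
  u finset.set0 * v [set s] + u [set s] * v finset.set0.
Proof.
rewrite gmulE -[in LHS](finset.setU0 [set s]) big_subsetU1 ?inE // !big_subset0.
by rewrite !finset.setU0 finset.setD0 finset.setDv inversions0l inversions0r !mul1r.
Qed.

Lemma gmul_set2 u v s t : (s < t)%N -> (u ** v) [set s; t] =
  u finset.set0 * v [set s; t] + u [set s] * v [set t] - u [set t] * v [set s]
  + u [set s; t] * v finset.set0.
Proof.
move=> st; have nst : s != t by apply: contraTneq st => ->; rewrite ltnn.
rewrite gmulE big_subsetU1 ?inE //; rewrite -(finset.setU0 [set t]).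
rewrite !big_subsetU1 ?inE // !big_subset0 !finset.setU0.
rewrite finset.setD0 finset.setDv inversions0l inversions0r.
have -> : [set s; t] :\: [set t] = [set s].
  apply/finset.setP => a; rewrite !inE; case: (eqVneq a t) => [->|_] /=.
    by rewrite eq_sym (negPf nst).
  by rewrite orbF.
have -> : [set s; t] :\: [set s] = [set t].
  apply/finset.setP => a; rewrite !inE; case: (eqVneq a s) => //= ->.
  by rewrite (negPf nst).
rewrite !inversions11 st ltnNge (ltnW st) /= !mul1r expr1 mulN1r.
by ring.
Qed.

(** ** The grading by the number of odd generators *)

Definition odd_degree (k : nat) u : Prop := forall S, u S != 0 -> #|S| = k.

Lemma odd_degree_eq0 k u S : odd_degree k u -> #|S| != k -> u S = 0.
Proof. by move=> du; apply: contraNeq => /du ->. Qed.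

Lemma odd_degreeM k l u v :
  odd_degree k u -> odd_degree l v -> odd_degree (k + l) (u ** v).
Proof.
move=> du dv W; apply: contraNeq => Wkl; rewrite gmulE big1 // => S SW.
have [->|/du Sk] := eqVneq (u S) 0; first by rewrite mul0r mulr0.
rewrite (odd_degree_eq0 dv) ?mulr0 ?mulr0 //; apply: contra Wkl => /eqP <-.
by rewrite -Sk -(cardsID S W) (finset.setIidPr SW).
Qed.

Lemma odd_degreeD k u v :
  odd_degree k u -> odd_degree k v -> odd_degree k (u + v).
Proof.
move=> du dv S; apply: contraNeq => Sk.
by rewrite ffunE (odd_degree_eq0 du) // (odd_degree_eq0 dv) // addr0.
Qed.

Lemma odd_degree0 k : odd_degree k 0.
Proof. by move=> S; rewrite ffunE eqxx. Qed.

Lemma odd_degree_sum k (I : Type) (r : seq I) (P : pred I) (F : I -> G) :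
  (forall i, P i -> odd_degree k (F i)) ->
  odd_degree k (\sum_(i <- r | P i) F i).
Proof.
move=> dF; elim/big_ind: _ => //; first exact: odd_degree0.
exact: odd_degreeD.
Qed.

Lemma odd_degreeZ k c u : odd_degree k u -> odd_degree k (c *: u).
Proof.
move=> du S; apply: contraNeq => Sk.
by rewrite ffunE (odd_degree_eq0 du) // scaler0.
Qed.

Lemma odd_degree_godd s : odd_degree 1 (godd K n s).
Proof.
by move=> S; rewrite ffunE; case: (S =P [set s]) => [->|_]; rewrite ?cards1 ?eqxx.
Qed.

Lemma odd_degree_gpoly q : odd_degree 0 (gpoly q).
Proof.
by move=> S; rewrite ffunE; case: (S =P finset.set0) => [->|_]; rewrite ?cards0 ?eqxx.
Qed.

Lemma odd_degree_gconst c : odd_degree 0 (gconst n d c).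
Proof. rewrite -[gconst n d c]/(gpoly (mpolyC n c)); exact: odd_degree_gpoly. Qed.

(** Passing to the complement exchanges the two factors; the sign is the parity of
  all the pairs formed by a generator of each factor. *)
Lemma gmulC k l u v : odd_degree k u -> odd_degree l v ->
  u ** v = (-1) ^+ (k * l) *: (v ** u).
Proof.
move=> du dv; apply/ffunP => W; rewrite [RHS]ffunE !gmulE scaler_sumr.
rewrite (reindex_onto (fun S => W :\: S) (fun S => W :\: S)) /=; last first.
  by move=> S SW; rewrite finset.setDDr finset.setDv finset.set0U (finset.setIidPr SW).
rewrite (eq_bigl (fun S : oset => S \subset W)) => [|S]; last first.
  rewrite finset.subsetDl /= finset.setDDr finset.setDv finset.set0U.
  by apply/eqP/idP => [<-|/finset.setIidPr//]; exact: finset.subsetIl.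
apply: eq_bigr => S SW.
rewrite finset.setDDr finset.setDv finset.set0U (finset.setIidPr SW).
have [u0|/du WSk] := eqVneq (u (W :\: S)) 0.
  by rewrite u0 mul0r !mulr0 scaler0.
have [v0|/dv Sl] := eqVneq (v S) 0; first by rewrite v0 mul0r !mulr0 scaler0.
have dWS : [disjoint W :\: S & S].
  by rewrite -finset.setI_eq0 finset.setIDAC finset.setDIl finset.setDv finset.setI0.
rewrite -WSk -Sl -(inversionsC dWS) scale_signE exprD -mulrA.
by rewrite [(_ ^+ inversions S _) * (_ * _)]mulrA -expr2 sqrr_sign mul1r [u _ * _]mulrC.
Qed.

End GradedAlgebraTheory.

(** ** The weights of a set of odd generators *)

Section OddWeight.
Variable d : nat.
Local Notation oset := {set 'I_(d + d)}.
Local Notation wxi := (odd_weight (@lshift d d)).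
Local Notation wth := (odd_weight (@rshift d d)).
Implicit Types (S T W : oset) (s t : 'I_(d + d)).

Lemma odd_weightE (h : 'I_d -> 'I_(d + d)) S :
  odd_weight h S = (\sum_(a < d) (h a \in S))%N.
Proof.
by rewrite /odd_weight -sum1_card big_mkcond /=; apply: eq_bigr => a _; rewrite inE; case: ifP.
Qed.

Lemma odd_weightD (h : 'I_d -> 'I_(d + d)) S W : S \subset W ->
  odd_weight h W = (odd_weight h S + odd_weight h (W :\: S))%N.
Proof.
move=> SW; rewrite !odd_weightE -big_split /=; apply: eq_bigr => a _.
by rewrite !inE; case: (boolP (h a \in S)) => // /(fintype.subsetP SW) ->.
Qed.

Lemma odd_weightU1 (h : 'I_d -> 'I_(d + d)) s S : s \notin S ->
  odd_weight h (s |: S) = (odd_weight h [set s] + odd_weight h S)%N.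
Proof.
move=> sS; rewrite (@odd_weightD _ [set s]) ?finset.subsetUl //.
by rewrite finset.setU1K.
Qed.

Lemma odd_weight0 (h : 'I_d -> 'I_(d + d)) : odd_weight h finset.set0 = 0%N.
Proof. by rewrite odd_weightE big1 // => a _; rewrite inE. Qed.

Lemma lshift_neq_rshift (a b : 'I_d) : (lshift d a == rshift d b) = false.
Proof. exact: eq_lrshift. Qed.

Lemma rshift_neq_lshift (a b : 'I_d) : (rshift d b == lshift d a) = false.
Proof. exact: eq_rlshift. Qed.

Definition eq_oddE := (lshift_neq_rshift, rshift_neq_lshift, eq_lshift, eq_rshift).

Lemma xi_weight_xi (a : 'I_d) : wxi [set lshift d a] = 1%N.
Proof.
rewrite odd_weightE (bigD1 a) //= inE eqxx big1 // => b ba.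
by rewrite inE eq_lshift (negPf ba).
Qed.

Lemma xi_weight_theta (a : 'I_d) : wxi [set rshift d a] = 0%N.
Proof. by rewrite odd_weightE big1 // => b _; rewrite inE eq_oddE. Qed.

Lemma theta_weight_theta (a : 'I_d) : wth [set rshift d a] = 1%N.
Proof.
rewrite odd_weightE (bigD1 a) //= inE eqxx big1 // => b ba.
by rewrite inE eq_rshift (negPf ba).
Qed.

Lemma theta_weight_xi (a : 'I_d) : wth [set lshift d a] = 0%N.
Proof. by rewrite odd_weightE big1 // => b _; rewrite inE eq_oddE. Qed.

Definition weightE := (odd_weight0, xi_weight_xi, xi_weight_theta,
  theta_weight_theta, theta_weight_xi).

Lemma odd_weight_card S : #|S| = (wxi S + wth S)%N.
Proof.
rewrite !odd_weightE -sum1_card big_mkcond /= big_split_ord /=.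
by congr (_ + _)%N; apply: eq_bigr => a _; case: ifP.
Qed.

Lemma xi_weight0 S (a : 'I_d) : wxi S = 0%N -> lshift d a \notin S.
Proof. by move=> /eqP; rewrite odd_weightE sum_nat_eq0 => /forallP/(_ a); case: (_ \in _). Qed.

Lemma theta_set1P S : wxi S = 0%N -> wth S = 1%N -> exists a, S = [set rshift d a].
Proof.
move=> xS tS; have /eqP/cards1P[s SE] : #|S| = 1%N by rewrite odd_weight_card xS tS.
case: (split_ordP s) => a sE; last by exists a; rewrite SE sE.
by have := xi_weight0 a xS; rewrite SE sE inE eqxx.
Qed.

Lemma theta_set2P S : wxi S = 0%N -> wth S = 2 ->
  exists a b : 'I_d, (a < b)%N /\ S = [set rshift d a; rshift d b].
Proof.
move=> xS tS; have /eqP/cards2P[s [t [st SE]]] : #|S| = 2 by rewrite odd_weight_card xS tS.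
have sS : s \in S by rewrite SE !inE eqxx.
have tS' : t \in S by rewrite SE !inE eqxx orbT.
case: (split_ordP s) => a sE.
  by move: sS; rewrite sE (negPf (xi_weight0 a xS)).
case: (split_ordP t) => b tE.
  by move: tS'; rewrite tE (negPf (xi_weight0 b xS)).
have : a != b by apply: contraNneq st => ab; rewrite sE tE ab.
rewrite neq_ltn => /orP[ab|ba]; first by exists a, b; rewrite SE sE tE.
by exists b, a; rewrite SE sE tE finset.setUC.
Qed.

Lemma rshift_set2_inj (a b a' b' : 'I_d) : (a < b)%N -> (a' < b')%N ->
  ([set rshift d a; rshift d b] == [set rshift d a'; rshift d b']) =
  (a == a') && (b == b').
Proof.
move=> ab ab'; apply/eqP/andP => [/finset.setP E|[/eqP-> /eqP->]//].
have := E (rshift d a); have := E (rshift d b).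
rewrite !inE !eq_rshift !eqxx ?orbT /= => /esym/orP Hb /esym/orP Ha.
case: Ha Hb => /eqP aE [] /eqP bE; rewrite ?aE ?bE ?eqxx // in ab *.
- by rewrite ltnn in ab.
- by have := ltn_trans ab ab'; rewrite ltnn.
- by rewrite ltnn in ab.
Qed.

Lemma theta_set3P S : wxi S = 0%N -> wth S = 3 ->
  exists a b c : 'I_d, [/\ (a < b)%N, (b < c)%N &
    S = rshift d a |: [set rshift d b; rshift d c]].
Proof.
move=> xS tS; have S0 : S != finset.set0.
  by rewrite -card_gt0 odd_weight_card xS tS.
have /finset.set0Pn[s0 s0S] := S0.
case: (@arg_minnP _ s0 (fun s => s \in S) (fun s : 'I_(d + d) => val s) s0S).
move=> s /= sS smin.
case: (split_ordP s) => a sE.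
  by move: sS; rewrite sE (negPf (xi_weight0 a xS)).
have sS1 : [set s] \subset S by rewrite finset.sub1set.
have [b [c [bc SsE]]] : exists a b : 'I_d, (a < b)%N /\ S :\ s = [set rshift d a; rshift d b].
  apply: theta_set2P.
    by apply/eqP; move/eqP: xS; rewrite (odd_weightD _ sS1) addn_eq0 => /andP[].
  by move: tS; rewrite (odd_weightD _ sS1) sE theta_weight_theta => -[].
exists a, b, c; split=> //; last by rewrite -SsE -sE finset.setD1K.
have bS : rshift d b \in S :\ s by rewrite SsE !inE eqxx.
have := smin (rshift d b); move: (bS); rewrite !inE => /andP[bs ->] /(_ isT).
rewrite sE /= leq_add2l leq_eqVlt => /orP[/eqP/val_inj ab|//].
by rewrite sE ab eqxx in bs.
Qed.

End OddWeight.

(** ** Bidegrees of local functions *)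

Lemma sum_seq_delta (I : eqType) (V : nmodType) (r : seq I) (F : I -> V) j :
  uniq r -> \sum_(i <- r) F i *+ (i == j) = if j \in r then F j else 0.
Proof.
move=> ur; case: ifPn => jr.
  by rewrite (bigD1_seq j) //= eqxx big1 ?addr0 // => i /negPf ->.
by rewrite big1_seq // => i /= ir; case: eqP => // ij; rewrite -ij ir in jr.
Qed.

Section Bidegree.
Variables (K : comNzRingType) (n d : nat).
Local Notation L := (galg K n d).
Local Notation oset := {set 'I_(d + d)}.
Local Notation wxi := (odd_weight (@lshift d d)).
Local Notation wth := (odd_weight (@rshift d d)).
Implicit Types (u v w : L) (S T W : oset) (s t : 'I_(d + d)) (c : K)
  (a b : 'I_n) (m : multinom n).

Lemma mcoeff_dp a u S m :
  mcoeff m (dp a u S) = mcoeff (mnm_add m (mnm1 a)) (u S) *+ (m a).+1.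
Proof. by rewrite ffunE mcoeff_mderiv. Qed.

Definition has_coef u S m := mcoeff m (u S) != 0.

Lemma has_coef_gmul u v W m : has_coef (u ** v) W m ->
  exists S m1 m2, [/\ S \subset W, m = mnm_add m1 m2,
    has_coef u S m1 & has_coef v (W :\: S) m2].
Proof.
move=> /eqP nz; apply: contrapT => no; apply: nz.
rewrite gmulE raddf_sum big1 // => S SW.
rewrite /= -scale_signE mcoeffZ mcoeffM big1 ?mulr0 // => k /eqP mE.
have [u0|un0] := eqVneq (mcoeff k.1 (u S)) 0; first by rewrite u0 mul0r.
have [v0|vn0] := eqVneq (mcoeff k.2 (v (W :\: S))) 0; first by rewrite v0 mulr0.
by case: no; exists S, k.1, k.2.
Qed.

Lemma has_coef_dp a u S m : has_coef (dp a u) S m -> has_coef u S (mnm_add m (mnm1 a)).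
Proof. by apply: contra => /eqP u0; rewrite mcoeff_dp u0 mul0rn. Qed.

Lemma has_coef_dleft s u S m : has_coef (dleft s u) S m ->
  s \notin S /\ has_coef u (s |: S) m.
Proof.
rewrite /has_coef ffunE; case: ifP => [_|sS]; first by rewrite mcoeff0 eqxx.
move=> h; split=> //; apply: contra h => /eqP u0.
by rewrite -scale_signE mcoeffZ u0 mulr0.
Qed.

Lemma has_coef_dright s u S m : has_coef (dright s u) S m ->
  s \notin S /\ has_coef u (s |: S) m.
Proof.
rewrite /has_coef ffunE; case: ifP => [_|sS]; first by rewrite mcoeff0 eqxx.
move=> h; split=> //; apply: contra h => /eqP u0.
by rewrite -scale_signE mcoeffZ u0 mulr0.
Qed.

Definition ghom (k l : nat) u : Prop := forall S m, has_coef u S m ->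
  k = (mdeg m + wth S)%N /\ l = (mdeg m + wxi S)%N.

Lemma ghom_coef0 k l u S m : ghom k l u ->
  (k != mdeg m + wth S)%N || (l != mdeg m + wxi S)%N -> mcoeff m (u S) = 0.
Proof.
by move=> hu; apply: contraTeq => /hu[-> ->]; rewrite !eqxx.
Qed.

Lemma ghom_set0 k l u S : ghom k l u -> ((k + wxi S)%N != (l + wth S)%N) -> u S = 0.
Proof.
move=> hu kl; apply/mpolyP => m; rewrite mcoeff0; apply/eqP; apply: contraNT kl.
by move=> /hu[-> ->]; rewrite addnAC.
Qed.

Lemma ghom_mpolyC k l u S : ghom k l u -> k = wth S -> l = wxi S ->
  u S = mpolyC n (mcoeff mnm0 (u S)).
Proof.
move=> hu kS lS; apply/mpolyP => m; rewrite mcoeffC.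
have [->|m0] := eqVneq m mnm0; first by rewrite mulr1.
rewrite mulr0; apply: (ghom_coef0 hu).
by rewrite kS -[X in X != _]add0n eqn_add2r eq_sym mdeg_eq0 m0.
Qed.

(** A monomial of bidegree (k, 0) has no momenta and no [xi]. *)
Lemma ghom_eq k u v : ghom k 0 u -> ghom k 0 v ->
  (forall S, wxi S = 0%N -> wth S = k -> mcoeff mnm0 (u S) = mcoeff mnm0 (v S)) ->
  u = v.
Proof.
move=> hu hv uv; apply/ffunP => S; apply/mpolyP => m.
have [/andP[/eqP e1 /eqP e2]|e] := boolP ((k == mdeg m + wth S) && (0%N == mdeg m + wxi S))%N.
  have -> : m = mnm0 by apply/eqP; rewrite -mdeg_eq0; lia.
  by apply: uv; lia.
by rewrite (ghom_coef0 hu) ?(ghom_coef0 hv) // -negb_and.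
Qed.

Lemma ghom0 k l : ghom k l 0.
Proof. by move=> S m; rewrite /has_coef ffunE mcoeff0 eqxx. Qed.

Lemma ghomD k l u v : ghom k l u -> ghom k l v -> ghom k l (u + v).
Proof.
move=> hu hv S m; rewrite /has_coef ffunE mcoeffD.
have [u0|/hu//] := eqVneq (mcoeff m (u S)) 0.
by rewrite u0 add0r => /hv.
Qed.

Lemma ghomN k l u : ghom k l u -> ghom k l (- u).
Proof. by move=> hu S m; rewrite /has_coef ffunE mcoeffN oppr_eq0 => /hu. Qed.

Lemma ghomB k l u v : ghom k l u -> ghom k l v -> ghom k l (u - v).
Proof. by move=> hu hv; apply: ghomD => //; exact: ghomN. Qed.

Lemma ghom_sum k l (I : Type) (r : seq I) (P : pred I) (F : I -> L) :
  (forall i, P i -> ghom k l (F i)) -> ghom k l (\sum_(i <- r | P i) F i).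
Proof.
by move=> hF; elim/big_ind: _ => //; [exact: ghom0|exact: ghomD].
Qed.

Lemma ghomZ k l c u : ghom k l u -> ghom k l (c *: u).
Proof.
move=> hu S m h; apply: hu; apply: contraNN h => /eqP u0.
by rewrite ffunE mcoeffZ u0 mulr0.
Qed.

Lemma ghom_gmul k1 l1 k2 l2 u v :
  ghom k1 l1 u -> ghom k2 l2 v -> ghom (k1 + k2) (l1 + l2) (u ** v).
Proof.
move=> hu hv W m /has_coef_gmul[S [m1 [m2 [SW -> /hu[-> ->] /hv[-> ->]]]]].
by rewrite mdegD !(odd_weightD _ SW) !addnA; split; congr (_ + _)%N; rewrite addnAC.
Qed.

Lemma ghom_gconst c : ghom 0 0 (gconst n d c).
Proof.
move=> S m; rewrite /has_coef ffunE.
case: (S =P finset.set0) => [->|_]; last by rewrite mcoeff0 eqxx.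
rewrite mcoeffC; have [->|m0] := eqVneq m mnm0; last by rewrite mulr0 eqxx.
by rewrite mdeg0 !weightE.
Qed.

Lemma ghom00E u : ghom 0 0 u -> u = gconst n d (mcoeff mnm0 (u finset.set0)).
Proof.
move=> hu; apply/ffunP => S; rewrite ffunE; case: eqP => [->|/eqP S0].
  by apply: ghom_mpolyC hu _ _; rewrite weightE.
apply/mpolyP => m; rewrite mcoeff0; apply: (ghom_coef0 hu); apply: contraNT S0.
rewrite negb_or !negbK !(eq_sym 0%N) !addn_eq0 -cards_eq0 odd_weight_card.
by move=> /andP[/andP[_ /eqP->] /andP[_ /eqP->]].
Qed.

End Bidegree.

Section LocalFunctionTheory.
Variables (R : realType) (n d : nat).
Local Notation K := ('rV[R]_n -> R).
Local Notation L := (lfun R n d).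
Local Notation oset := {set 'I_(d + d)}.
Local Notation wxi := (odd_weight (@lshift d d)).
Local Notation wth := (odd_weight (@rshift d d)).
Implicit Types (u v w : L) (S T W : oset) (s t : 'I_(d + d)) (c : K)
  (y : 'rV[R]_n) (U : set 'rV[R]_n) (a b : 'I_n) (m : multinom n).

Lemma mcoeff_dx a u S m : mcoeff m (dx a u S) = pderiv a (mcoeff m (u S)).
Proof.
rewrite ffunE raddf_sum /=.
under eq_bigr => m' _ do rewrite mcoeffZ mcoeffX mulr_natr.
rewrite sum_seq_delta ?msupp_uniq //; case: ifPn => // mS.
move: mS; rewrite mcoeff_msupp negbK => /eqP ->.
by apply/funext => y; rewrite pderiv_cst.
Qed.

Lemma has_coef_dx a u S m : has_coef (dx a u) S m -> has_coef u S m.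
Proof.
apply: contra => /eqP u0; rewrite mcoeff_dx u0.
by apply/eqP/funext => y; exact: pderiv_cst.
Qed.

Lemma ghom_lbracket k1 l1 k2 l2 k l u v : (k1 + k2 = k.+1)%N -> (l1 + l2 = l.+1)%N ->
  ghom k1 l1 u -> ghom k2 l2 v -> ghom k l (lbracket u v).
Proof.
move=> kE lE hu hv.
have prod u' v' : (forall S T m1 m2, has_coef u' S m1 -> has_coef v' T m2 ->
    (mdeg m1 + wth S + (mdeg m2 + wth T) = k)%N /\
    (mdeg m1 + wxi S + (mdeg m2 + wxi T) = l)%N) -> ghom k l (u' ** v').
  move=> h W m /has_coef_gmul[S [m1 [m2 [SW -> /h/[apply][[<- <-]]]]]].
  by rewrite mdegD !(odd_weightD _ SW) !addnA; split; congr (_ + _)%N; rewrite addnAC.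
apply: ghomD; apply: ghom_sum => a _.
  apply: ghomB; apply: prod => S T m1 m2.
    move=> /has_coef_dp/hu[e1 e2] /has_coef_dx/hv[e3 e4].
    by rewrite mdegD mdeg1 in e1 e2; lia.
  move=> /has_coef_dx/hu[e1 e2] /has_coef_dp/hv[e3 e4].
  by rewrite mdegD mdeg1 in e3 e4; lia.
apply: ghomD; apply: prod => S T m1 m2.
  move=> /has_coef_dright[nS /hu[e1 e2]] /has_coef_dleft[nT /hv[e3 e4]].
  by rewrite !odd_weightU1 // !weightE in e1 e2 e3 e4; lia.
move=> /has_coef_dright[nS /hu[e1 e2]] /has_coef_dleft[nT /hv[e3 e4]].
by rewrite !odd_weightU1 // !weightE in e1 e2 e3 e4; lia.
Qed.

(** ** Equality over an open set *)

Definition eval_at y (f : K) : R := f y.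

Lemma eval_at_is_zmod_morphism y : zmod_morphism (eval_at y).
Proof. by []. Qed.
Lemma eval_at_is_monoid_morphism y : monoid_morphism (eval_at y).
Proof. by []. Qed.
HB.instance Definition _ y :=
  GRing.isZmodMorphism.Build K R (eval_at y) (eval_at_is_zmod_morphism y).
HB.instance Definition _ y :=
  GRing.isMonoidMorphism.Build K R (eval_at y) (eval_at_is_monoid_morphism y).

Lemma mcoeff_geval y u S m : mcoeff m (geval y u S) = mcoeff m (u S) y.
Proof. by rewrite ffunE -[fun f => f y]/(eval_at y) mcoeff_map_mpoly. Qed.

Lemma ghom_geval k l u y : ghom k l u -> ghom k l (geval y u).
Proof.
move=> hu S m; rewrite /has_coef mcoeff_geval => nz; apply: hu.
by apply: contra nz => /eqP h0; rewrite h0.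
Qed.

Lemma gevalP y u v : geval y u = geval y v <->
  forall S m, mcoeff m (u S) y = mcoeff m (v S) y.
Proof.
split=> [uv S m|uv]; first by rewrite -!mcoeff_geval uv.
by apply/ffunP => S; apply/mpolyP => m; rewrite !mcoeff_geval.
Qed.

Lemma geval_is_zmod_morphism y : zmod_morphism (@geval R n d y).
Proof.
move=> u v; apply/ffunP => S; apply/mpolyP => m.
have subE (K' : comNzRingType) (f g : galg K' n d) : (f - g) S = f S - g S.
  by rewrite !ffunE.
by rewrite [in RHS]subE mcoeffB !mcoeff_geval subE mcoeffB.
Qed.
HB.instance Definition _ y :=
  GRing.isZmodMorphism.Build L (galg R n d) (@geval R n d y) (geval_is_zmod_morphism y).

Lemma geval_gmul y u v : geval y (u ** v) = geval y u ** geval y v.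
Proof.
apply/ffunP => W; rewrite ffunE -[fun f => f y]/(eval_at y) !gmulE raddf_sum /=.
apply: eq_bigr => S _; rewrite !ffunE -[fun f => f y]/(eval_at y).
by rewrite !rmorphM rmorphXn rmorphN1.
Qed.

(** The big bracket differentiates the coefficients, so it does not preserve
  equality at a point, only equality over an open set. *)
Definition eq_over U u v := forall y, U y -> geval y u = geval y v.

Lemma eq_over_refl U u : eq_over U u u. Proof. by []. Qed.

Lemma eq_over_sym U u v : eq_over U u v -> eq_over U v u.
Proof. by move=> uv y Uy; rewrite uv. Qed.

Lemma eq_overD U u u' v v' :
  eq_over U u u' -> eq_over U v v' -> eq_over U (u + v) (u' + v').
Proof. by move=> uu vv y Uy; rewrite [LHS]raddfD [RHS]raddfD /= (uu y Uy) (vv y Uy). Qed.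

Lemma eq_overN U u u' : eq_over U u u' -> eq_over U (- u) (- u').
Proof. by move=> uu y Uy; rewrite !raddfN /= uu. Qed.

Lemma eq_overB U u u' v v' :
  eq_over U u u' -> eq_over U v v' -> eq_over U (u - v) (u' - v').
Proof. by move=> uu vv; apply: eq_overD => //; exact: eq_overN. Qed.

Lemma eq_over_sum U (I : Type) (r : seq I) (P : pred I) (F F' : I -> L) :
  (forall i, P i -> eq_over U (F i) (F' i)) ->
  eq_over U (\sum_(i <- r | P i) F i) (\sum_(i <- r | P i) F' i).
Proof.
by move=> FF y Uy; rewrite !raddf_sum /=; apply: eq_bigr => i Pi; rewrite FF.
Qed.

Lemma eq_over_gmul U u u' v v' :
  eq_over U u u' -> eq_over U v v' -> eq_over U (u ** v) (u' ** v').
Proof. by move=> uu vv y Uy; rewrite geval_gmul (uu y Uy) (vv y Uy) -geval_gmul. Qed.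

Lemma eq_over_dp U a u v : eq_over U u v -> eq_over U (dp a u) (dp a v).
Proof.
move=> uv y /uv/gevalP uvy; apply/gevalP => S m; rewrite !mcoeff_dp.
by rewrite ![(_ *+ _) y](raddfMn (eval_at y)) /= /eval_at uvy.
Qed.

Lemma eq_over_dx U a u v : open U -> eq_over U u v -> eq_over U (dx a u) (dx a v).
Proof.
move=> oU uv y Uy; apply/gevalP => S m; rewrite !mcoeff_dx.
by apply: (eq_on_pderiv _ oU) Uy => z /uv/gevalP.
Qed.

Lemma geval_dleft y s u : geval y (dleft s u) = dleft s (geval y u).
Proof.
apply/ffunP => S; rewrite !ffunE -[fun f => f y]/(eval_at y); case: ifP => _.
  by rewrite raddf0.
by rewrite rmorphM rmorphXn rmorphN1.
Qed.

Lemma geval_dright y s u : geval y (dright s u) = dright s (geval y u).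
Proof.
apply/ffunP => S; rewrite !ffunE -[fun f => f y]/(eval_at y); case: ifP => _.
  by rewrite raddf0.
by rewrite rmorphM rmorphXn rmorphN1.
Qed.

Lemma eq_over_dleft U s u v : eq_over U u v -> eq_over U (dleft s u) (dleft s v).
Proof. by move=> uv y Uy; rewrite geval_dleft (uv y Uy) -geval_dleft. Qed.

Lemma eq_over_dright U s u v : eq_over U u v -> eq_over U (dright s u) (dright s v).
Proof. by move=> uv y Uy; rewrite geval_dright (uv y Uy) -geval_dright. Qed.

Lemma eq_over_lbracket U u u' v v' : open U ->
  eq_over U u u' -> eq_over U v v' -> eq_over U (lbracket u v) (lbracket u' v').
Proof.
move=> oU uu vv; apply: eq_overD; apply: eq_over_sum => a _.
  apply: eq_overB.
    exact: eq_over_gmul (eq_over_dp _ uu) (eq_over_dx _ oU vv).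
  exact: eq_over_gmul (eq_over_dx _ oU uu) (eq_over_dp _ vv).
apply: eq_overD.
  exact: eq_over_gmul (eq_over_dright _ uu) (eq_over_dleft _ vv).
exact: eq_over_gmul (eq_over_dright _ uu) (eq_over_dleft _ vv).
Qed.

(** A bihomogeneous element is only constrained over the chart; multiplying by
  the indicator function of the chart makes it bihomogeneous everywhere, so
  that degree arguments become equalities of local functions. *)
Definition cutoff U u : L := (fun y => (y \in U)%:R : R) *: u.

Lemma mcoeff_cutoff U u S m y : U y -> mcoeff m (cutoff U u S) y = mcoeff m (u S) y.
Proof.
move=> Uy; rewrite ffunE mcoeffZ -[LHS]/(((y \in U)%:R : R) * mcoeff m (u S) y).
by rewrite mem_set // mul1r.
Qed.

Lemma eq_over_cutoff U u : eq_over U (cutoff U u) u.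
Proof. by move=> y Uy; apply/gevalP => S m; rewrite mcoeff_cutoff. Qed.

Lemma ghom_cutoff U u k l :
  (forall y S m, U y -> mcoeff m (u S) y != 0 ->
    k = (mdeg m + wth S)%N /\ l = (mdeg m + wxi S)%N) -> ghom k l (cutoff U u).
Proof.
move=> hu S m /eqP nz; have [y yU uy] : exists2 y, U y & mcoeff m (u S) y != 0.
  apply: contra_notP nz => no; apply/funext => y; rewrite ffunE mcoeffZ.
  rewrite -[LHS]/(((y \in U)%:R : R) * mcoeff m (u S) y).
  case: (boolP (y \in U)) => [/set_mem yU|_]; last by rewrite mul0r.
  by apply/eqP; rewrite mul1r; apply: contra_notT no => uy; exists y.
exact: hu yU uy.
Qed.

End LocalFunctionTheory.

(** * Transformation laws *)

Section Substitution.
Variables (K : comNzRingType) (n d : nat).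
Local Notation G := (galg K n d).
Local Notation oset := {set 'I_(d + d)}.
Implicit Types (u v : G) (S T : oset) (s t : 'I_(d + d)).

HB.instance Definition _ :=
  Monoid.isLaw.Build G (gconst n d 1) (@gmul K n d)
    (@gmulA K n d) (@gmul1l K n d) (@gmul1r K n d).

Variables (P : 'I_n -> G) (Q : 'I_(d + d) -> G).

Definition gsubst_monomial (S : oset) (m : multinom n) : G :=
  (\big[@gmul K n d/gconst n d 1]_(a < n) iter (m a) (gmul (P a)) (gconst n d 1)) **
  (\big[@gmul K n d/gconst n d 1]_(e <- enum S) Q e).

Definition gsubst_part (S : oset) (p : mpoly n K) : G :=
  \sum_(m <- msupp p) mcoeff m p *: gsubst_monomial S m.

Lemma gsubstE u : gsubst P Q u = \sum_(S : oset) gsubst_part S (u S).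
Proof.
by apply: eq_bigr => S _; apply: eq_bigr => m _; rewrite gconst_mull.
Qed.

Lemma gsubst_monomial0 S :
  gsubst_monomial S mnm0 = \big[@gmul K n d/gconst n d 1]_(e <- enum S) Q e.
Proof. by rewrite /gsubst_monomial big1 ?gmul1l // => a _; rewrite mnm0E. Qed.

Lemma gsubst_monomial1 s a : gsubst_monomial [set s] (mnm1 a) = P a ** Q s.
Proof.
rewrite /gsubst_monomial enum_set1 big_seq1 (big_only1 a) //.
  by rewrite mnm1E eqxx /= gmul1r.
by move=> b ba _; rewrite mnm1E eq_sym (negPf ba).
Qed.

(** The support of a polynomial may be replaced by any set of monomials that
  contains it, in particular by one that is easy to enumerate. *)
Lemma sum_msupp (V : lmodType K) (p : mpoly n K) (r : seq (multinom n))
    (F : multinom n -> V) : uniq r -> (forall m, mcoeff m p != 0 -> m \in r) ->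
  \sum_(m <- msupp p) mcoeff m p *: F m = \sum_(m <- r) mcoeff m p *: F m.
Proof.
move=> ur pr; rewrite [RHS](bigID (fun m => m \in msupp p)) /=.
rewrite [X in _ = _ + X]big1 ?addr0 => [|m]; last first.
  by rewrite mcoeff_msupp negbK => /eqP ->; rewrite scale0r.
rewrite -[RHS]big_filter; apply: perm_big; apply: uniq_perm.
- exact: msupp_uniq.
- exact: filter_uniq.
- move=> m; rewrite mem_filter; case: (boolP (m \in msupp p)) => // mp.
  by rewrite pr // -mcoeff_msupp.
Qed.

Lemma gsubst_part_const S p : (forall m, mcoeff m p != 0 -> m = mnm0) ->
  gsubst_part S p =
  mcoeff mnm0 p *: \big[@gmul K n d/gconst n d 1]_(e <- enum S) Q e.
Proof.
move=> p0; rewrite /gsubst_part (@sum_msupp _ _ [:: mnm0]) //.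
  by rewrite big_seq1 gsubst_monomial0.
by move=> m /p0 ->; rewrite inE.
Qed.

Lemma mnm1_inj : injective (@mnm1 n).
Proof.
move=> a b /mnmP/(_ a); rewrite !mnm1E eqxx; by case: eqP.
Qed.

Lemma gsubst_part_linear s p : (forall m, mcoeff m p != 0 -> mdeg m = 1%N) ->
  gsubst_part [set s] p = \sum_(a < n) mcoeff (mnm1 a) p *: (P a ** Q s).
Proof.
move=> p1; rewrite /gsubst_part (@sum_msupp _ _ [seq mnm1 a | a <- enum 'I_n]).
- rewrite big_map big_enum /=; apply: eq_bigr => a _.
  by rewrite gsubst_monomial1.
- by rewrite map_inj_uniq ?enum_uniq //; exact: mnm1_inj.
move=> m /p1/eqP/mdeg1P[a /eqP ->]; apply/mapP; exists a => //.
by rewrite mem_enum.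
Qed.

Lemma gsubst_part0 S : gsubst_part S 0 = 0.
Proof. by rewrite /gsubst_part msupp0 big_nil. Qed.

Lemma sum_inj (I J : finType) (V : nmodType) (h : I -> J) (C : pred I) (F : J -> V) :
  {in C &, injective h} ->
  (forall j, (forall i, C i -> j != h i) -> F j = 0) ->
  \sum_j F j = \sum_(i | C i) F (h i).
Proof.
move=> hI F0; rewrite (bigID (fun j => j \in [set h i | i in C])) /=.
rewrite [X in _ + X]big1 ?addr0 => [|j jC]; last first.
  by apply: F0 => i Ci; apply: contraNneq jC => ->; apply/imsetP; exists i.
by rewrite big_imset //=; apply: eq_bigl.
Qed.

Lemma sum_set1 (V : nmodType) (I J : finType) (h : I -> J) (F : {set J} -> V) :
  injective h -> (forall B, (forall i, B != [set h i]) -> F B = 0) ->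
  \sum_B F B = \sum_i F [set h i].
Proof.
move=> hI F0; apply: (sum_inj (h := fun i => [set h i])).
  by move=> i j _ _ /finset.set1_inj/hI.
by move=> S Sh; apply: F0 => i; exact: Sh.
Qed.

Hypothesis Q1 : forall e, odd_degree 1 (Q e).

Lemma odd_degree_big (r : seq 'I_(d + d)) :
  odd_degree (size r) (\big[@gmul K n d/gconst n d 1]_(e <- r) Q e).
Proof.
elim: r => [|e r IH]; first by rewrite big_nil; exact: odd_degree_gconst.
by rewrite big_cons /= -add1n; exact: odd_degreeM.
Qed.

Lemma gmul_PQ a s t : (P a ** Q s) [set t] = P a finset.set0 * Q s [set t].
Proof.
by rewrite gmul_set1 (odd_degree_eq0 (@Q1 s) (S := finset.set0)) ?cards0 // mulr0 addr0.
Qed.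

(** A function of bidegree (1, 2) or (2, 1) is a sum of monomials with one
  momentum and one odd generator, or with three odd generators; only the former
  contribute to its coefficients at a single odd generator. *)
Lemma gsubst_symbol k l u t m : ghom k l u -> (k + l = 3)%N ->
  mcoeff m (gsubst P Q u [set t]) =
  \sum_s \sum_(a < n) mcoeff (mnm1 a) (u [set s]) *
    mcoeff m (P a finset.set0 * Q s [set t]).
Proof.
move=> hu kl; have deg S m' : mcoeff m' (u S) != 0 -> (mdeg m' + mdeg m' + #|S|)%N = 3.
  by move=> /hu[kE lE]; rewrite odd_weight_card -kl kE lE; lia.
rewrite gsubstE sum_ffunE raddf_sum /= (sum_set1 (h := id)) //; last first.
  move=> S S1; have cS : #|S| != 1%N.
    by apply/negP => /cards1P[s SE]; have := S1 s; rewrite SE eqxx.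
  rewrite gsubst_part_const; last first.
    move=> m' /deg; case: #|S| cS (mdeg_eq0 m') => [|[|[|[|c]]]] // _; try lia.
    by move=> e; move=> h; apply/eqP; rewrite -e; lia.
  rewrite ffunE (odd_degree_eq0 (@odd_degree_big (enum S))) ?scaler0 ?mcoeff0 //.
  by rewrite cards1 -cardE eq_sym.
apply: eq_bigr => s _; rewrite gsubst_part_linear; last first.
  by move=> m' /deg; rewrite cards1; lia.
rewrite sum_ffunE raddf_sum /=; apply: eq_bigr => a _.
by rewrite ffunE mcoeffZ gmul_PQ.
Qed.

Lemma gsubst_vector u : ghom 1 0 u -> gsubst P Q u =
  \sum_(b < d) mcoeff mnm0 (u [set rshift d b]) *: Q (rshift d b).
Proof.
move=> hu; rewrite gsubstE (sum_set1 (h := @rshift d d)) //.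
- apply: eq_bigr => b _; rewrite gsubst_part_const.
    by rewrite enum_set1 big_seq1.
  move=> m /hu[+ _]; rewrite !weightE => e.
  by apply/eqP; rewrite -mdeg_eq0; lia.
- exact: rshift_inj.
move=> S S1; rewrite (_ : u S = 0) ?gsubst_part0 //.
apply/mpolyP => m; rewrite mcoeff0; apply/eqP; apply: contraT => /hu[e1 e2].
have [||b SE] := @theta_set1P d S; [lia|lia|].
by have := S1 b; rewrite SE eqxx.
Qed.

Lemma enum_set2 s t : (s < t)%N -> enum [set s; t] = [:: s; t].
Proof.
move=> st; apply: (@irr_sorted_eq _ (fun i j : 'I_(d + d) => (i < j)%N)).
- by move=> i j k; exact: ltn_trans.
- by move=> i; rewrite ltnn.
- rewrite /enum_mem; apply: sorted_filter; first by move=> i j k; exact: ltn_trans.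
  by rewrite -enumT; have := iota_ltn_sorted 0 (d + d); rewrite -val_enum_ord sorted_map.
- by rewrite /= st.
by move=> i; rewrite mem_enum !inE.
Qed.

Lemma gsubst_bivector u : ghom 2 0 u -> gsubst P Q u =
  \sum_(a < d) \sum_(b < d | (a < b)%N)
    mcoeff mnm0 (u [set rshift d a; rshift d b]) *: (Q (rshift d a) ** Q (rshift d b)).
Proof.
move=> hu; rewrite gsubstE pair_big_dep /=.
rewrite (sum_inj (h := fun ab : 'I_d * 'I_d => [set rshift d ab.1; rshift d ab.2])
  (C := fun ab => (ab.1 < ab.2)%N)).
- apply: eq_bigr => -[a b] /= ab; rewrite gsubst_part_const.
    by rewrite enum_set2 /= ?ltn_add2l // big_cons big_seq1.
  move=> m /hu[+ _]; rewrite odd_weightU1 ?inE ?eq_rshift ?weightE.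
    by move=> e; apply/eqP; rewrite -mdeg_eq0; lia.
  by apply: contraTneq ab => ->; rewrite ltnn.
- move=> [a b] [a' b']; rewrite !unfold_in /= => ab ab' /eqP.
  by rewrite rshift_set2_inj // => /andP[/eqP-> /eqP->].
move=> S S2; rewrite (_ : u S = 0) ?gsubst_part0 //.
apply/mpolyP => m; rewrite mcoeff0; apply/eqP; apply: contraT => /hu[e1 e2].
have [||a [b [ab SE]]] := @theta_set2P d S; [lia|lia|].
by have := S2 (a, b) ab; rewrite SE eqxx.
Qed.

End Substitution.

Section Generators.
Variables (K : comNzRingType) (n d : nat).
Local Notation G := (galg K n d).
Implicit Types (s t : 'I_(d + d)).

Lemma godd_set1 s t : godd K n s [set t] = (s == t)%:R.
Proof.
rewrite ffunE; congr (_%:R); congr nat_of_bool.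
by apply/eqP/eqP => [/finset.set1_inj|->].
Qed.

Lemma godd_anticomm s t : godd K n s ** godd K n t = - (godd K n t ** godd K n s).
Proof.
rewrite (@gmulC _ _ _ 1 1 (godd K n s) (godd K n t)); do ?exact: odd_degree_godd.
by rewrite mul1n expr1 scaleN1r.
Qed.

Lemma gmul_godd2 s t (S : {set 'I_(d + d)}) : (s < t)%N ->
  (godd K n s ** godd K n t) S = (S == [set s; t])%:R.
Proof.
move=> st; have nst : s != t by apply: contraTneq st => ->; rewrite ltnn.
have g0 e : godd K n e finset.set0 = 0.
  by rewrite (odd_degree_eq0 (@odd_degree_godd _ _ _ e)) ?cards0.
case: (S =P [set s; t]) => [->|nS].
  rewrite gmul_set2 // !godd_set1 !g0 !eqxx (negPf nst).
  by rewrite !mul0r !mulr0 add0r subr0 addr0 mul1r.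
rewrite gmulE big1 // => T TS; rewrite !ffunE.
case: (T =P [set s]) => [Ts|]; last by rewrite mul0r mulr0.
case: (S :\: T =P [set t]) => [ST|]; last by rewrite !mulr0.
by case: nS; rewrite -Ts -ST -{1}(finset.setIidPr TS) finset.setID.
Qed.

End Generators.

Section Multivectors.
Variables (K : comNzRingType) (n d : nat).
Local Notation G := (galg K n d).
Implicit Types (s t : 'I_(d + d)) (V : 'I_d -> K) (P : 'I_d -> 'I_d -> K).

Lemma ghom_gtheta (b : 'I_d) : ghom 1 0 (gtheta K n b).
Proof.
move=> S m; rewrite /has_coef ffunE; case: (S =P [set rshift d b]) => [->|_].
  by rewrite mcoeff1 !weightE; case: (eqVneq m mnm0) => [->|_]; rewrite ?mdeg0 ?eqxx.
by rewrite mcoeff0 eqxx.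
Qed.

Definition vector V : G := \sum_(b < d) V b *: gtheta K n b.

Definition bivector P : G :=
  \sum_(a < d) \sum_(b < d | (a < b)%N) P a b *: (gtheta K n a ** gtheta K n b).

Lemma ghom_vector V : ghom 1 0 (vector V).
Proof. by apply: ghom_sum => b _; apply: ghomZ; exact: ghom_gtheta. Qed.

Lemma ghom_bivector P : ghom 2 0 (bivector P).
Proof.
apply: ghom_sum => a _; apply: ghom_sum => b _; apply: ghomZ.
by apply: (@ghom_gmul _ _ _ 1 0 1 0); exact: ghom_gtheta.
Qed.

Lemma vectorE V b : vector V [set rshift d b] = mpolyC n (V b).
Proof.
rewrite sum_ffunE (bigD1 b) //= big1 ?addr0 => [|a ab].
  by rewrite ffunE godd_set1 eqxx -mul_mpolyC mulr1.
by rewrite ffunE godd_set1 eq_rshift (negPf ab) scaler0.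
Qed.

Lemma bivectorE P (a b : 'I_d) : (a < b)%N ->
  bivector P [set rshift d a; rshift d b] = mpolyC n (P a b).
Proof.
move=> ab; rewrite sum_ffunE (bigD1 a) //= sum_ffunE (bigD1 b) //=.
rewrite ffunE gmul_godd2 /= ?ltn_add2l // eqxx -mul_mpolyC mulr1.
rewrite !big1 ?addr0 // => [c ca|c /andP[ac cb]].
  rewrite sum_ffunE big1 // => e ce; rewrite ffunE gmul_godd2 /= ?ltn_add2l //.
  by rewrite rshift_set2_inj // eq_sym (negPf ca) scaler0.
rewrite ffunE gmul_godd2 /= ?ltn_add2l // rshift_set2_inj // [b == c]eq_sym.
by rewrite (negPf cb) andbF scaler0.
Qed.

Lemma ghom10E u : ghom 1 0 u -> u = vector (fun b => mcoeff mnm0 (u [set rshift d b])).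
Proof.
move=> hu; apply: (ghom_eq hu (@ghom_vector _)) => S xS tS.
have [b ->] := theta_set1P xS tS.
by rewrite vectorE mcoeffC eqxx mulr1.
Qed.

Lemma ghom20E u : ghom 2 0 u ->
  u = bivector (fun a b => mcoeff mnm0 (u [set rshift d a; rshift d b])).
Proof.
move=> hu; apply: (ghom_eq hu (@ghom_bivector _)) => S xS tS.
have [a [b [ab ->]]] := theta_set2P xS tS.
by rewrite bivectorE // mcoeffC eqxx mulr1.
Qed.

End Multivectors.

Section SkewSums.
Variables (R : realType) (V : lmodType R) (d : nat).

Lemma eq_opp0 (x : V) : x = - x -> x = 0.
Proof.
move=> /eqP; rewrite -addr_eq0 -mulr2n -scaler_nat scaler_eq0 pnatr_eq0 /=.
by move/eqP.
Qed.

Lemma mulr2n_inj : injective (fun x : V => x *+ 2).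
Proof.
move=> x y /= E; apply/eqP; rewrite -subr_eq0; apply/eqP/eq_opp0/eqP.
by rewrite -addr_eq0 -mulr2n mulrnBl E subrr.
Qed.

Lemma sum_sym_skew (H : 'I_d -> 'I_d -> R) (w : 'I_d -> 'I_d -> V) :
  (forall a b, H a b = H b a) -> (forall a b, w a b = - w b a) ->
  \sum_a \sum_b H a b *: w a b = 0.
Proof.
move=> Hs ws; apply: eq_opp0; rewrite {1}exchange_big -sumrN /=.
apply: eq_bigr => a _; rewrite -sumrN; apply: eq_bigr => b _.
by rewrite Hs ws scalerN.
Qed.

Lemma sum_skew_skew (P : 'I_d -> 'I_d -> R) (w : 'I_d -> 'I_d -> V) :
  (forall a b, P a b = - P b a) -> (forall a b, w a b = - w b a) ->
  \sum_a \sum_b P a b *: w a b =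
  (\sum_(a < d) \sum_(b < d | (a < b)%N) P a b *: w a b) *+ 2.
Proof.
move=> Ps ws.
have diag a : P a a *: w a a = 0 by rewrite (eq_opp0 (ws a a)) scaler0.
have -> : \sum_a \sum_b P a b *: w a b =
    \sum_(a < d) \sum_(b < d | (a < b)%N) P a b *: w a b +
    \sum_(a < d) \sum_(b < d | (b < a)%N) P a b *: w a b.
  rewrite -big_split /=; apply: eq_bigr => a _.
  rewrite (bigID (fun b : 'I_d => (a < b)%N)) /=; congr (_ + _).
  rewrite (bigD1 a) ?ltnn //= diag add0r; apply: eq_bigl => b.
  by rewrite -leqNgt [RHS]ltn_neqAle andbC.
rewrite mulr2n; congr (_ + _).
rewrite (exchange_big_dep predT) //=; apply: eq_bigr => a _; apply: eq_bigr => b _.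
by rewrite Ps ws scalerN scaleNr opprK.
Qed.

End SkewSums.

Section Transitions.
Variables (R : realType) (n : nat) (M : manifold R n) (d : nat) (A : vbundle M d).
Implicit Types (i j : chart_index M) (x : M) (b c : 'I_d) (F : lfamily A).

Lemma trans_odd_xi i j x b : trans_odd A i j x (lshift d b) = trans_xi A i j x b.
Proof. by rewrite /trans_odd (unsplitK (inl b)). Qed.

Lemma trans_odd_theta i j x b : trans_odd A i j x (rshift d b) = trans_theta A i j x b.
Proof. by rewrite /trans_odd (unsplitK (inr b)). Qed.

Lemma trans_xiE i j x b :
  trans_xi A i j x b = \sum_c vb_trans A i j x c b *: gxi R n c.
Proof. by apply: eq_bigr => c _; rewrite gconst_mull. Qed.

Lemma trans_thetaE i j x b :
  trans_theta A i j x b = \sum_c vb_trans A j i x b c *: gtheta R n c.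
Proof. by apply: eq_bigr => c _; rewrite gconst_mull. Qed.

Lemma odd_degree_trans_xi i j x b : odd_degree 1 (trans_xi A i j x b).
Proof.
rewrite trans_xiE; apply: odd_degree_sum => c _; apply: odd_degreeZ.
exact: odd_degree_godd.
Qed.

Lemma odd_degree_trans_odd i j x e : odd_degree 1 (trans_odd A i j x e).
Proof.
case: (split_ordP e) => b ->; first by rewrite trans_odd_xi; exact: odd_degree_trans_xi.
rewrite trans_odd_theta trans_thetaE; apply: odd_degree_sum => c _; apply: odd_degreeZ.
exact: odd_degree_godd.
Qed.

Lemma trans_xi_set1 i j x b e : trans_xi A i j x b [set e] =
  \sum_c vb_trans A i j x c b *: (lshift d c == e)%:R.
Proof.
rewrite trans_xiE sum_ffunE; apply: eq_bigr => c _.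
by rewrite ffunE godd_set1.
Qed.

Lemma trans_theta_set1 i j x b e : trans_theta A i j x b [set e] =
  \sum_c vb_trans A j i x b c *: (rshift d c == e)%:R.
Proof.
rewrite trans_thetaE sum_ffunE; apply: eq_bigr => c _.
by rewrite ffunE godd_set1.
Qed.

Lemma trans_p_set0 i j x a : trans_p A i j x a finset.set0 =
  \sum_b Defs.jacobian j i x a b *: mpolyX R (mnm1 b).
Proof.
rewrite ffunE sum_ffunE [X in _ + X]sum_ffunE [X in _ + X]big1 => [|b _].
  by rewrite addr0; apply: eq_bigr => b _; rewrite gconst_mull ffunE ffunE eqxx.
rewrite sum_ffunE big1 // => c _; rewrite gconst_mull ffunE gmul_set0.
by rewrite (odd_degree_eq0 (@odd_degree_trans_xi _ _ _ _)) ?cards0 // mul0r scaler0.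
Qed.

(** The symbols of an element of bidegree (1, 2), resp. (2, 1): for the
  structure of a Lie algebroid on the bundle, resp. on its dual, these are the
  matrices of the anchor. *)
Definition xi_symbol (u : lfun R n d) (y : 'rV[R]_n) : 'M[R]_(n, d) :=
  \matrix_(a, b) mcoeff (mnm1 a) (u [set lshift d b]) y.

Definition theta_symbol (u : lfun R n d) (y : 'rV[R]_n) : 'M[R]_(n, d) :=
  \matrix_(a, b) mcoeff (mnm1 a) (u [set rshift d b]) y.

Definition vector_coef (u : lfun R n d) (y : 'rV[R]_n) : 'rV[R]_d :=
  \row_b mcoeff mnm0 (u [set rshift d b]) y.

Lemma chart_imgT i x : chart_dom i x -> chart_img i (chart i x).
Proof. by move=> xi; exists x. Qed.

Lemma ghom_bihom k l F i y : bihom k l F -> chart_img i y -> ghom k l (geval y (F i)).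
Proof. by move=> [_ _ hF] yi S m; rewrite /has_coef mcoeff_geval => /(hF _ _ _ _ yi). Qed.

Lemma mcoeff_trans_p (p : mpoly n R) i j x a a' (c : R) :
  mcoeff (mnm1 a') (trans_p A i j x a finset.set0 * (c *: 1)) = Defs.jacobian j i x a a' * c.
Proof.
rewrite trans_p_set0 -scalerAr mulr1 mcoeffZ raddf_sum /= (bigD1 a') //=.
rewrite mcoeffZ mcoeffX eqxx mulr1 big1 ?addr0 1?mulrC // => b ba.
by rewrite mcoeffZ mcoeffX (inj_eq (@mnm1_inj n)) (negPf ba) mulr0.
Qed.

Lemma sum_shift_delta (I : finType) (V : lmodType R) (f : I -> R) (P : pred I) (v : V) (k0 : I) :
  (forall k, P k = (k == k0)) -> \sum_k f k *: (v *+ P k) = f k0 *: v.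
Proof.
move=> Pk; rewrite (bigD1 k0) //= Pk eqxx big1 ?addr0 // => k /negPf kk0.
by rewrite Pk kk0 scaler0.
Qed.

Lemma xi_symbol_trans F i j x : bihom 1 2 F -> chart_dom i x -> chart_dom j x ->
  xi_symbol (F i) (chart i x) =
  (Defs.jacobian j i x)^T *m xi_symbol (F j) (chart j x) *m (vb_trans A i j x)^T.
Proof.
move=> hF xi xj; have [_ cF _] := hF.
apply/matrixP => a' b'; rewrite mxE -mcoeff_geval (cF _ _ _ xi xj).
rewrite (gsubst_symbol _ (@odd_degree_trans_odd _ _ _) _ _ (ghom_bihom hF (chart_imgT xj))) //.
rewrite big_split_ord /= [X in _ + X]big1 ?addr0 => [|b _]; last first.
  rewrite big1 // => a _; rewrite trans_odd_theta trans_theta_set1 big1.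
    by rewrite mulr0 mcoeff0 mulr0.
  by move=> c _; rewrite eq_oddE scaler0.
rewrite mxE; apply: eq_bigr => b _; rewrite !mxE mulr_suml; apply: eq_bigr => a _.
rewrite mcoeff_geval trans_odd_xi trans_xi_set1.
rewrite (sum_shift_delta _ _ (k0 := b')) => [|c]; last by rewrite eq_lshift.
by rewrite (mcoeff_trans_p 0) !mxE mulrCA mulrA.
Qed.

Lemma theta_symbol_trans F i j x : bihom 2 1 F -> chart_dom i x -> chart_dom j x ->
  theta_symbol (F i) (chart i x) =
  (Defs.jacobian j i x)^T *m theta_symbol (F j) (chart j x) *m vb_trans A j i x.
Proof.
move=> hF xi xj; have [_ cF _] := hF.
apply/matrixP => a' b'; rewrite mxE -mcoeff_geval (cF _ _ _ xi xj).
rewrite (gsubst_symbol _ (@odd_degree_trans_odd _ _ _) _ _ (ghom_bihom hF (chart_imgT xj))) //.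
rewrite big_split_ord /= [X in X + _]big1 ?add0r => [|b _]; last first.
  rewrite big1 // => a _; rewrite trans_odd_xi trans_xi_set1 big1.
    by rewrite mulr0 mcoeff0 mulr0.
  by move=> c _; rewrite eq_oddE scaler0.
rewrite mxE; apply: eq_bigr => b _; rewrite !mxE mulr_suml; apply: eq_bigr => a _.
rewrite mcoeff_geval trans_odd_theta trans_theta_set1.
rewrite (sum_shift_delta _ _ (k0 := b')) => [|c]; last by rewrite eq_rshift.
by rewrite (mcoeff_trans_p 0) !mxE mulrCA mulrA.
Qed.

Lemma geval_vector_coef (u : lfun R n d) y : ghom 1 0 (geval y u) ->
  geval y u = vector n (fun b => vector_coef u y 0 b).
Proof.
move=> hu; rewrite {1}(ghom10E hu); congr vector.
by apply/funext => b; rewrite mcoeff_geval mxE.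
Qed.

(** The substitution is linear in the [theta], whose transformation law is the
  cocycle of the bundle. *)
Lemma compatible_vectorP F :
  (forall i y, chart_img i y -> ghom 1 0 (geval y (F i))) ->
  compatible F <-> forall i j x, chart_dom i x -> chart_dom j x ->
    vector_coef (F i) (chart i x) = vector_coef (F j) (chart j x) *m vb_trans A j i x.
Proof.
move=> hF; split=> [cF|tF] i j x xi xj; last first.
  rewrite (gsubst_vector _ _ (hF _ _ (chart_imgT xj))).
  rewrite (geval_vector_coef (hF _ _ (chart_imgT xi))) (tF i j x xi xj).
  transitivity (\sum_b \sum_c (vector_coef (F j) (chart j x) 0 b * vb_trans A j i x b c)
      *: gtheta R n c); last first.
    apply: eq_bigr => b _; rewrite mcoeff_geval trans_odd_theta trans_thetaE scaler_sumr.
    by apply: eq_bigr => c _; rewrite scalerA mxE.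
  by rewrite exchange_big; apply: eq_bigr => c _; rewrite mxE scaler_suml.
apply/rowP => c; rewrite [LHS]mxE -mcoeff_geval (cF _ _ _ xi xj).
rewrite (gsubst_vector _ _ (hF _ _ (chart_imgT xj))) sum_ffunE raddf_sum /= mxE.
apply: eq_bigr => b _; rewrite ffunE mcoeffZ mcoeff_geval mxE; congr (_ * _).
rewrite trans_odd_theta trans_theta_set1.
rewrite (sum_shift_delta _ _ (k0 := c)) => [|e]; last by rewrite eq_rshift.
by rewrite mcoeffZ mcoeff1 eqxx mulr1.
Qed.

Lemma bihom_vector (V : chart_index M -> 'I_d -> 'rV[R]_n -> R) :
  (forall i b, smooth_on (chart_img i) (V i b)) ->
  (forall i j x c, chart_dom i x -> chart_dom j x ->
    V i c (chart i x) = \sum_b V j b (chart j x) * vb_trans A j i x b c) ->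
  bihom (A := A) 1 0 (fun i => vector n (V i)).
Proof.
move=> sV tV; split.
- move=> i S m; rewrite sum_ffunE raddf_sum /=; apply: smooth_on_sum => [|b _].
    exact: chart_img_open.
  rewrite !ffunE mcoeffZ; apply: smooth_onM => //; first exact: chart_img_open.
  by case: eqP => _; rewrite ?mcoeff1 ?mcoeff0; [apply: smooth_onMn; first exact: chart_img_open|]; exact: smooth_on_cst.
- have vcE i y b : vector_coef (vector n (V i)) y 0 b = V i b y.
    by rewrite mxE vectorE mcoeffC eqxx mulr1.
  apply/compatible_vectorP => [i y yi|i j x xi xj].
    exact (ghom_geval (@ghom_vector _ _ _ (V i))).
  by apply/rowP => c; rewrite vcE (tV i j x c xi xj) mxE; apply: eq_bigr => b _; rewrite vcE.
move=> i y S m yi; rewrite -mcoeff_geval.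
exact (ghom_geval (y := y) (@ghom_vector _ _ _ (V i)) (S := S) (m := m)).
Qed.

Lemma geval_scale (K1 := 'rV[R]_n -> R) (f : K1) (u : lfun R n d) y :
  geval y (f *: u) = f y *: geval y u.
Proof.
apply/ffunP => S; apply/mpolyP => m; rewrite mcoeff_geval !ffunE !mcoeffZ.
by rewrite -[fun g => g y]/(eval_at y) mcoeff_map_mpoly.
Qed.

Lemma geval_godd e y : geval y (godd _ n e) = godd R n e :> galg R n d.
Proof.
apply/ffunP => S; apply/mpolyP => m; rewrite mcoeff_geval !ffunE.
by case: eqP => _; rewrite ?mcoeff1 ?mcoeff0 //; case: eqP.
Qed.

Lemma geval_bivector P y : geval y (bivector n P) =
  bivector n (fun a b => P a b y) :> galg R n d.
Proof.
rewrite raddf_sum /=; apply: eq_bigr => a _; rewrite raddf_sum /=.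
apply: eq_bigr => b _.
by rewrite geval_scale geval_gmul !geval_godd.
Qed.

(** Skewness turns the sum over [a < b] into half of a sum over all pairs of
  indices, on which the transformation law is a plain matrix congruence. *)
Lemma bihom_bivector (P : chart_index M -> 'I_d -> 'I_d -> 'rV[R]_n -> R) :
  (forall i a b, smooth_on (chart_img i) (P i a b)) ->
  (forall i a b y, chart_img i y -> P i a b y = - P i b a y) ->
  (forall i j x a b, chart_dom i x -> chart_dom j x ->
    P i a b (chart i x) = \sum_c \sum_e P j c e (chart j x) *
      (vb_trans A j i x c a * vb_trans A j i x e b)) ->
  bihom (A := A) 2 0 (fun i => bivector n (P i)).
Proof.
move=> sP skP tP; split.
- move=> i S m; have oU := @chart_img_open _ _ M i.
  rewrite sum_ffunE raddf_sum /=; apply: smooth_on_sum => // a _.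
  rewrite sum_ffunE raddf_sum /=; apply: smooth_on_sum => // b ab.
  rewrite ffunE mcoeffZ; apply: smooth_onM => //.
  rewrite gmul_godd2 /= ?ltn_add2l //.
  by case: eqP => _; rewrite ?mcoeff1 ?mcoeff0; [apply: smooth_onMn => //|]; exact: smooth_on_cst.
- move=> i j x xi xj; rewrite !geval_bivector (gsubst_bivector _ _ (@ghom_bivector _ _ _ _)).
  set T := vb_trans A j i x in tP *.
  have -> : \sum_(a < d) \sum_(b < d | (a < b)%N)
      mcoeff mnm0 (bivector n (fun a b => P j a b (chart j x)) [set rshift d a; rshift d b])
      *: (trans_odd A i j x (rshift d a) ** trans_odd A i j x (rshift d b)) =
    \sum_(a < d) \sum_(b < d | (a < b)%N) P j a b (chart j x)
      *: (trans_theta A i j x a ** trans_theta A i j x b).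
    apply: eq_bigr => a _; apply: eq_bigr => b ab.
    by rewrite bivectorE // mcoeffC eqxx mulr1 !trans_odd_theta.
  suff : bivector n (fun a b => P i a b (chart i x)) *+ 2 =
      (\sum_(a < d) \sum_(b < d | (a < b)%N) P j a b (chart j x)
      *: (trans_theta A i j x a ** trans_theta A i j x b)) *+ 2.
    exact: mulr2n_inj.
  rewrite -!sum_skew_skew; first last.
  - by move=> a b; exact: godd_anticomm.
  - by move=> a b; apply: skP; exact: chart_imgT.
  - move=> a b; rewrite (@gmulC _ _ _ 1 1 (trans_theta _ _ _ _ a)).
    + by rewrite mul1n expr1 scaleN1r.
    + by rewrite -trans_odd_theta; exact: odd_degree_trans_odd.
    + by rewrite -trans_odd_theta; exact: odd_degree_trans_odd.
  - by move=> a b; apply: skP; exact: chart_imgT.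
  have -> : \sum_c \sum_e P j c e (chart j x) *:
      (trans_theta A i j x c ** trans_theta A i j x e) =
    \sum_c \sum_e \sum_a \sum_b (P j c e (chart j x) * (T c a * T e b)) *:
      (gtheta R n a ** gtheta R n b).
    apply: eq_bigr => c _; apply: eq_bigr => e _; rewrite !trans_thetaE gmul_suml scaler_sumr.
    apply: eq_bigr => a _; rewrite gmul_sumr scaler_sumr; apply: eq_bigr => b _.
    by rewrite gmulZl gmulZr !scalerA mulrA.
  under [RHS]eq_bigr => c _ do rewrite exchange_big.
  rewrite [RHS]exchange_big; apply: eq_bigr => a _ /=.
  under [RHS]eq_bigr => c _ do rewrite exchange_big.
  rewrite [RHS]exchange_big; apply: eq_bigr => b _ /=.
  rewrite (tP i j x a b xi xj) scaler_suml; apply: eq_bigr => c _.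
  by rewrite scaler_suml.
move=> i y S m yi; rewrite -mcoeff_geval.
exact (ghom_geval (y := y) (@ghom_bivector _ _ _ (P i)) (S := S) (m := m)).
Qed.

Lemma bihom_of_fun (f : M -> R) : smooth f -> bihom 0 0 (of_fun A f).
Proof.
move=> sf; split.
- move=> i S m; rewrite ffunE; case: eqP => _; last by rewrite mcoeff0; exact: smooth_on_cst.
  rewrite mcoeffC; apply: smooth_onM; [exact: chart_img_open|exact: sf|].
  by apply: smooth_onMn; [exact: chart_img_open|exact: smooth_on_cst].
- have gevalC i x : chart_dom i x ->
      geval (chart i x) (of_fun A f i) = gconst n d (f x).
    move=> xi; apply/ffunP => S; apply/mpolyP => m; rewrite mcoeff_geval !ffunE.
    case: eqP => _; rewrite ?mcoeff0 // !mcoeffC -{2}(chartK xi).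
    by case: (m == mnm0); rewrite ?mulr1 ?mulr0.
  move=> i j x xi xj; rewrite !gevalC // gsubstE (bigD1 finset.set0) //=.
  rewrite big1 ?addr0 => [|S S0]; last first.
    by rewrite ffunE (negPf S0) gsubst_part0.
  rewrite ffunE eqxx gsubst_part_const; last first.
    by move=> m; rewrite mcoeffC; case: (m =P mnm0) => // _; rewrite mulr0 eqxx.
  by rewrite mcoeffC eqxx mulr1 enum_set0 big_nil -gconst_mull gmul1r.
move=> i y S m yi; rewrite -mcoeff_geval.
exact (ghom_geval (y := y) (@ghom_gconst _ _ _ (f \o chart_inv i)) (S := S) (m := m)).
Qed.

End Transitions.

Section Liouville.
Variables (K : comNzRingType) (n : nat).
Local Notation G := (galg K n n).
Local Notation xi := (lshift n).

Lemma gp_gxi_set1 (a b : 'I_n) :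
  (gp K n a ** gxi K n a) [set xi b] = mpolyX K (mnm1 a) *+ (a == b).
Proof. by rewrite (gpoly_mull (mpolyX K (mnm1 a))) godd_set1 eq_lshift mulr_natr. Qed.

(** The Liouville form on the cotangent bundle. *)
Definition liouville : G := \sum_(a < n) gp _ n a ** gxi _ n a.

Lemma liouville_xi b : liouville [set xi b] = mpolyX K (mnm1 b).
Proof.
rewrite sum_ffunE (bigD1 b) //= gp_gxi_set1 eqxx big1 ?addr0 // => a ab.
by rewrite gp_gxi_set1 (negPf ab).
Qed.

Lemma ghom_liouville : ghom 1 2 liouville.
Proof.
apply: ghom_sum => a _ S m; rewrite /has_coef (gpoly_mull (mpolyX K (mnm1 a))).
rewrite ffunE; case: (S =P [set xi a]) => [->|_]; last by rewrite mulr0 mcoeff0 eqxx.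
rewrite mulr1 mcoeffX; case: (mnm1 a =P m) => [<-|_]; last by rewrite eqxx.
by rewrite mdeg1 !weightE.
Qed.

Lemma liouville_neq S : (forall b, S != [set xi b]) -> liouville S = 0.
Proof.
move=> Sb; rewrite sum_ffunE big1 // => a _.
by rewrite (gpoly_mull (mpolyX K (mnm1 a))) ffunE (negPf (Sb a)) mulr0.
Qed.

End Liouville.

Section TangentStructure.
Variables (R : realType) (n : nat) (M : manifold R n).
Local Notation TM := (tangent_bundle M).

(** The Liouville form is invariant.  The inhomogeneous part of the
  transformation of the momenta pairs the second derivatives of the change of
  coordinates, which are symmetric, with anticommuting generators. *)
Lemma bihom_tangent_mu : bihom 1 2 (tangent_mu M).
Proof.
split.
- move=> i S m; have oU := @chart_img_open _ _ M i.
  rewrite sum_ffunE raddf_sum /=; apply: smooth_on_sum => // a _.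
  rewrite (gpoly_mull (mpolyX _ (mnm1 a))) ffunE mulr_natr mcoeffMn mcoeffX.
  by apply: smooth_onMn => //; apply: smooth_onMn => //; exact: smooth_on_cst.
- move=> i j x xi xj.
  have gevalT y k : geval y (tangent_mu M k) = liouville R n.
    rewrite raddf_sum /=; apply: eq_bigr => a _; rewrite geval_gmul geval_godd.
    congr (_ ** _); apply/ffunP => S; apply/mpolyP => m; rewrite mcoeff_geval !ffunE.
    by case: eqP => _; rewrite ?mcoeff0 // !mcoeffX; case: eqP.
  rewrite !gevalT gsubstE (sum_set1 (h := @lshift n n)); first last.
  + by move=> S S1; rewrite liouville_neq // gsubst_part0.
  + exact: lshift_inj.
  transitivity (\sum_(b < n) trans_p TM i j x b ** trans_xi TM i j x b); last first.
    apply: eq_bigr => b _; rewrite liouville_xi gsubst_part_linear; last first.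
      by move=> m; rewrite mcoeffX; case: (mnm1 b =P m) => [<- _|_]; rewrite ?mdeg1 ?eqxx.
    rewrite (bigD1 b) //= mcoeffX eqxx scale1r trans_odd_xi big1 ?addr0 // => a ab.
    by rewrite mcoeffX (inj_eq (@mnm1_inj n)) eq_sym (negPf ab) scale0r.
  (* The second derivatives of the change of coordinates. *)
  set H := fun a b c => pderiv a (fun y => Defs.jacobian j i (chart_inv j y) b c) (chart j x).
  have Hsym a b c : H a b c = H b a c.
    pose h y := chart i (chart_inv j y) 0 c.
    have oV := @open_chart_overlap _ _ M j i.
    have HE a' b' : H a' b' c = pderiv a' (pderiv b' h) (chart j x).
      apply: (eq_on_pderiv _ oV); last by exists x.
      by move=> _ [z [zi zj] <-]; rewrite mxE chartK.
    rewrite !HE; apply: (pderivC _ _ oV); last by exists x.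
    by rewrite setIC; exact: chart_smooth.
  transitivity (\sum_(a < n) (\sum_(b < n) Defs.jacobian j i x a b *: gp R n b) **
       trans_xi TM i j x a +
     \sum_(a < n) \sum_(b < n) \sum_(c < n) H a b c *:
       ((trans_xi TM i j x b ** gtheta R n c) ** trans_xi TM i j x a)); last first.
    rewrite -big_split /=; apply: eq_bigr => a _; rewrite /trans_p gmulDl; congr (_ ** _ + _).
      by apply: eq_bigr => b _; rewrite gconst_mull.
    rewrite gmul_suml; apply: eq_bigr => b _; rewrite gmul_suml; apply: eq_bigr => c _.
    by rewrite gconst_mull gmulZl.
  have -> : \sum_(a < n) \sum_(b < n) \sum_(c < n) H a b c *:
      ((trans_xi TM i j x b ** gtheta R n c) ** trans_xi TM i j x a) = 0.
    under eq_bigr => a _ do rewrite exchange_big /=.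
    rewrite exchange_big big1 // => c _ /=.
    apply: (sum_sym_skew (H := fun a b => H a b c)
      (w := fun a b => (trans_xi TM i j x b ** gtheta R n c) ** trans_xi TM i j x a)) => // a b.
    have anti (u v : galg R n n) : odd_degree 1 u -> odd_degree 1 v -> u ** v = - (v ** u).
      by move=> du dv; rewrite (gmulC du dv) mul1n expr1 scaleN1r.
    have dx a' := @odd_degree_trans_xi _ _ _ _ TM i j x a'.
    have dt : odd_degree 1 (gtheta R n c) by exact: odd_degree_godd.
    rewrite -gmulA (anti _ _ dt (dx a)) gmulNr gmulA (anti _ _ (dx b) (dx a)).
    by rewrite gmulNl opprK -gmulA (anti _ _ (dx b) dt) gmulNr gmulA.
  rewrite addr0.
  transitivity (\sum_(a < n) \sum_(b < n) \sum_(c < n)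
      (Defs.jacobian i j x c a * Defs.jacobian j i x a b) *: (gp R n b ** gxi R n c)); last first.
    apply: eq_bigr => a _; rewrite gmul_suml; apply: eq_bigr => b _.
    rewrite trans_xiE gmul_sumr; apply: eq_bigr => c _.
    by rewrite gmulZl gmulZr scalerA mulrC.
  rewrite exchange_big; apply: eq_bigr => b _ /=; rewrite exchange_big /=.
  have JJ c : \sum_(a < n) Defs.jacobian i j x c a * Defs.jacobian j i x a b = (c == b)%:R.
    have /matrixP/(_ c b) := jacobian_cocycle xi xj xi.
    by rewrite (jacobian_id xi) !mxE => ->.
  under eq_bigr => c _ do rewrite -scaler_suml JJ.
  rewrite (bigD1 b) //= eqxx scale1r big1 ?addr0 // => c /negPf ->.
  by rewrite scale0r.
move=> i y S m yi; rewrite -mcoeff_geval.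
exact (ghom_geval (y := y) (@ghom_liouville _ n) (S := S) (m := m)).
Qed.

End TangentStructure.

(** * Brackets with functions and with sections *)

Section CoefficientSums.
Variables (K : comNzRingType) (n : nat) (I : Type) (r : seq I) (P : pred I).
Implicit Types (F : I -> mpoly n K).

Lemma mcoeff_sum m F :
  mcoeff m (\sum_(i <- r | P i) F i) = \sum_(i <- r | P i) mcoeff m (F i).
Proof. exact: raddf_sum. Qed.

Lemma mderiv_sum a F :
  mderiv a (\sum_(i <- r | P i) F i) = \sum_(i <- r | P i) mderiv a (F i).
Proof. exact: raddf_sum. Qed.

End CoefficientSums.

Section OddProducts.
Variables (K : comNzRingType) (n d : nat).
Implicit Types (u v : galg K n d) (W : {set 'I_(d + d)}) (s t : 'I_(d + d)).

Lemma gmul_odd1r u v W : odd_degree 1 v ->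
  (u ** v) W = \sum_(t in W) (-1) ^+ inversions (W :\ t) [set t] * (u (W :\ t) * v [set t]).
Proof.
move=> dv; rewrite gmulE.
rewrite (reindex_onto (fun T => W :\: T) (fun T => W :\: T)) /=; last first.
  by move=> S SW; rewrite finset.setDDr finset.setDv finset.set0U (finset.setIidPr SW).
rewrite (eq_bigl (fun T : {set 'I_(d + d)} => T \subset W)) => [|S]; last first.
  rewrite finset.subsetDl /= finset.setDDr finset.setDv finset.set0U.
  by apply/eqP/idP => [<-|/finset.setIidPr//]; exact: finset.subsetIl.
rewrite big_mkcond /= (sum_inj (h := fun t => [set t]) (C := fun t => t \in W)).
- apply: eq_bigr => t tW; rewrite finset.sub1set tW.
  by rewrite finset.setDDr finset.setDv finset.set0U (finset.setIidPr _) ?finset.sub1set.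
- by move=> s t _ _ /finset.set1_inj.
move=> T TW; case: ifP => // TsW.
rewrite finset.setDDr finset.setDv finset.set0U (finset.setIidPr TsW).
rewrite (odd_degree_eq0 dv) ?mulr0 //; apply/negP => /cards1P[t tE].
have tW : t \in W by rewrite -finset.sub1set -tE.
by have := TW t tW; rewrite tE eqxx.
Qed.

End OddProducts.

Section LocalBrackets.
Variables (R : realType) (n d : nat).
Local Notation K := ('rV[R]_n -> R).
Local Notation L := (lfun R n d).
Local Notation xi := (lshift d).
Local Notation th := (rshift d).
Implicit Types (u v w : L) (S : {set 'I_(d + d)}) (f g : K) (a : 'I_n)
  (b c e : 'I_d) (m : multinom n).

Lemma has_coef_eq0 u : (forall S m, ~ has_coef u S m) -> u = 0.
Proof.
move=> u0; apply/ffunP => S; apply/mpolyP => m; rewrite [in RHS]ffunE mcoeff0.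
by apply/eqP; apply: contraT => /u0.
Qed.

Lemma lt_xi_theta b c : (xi b < th c)%N.
Proof. by rewrite /= ltn_addr. Qed.

Lemma ghom_dx k l a u : ghom k l u -> ghom k l (dx a u).
Proof. by move=> hu S m /has_coef_dx/hu. Qed.

Lemma ghom_dp k l a u : ghom k.+1 l.+1 u -> ghom k l (dp a u).
Proof. by move=> hu S m /has_coef_dp/hu; rewrite mdegD mdeg1; lia. Qed.

Lemma dp_eq0 k l a u : ghom k l u -> (k == 0%N) || (l == 0%N) -> dp a u = 0.
Proof.
move=> hu kl; apply: has_coef_eq0 => S m /has_coef_dp/hu; rewrite mdegD mdeg1.
by move: kl => /orP[/eqP->|/eqP->]; lia.
Qed.

Lemma dleft_xi_eq0 k b u : ghom k 0 u -> dleft (xi b) u = 0.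
Proof.
move=> hu; apply: has_coef_eq0 => S m /has_coef_dleft[nS /hu].
by rewrite !odd_weightU1 // !weightE; lia.
Qed.

Lemma dright_xi_eq0 k b u : ghom k 0 u -> dright (xi b) u = 0.
Proof.
move=> hu; apply: has_coef_eq0 => S m /has_coef_dright[nS /hu].
by rewrite !odd_weightU1 // !weightE; lia.
Qed.

Lemma dleft_set0 (s : 'I_(d + d)) u : dleft s u finset.set0 = u [set s].
Proof. by rewrite ffunE inE inversions0r mul1r finset.setU0. Qed.

Lemma dright_set0 (s : 'I_(d + d)) u : dright s u finset.set0 = u [set s].
Proof. by rewrite ffunE inE inversions0l mul1r finset.setU0. Qed.

Lemma dp_gconst a f : dp a (gconst n d f) = 0.
Proof. exact: dp_eq0 (@ghom_gconst _ _ _ f) isT. Qed.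

Lemma dleft_gconst (s : 'I_(d + d)) f : dleft s (gconst n d f) = 0.
Proof.
apply/ffunP => S; rewrite !ffunE; case: ifP => // _.
rewrite ifN ?mulr0 //; apply/finset.set0Pn.
by exists s; rewrite !inE eqxx.
Qed.

Lemma dright_gconst (s : 'I_(d + d)) f : dright s (gconst n d f) = 0.
Proof.
apply/ffunP => S; rewrite !ffunE; case: ifP => // _.
rewrite ifN ?mulr0 //; apply/finset.set0Pn.
by exists s; rewrite !inE eqxx.
Qed.

Lemma dx_gconst a f : dx a (gconst n d f) = gconst n d (pderiv a f).
Proof.
have pd0 : pderiv a (0 : K) = 0 by apply/funext => y; exact: pderiv_cst.
apply/ffunP => S; apply/mpolyP => m; rewrite mcoeff_dx !ffunE.
case: eqP => _; last by rewrite mcoeff0 pd0.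
by rewrite !mcoeffC; case: (m == mnm0); rewrite ?mulr1 ?mulr0.
Qed.

Lemma lbracket_gconstr u f S :
  lbracket u (gconst n d f) S = \sum_a pderiv a f *: mderiv a (u S).
Proof.
rewrite ffunE [X in _ + X]sum_ffunE [X in _ + X]big1 ?addr0 => [|b _]; last first.
  by rewrite !dleft_gconst !gmul0r addr0 ffunE.
rewrite sum_ffunE; apply: eq_bigr => a _.
by rewrite dp_gconst gmul0r subr0 dx_gconst gconst_mulr !ffunE.
Qed.

Lemma lbracket_gconstl f v S :
  lbracket (gconst n d f) v S = - \sum_a pderiv a f *: mderiv a (v S).
Proof.
rewrite ffunE [X in _ + X]sum_ffunE [X in _ + X]big1 ?addr0 => [|b _]; last first.
  by rewrite !dright_gconst !gmul0l addr0 ffunE.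
rewrite sum_ffunE -sumrN; apply: eq_bigr => a _.
by rewrite dp_gconst gmul0l sub0r dx_gconst gconst_mull !ffunE.
Qed.

(** The components in the frame of the [theta], for an element of bidegree (1, 0),
  i.e. a section. *)
Definition scoef u b : K := mcoeff mnm0 (u [set th b]).

Lemma scoef_dx a u b : scoef (dx a u) b = pderiv a (scoef u b).
Proof. exact: mcoeff_dx. Qed.

Lemma eq_geval_scoef u v b y : geval y u = geval y v -> scoef u b y = scoef v b y.
Proof. by move=> /gevalP uv; exact: uv. Qed.

Lemma scoefD u v b : scoef (u + v) b = scoef u b + scoef v b.
Proof. by rewrite /scoef ffunE mcoeffD. Qed.

Lemma scoefN u b : scoef (- u) b = - scoef u b.
Proof. by rewrite /scoef ffunE mcoeffN. Qed.

Lemma scoefZ f u b : scoef (f *: u) b = f * scoef u b.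
Proof. by rewrite /scoef ffunE mcoeffZ. Qed.

Lemma ghom10_theta u b : ghom 1 0 u -> u [set th b] = mpolyC n (scoef u b).
Proof. by move=> hu; apply: (ghom_mpolyC hu); rewrite weightE. Qed.

Lemma dleft_theta u b : ghom 1 0 u -> dleft (th b) u = gconst n d (scoef u b).
Proof.
move=> hu; have h0 : ghom 0 0 (dleft (th b) u).
  by move=> S m /has_coef_dleft[nS /hu]; rewrite !odd_weightU1 // !weightE; lia.
by rewrite (ghom00E h0) dleft_set0.
Qed.

Lemma dright_theta u b : ghom 1 0 u -> dright (th b) u = gconst n d (scoef u b).
Proof.
move=> hu; have h0 : ghom 0 0 (dright (th b) u).
  by move=> S m /has_coef_dright[nS /hu]; rewrite !odd_weightU1 // !weightE; lia.
by rewrite (ghom00E h0) dright_set0.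
Qed.

Lemma lbracket_vectorl u v : ghom 1 0 u -> lbracket u v =
  \sum_b scoef u b *: dleft (xi b) v - \sum_a dx a u ** dp a v.
Proof.
move=> hu; rewrite /lbracket addrC; congr (_ + _).
  apply: eq_bigr => b _; rewrite (dright_xi_eq0 _ hu) gmul0l addr0.
  by rewrite dright_theta // gconst_mull.
rewrite -sumrN; apply: eq_bigr => a _.
by rewrite (dp_eq0 _ hu) // gmul0l sub0r.
Qed.

Lemma lbracket_vectorr u v : ghom 1 0 v -> lbracket u v =
  \sum_a dp a u ** dx a v + \sum_b scoef v b *: dright (xi b) u.
Proof.
move=> hv; rewrite /lbracket; congr (_ + _).
  by apply: eq_bigr => a _; rewrite (dp_eq0 _ hv) // gmul0r subr0.
apply: eq_bigr => b _; rewrite (dleft_xi_eq0 _ hv) gmul0r add0r.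
by rewrite dleft_theta // gconst_mulr.
Qed.

End LocalBrackets.

Section JacobiBracket.
Variables (R : realType) (n d : nat).
Local Notation K := ('rV[R]_n -> R).
Local Notation L := (lfun R n d).
Local Notation xi := (lshift d).
Local Notation th := (rshift d).
Implicit Types (u v w V W : L) (S : {set 'I_(d + d)}) (f g : K) (a : 'I_n)
  (b c e : 'I_d) (m : multinom n).

Definition local_id : L := \sum_(a < d) gxi _ n a ** gtheta _ n a.

Definition local_jacobi_bracket (mu phi P Q : L) : L :=
  lbracket (lbracket P (mu + local_id ** phi)) Q
  - P ** lbracket phi Q + lbracket P phi ** Q.

Lemma local_idE S : local_id S = \sum_(a < d) (S == [set xi a; th a])%:R.
Proof.
by rewrite sum_ffunE; apply: eq_bigr => a _; rewrite gmul_godd2 ?lt_xi_theta.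
Qed.

Lemma xi_theta_set2_inj b c b' c' :
  ([set xi b; th c] == [set xi b'; th c']) = (b == b') && (c == c').
Proof.
apply/eqP/andP => [/finset.setP E|[/eqP-> /eqP->]//]; split.
  by have := E (xi b); rewrite !inE !eq_oddE !orbF eqxx => /esym.
by have := E (th c); rewrite !inE !eq_oddE eqxx /= => /esym.
Qed.

Lemma local_id_set2 b c : local_id [set xi b; th c] = (b == c)%:R.
Proof.
rewrite local_idE (bigD1 b) //= xi_theta_set2_inj eqxx big1 ?addr0 => [|a ab].
  by rewrite eq_sym.
by rewrite xi_theta_set2_inj eq_sym (negPf ab).
Qed.

Lemma ghom_local_id : ghom 1 1 local_id.
Proof.
move=> S m; rewrite /has_coef local_idE => nz.
have [a Sa] : exists a : 'I_d, S = [set xi a; th a].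
  apply: contrapT => no; move/eqP: nz; apply; rewrite big1 ?mcoeff0 // => a _.
  by case: eqP => // Sa; case: no; exists a.
have m0 : m = mnm0.
  apply: contrapT => /eqP mn0; move/eqP: nz; apply.
  rewrite raddf_sum big1 //= => b _; case: eqP => _; rewrite ?mcoeff0 //.
  by rewrite mcoeff1 (negPf mn0).
by rewrite m0 Sa mdeg0 !odd_weightU1 ?inE ?eq_oddE // !weightE.
Qed.

Lemma odd_degree_local_id : odd_degree 2 local_id.
Proof.
apply: odd_degree_sum => a _; apply: (@odd_degreeM _ _ _ 1 1);
exact: odd_degree_godd.
Qed.

Section Algebroid.
Variables (mu phi : L).
Hypotheses (hmu : ghom 1 2 mu) (hphi : ghom 0 1 phi).

Definition anchor a b : K := mcoeff (mnm1 a) (mu [set xi b]).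
Definition cocycle b : K := mcoeff mnm0 (phi [set xi b]).
Definition structure_fun c e b : K :=
  mcoeff mnm0 (dleft (xi e) mu [set xi b; th c]).

(** The action on functions of a section with components [V]: the bracket
  [V, g] of the Jacobi algebroid. *)
Definition act (V : 'I_d -> K) g : K :=
  \sum_b V b * (\sum_a anchor a b * pderiv a g + cocycle b * g).

Local Notation mu' := (mu + local_id ** phi).

Lemma odd_degree_phi : odd_degree 1 phi.
Proof.
move=> S; apply: contraNeq => S1; apply/eqP/mpolyP => m; rewrite mcoeff0.
by apply/eqP; apply: contraT => /hphi; move: S1; rewrite odd_weight_card; lia.
Qed.

Lemma ghom_mu' : ghom 1 2 mu'.
Proof. by apply: ghomD => //; exact: (@ghom_gmul _ _ _ 1 1 0 1) ghom_local_id hphi. Qed.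

Lemma mu'_xi b : mu' [set xi b] = mu [set xi b].
Proof.
have deg3 : odd_degree 3 (local_id ** phi).
  exact: (@odd_degreeM _ _ _ 2 1) odd_degree_local_id odd_degree_phi.
by rewrite ffunE (odd_degree_eq0 deg3) ?addr0 // cards1.
Qed.

Lemma mderiv_mu_xi a b : mcoeff mnm0 (mderiv a (mu [set xi b])) = anchor a b.
Proof.
rewrite mcoeff_mderiv mnm0E mulr1n /anchor; congr (mcoeff _ _).
by apply/mnmP => k; rewrite mnmDE mnm0E.
Qed.

Lemma phi_xi b : phi [set xi b] = mpolyC n (cocycle b).
Proof. by apply: (ghom_mpolyC hphi); rewrite weightE. Qed.

Lemma set0_eq0 k l u : ghom k l u -> k != l -> u finset.set0 = 0.
Proof. by move=> hu kl; apply: (ghom_set0 hu); rewrite !weightE !addn0. Qed.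

Lemma lbracket_vector_mu0 V : ghom 1 0 V ->
  lbracket V mu' finset.set0 = \sum_b scoef V b *: mu [set xi b].
Proof.
move=> hV; rewrite (lbracket_vectorl _ hV) ffunE [X in _ + X]ffunE.
rewrite [X in _ - X]sum_ffunE [X in _ - X]big1 ?subr0 => [|a _]; last first.
  by rewrite gmul_set0 (set0_eq0 (ghom_dx (a := a) hV)) // mul0r.
rewrite sum_ffunE; apply: eq_bigr => b _.
by rewrite ffunE dleft_set0 mu'_xi.
Qed.

Lemma lbracket_phi_fun g : lbracket phi (gconst n d g) = 0.
Proof.
apply/ffunP => S; rewrite lbracket_gconstr [RHS]ffunE big1 // => a _.
have /ffunP/(_ S) := dp_eq0 a hphi isT; rewrite !ffunE => ->.
by rewrite scaler0.
Qed.

Lemma lbracket_fun_phi g : lbracket (gconst n d g) phi = 0.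
Proof.
apply/ffunP => S; rewrite lbracket_gconstl [RHS]ffunE big1 ?oppr0 // => a _.
have /ffunP/(_ S) := dp_eq0 a hphi isT; rewrite !ffunE => ->.
by rewrite scaler0.
Qed.

Lemma lbracket_vector_phi V : ghom 1 0 V ->
  lbracket V phi = gconst n d (\sum_b scoef V b * cocycle b).
Proof.
move=> hV; have h0 : ghom 0 0 (lbracket V phi) by apply: ghom_lbracket hV hphi.
rewrite (ghom00E h0); congr gconst.
rewrite (lbracket_vectorl _ hV) ffunE [X in _ + X]ffunE.
rewrite [X in _ - X]sum_ffunE [X in _ - X]big1 ?subr0 => [|a _]; last first.
  by rewrite gmul_set0 (set0_eq0 (ghom_dx (a := a) hV)) // mul0r.
rewrite sum_ffunE mcoeff_sum; apply: eq_bigr => b _.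
by rewrite ffunE dleft_set0 phi_xi mcoeffZ mcoeffC eqxx mulr1.
Qed.

Lemma lbracket_phi_vector V : ghom 1 0 V ->
  lbracket phi V = gconst n d (\sum_b scoef V b * cocycle b).
Proof.
move=> hV; have h0 : ghom 0 0 (lbracket phi V) by apply: ghom_lbracket hphi hV.
rewrite (ghom00E h0); congr gconst.
rewrite (lbracket_vectorr _ hV) ffunE.
rewrite [X in X + _]sum_ffunE [X in X + _]big1 ?add0r => [|a _]; last first.
  by rewrite gmul_set0 (set0_eq0 (ghom_dx (a := a) hV)) // mulr0.
rewrite sum_ffunE mcoeff_sum; apply: eq_bigr => b _.
by rewrite ffunE dright_set0 phi_xi mcoeffZ mcoeffC eqxx mulr1.
Qed.

Lemma jacobi_bracket_vector_fun V g : ghom 1 0 V ->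
  local_jacobi_bracket mu phi V (gconst n d g) = gconst n d (act (scoef V) g).
Proof.
move=> hV; rewrite /local_jacobi_bracket lbracket_phi_fun gmul0r subr0.
rewrite lbracket_vector_phi // gconst_mull.
set u := lbracket (lbracket V mu') _.
have hu1 : ghom 1 1 (lbracket V mu') by apply: ghom_lbracket hV ghom_mu'.
have hu : ghom 0 0 u by apply: ghom_lbracket hu1 (@ghom_gconst _ _ _ g).
have -> : u = gconst n d (\sum_b scoef V b * \sum_a anchor a b * pderiv a g).
  rewrite (ghom00E hu); congr gconst; rewrite lbracket_gconstr lbracket_vector_mu0 //.
  under eq_bigr => a _ do rewrite mderiv_sum scaler_sumr.
  rewrite mcoeff_sum; under eq_bigr => a _ do rewrite mcoeff_sum.
  rewrite exchange_big; apply: eq_bigr => b _; rewrite mulr_sumr.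
  apply: eq_bigr => a _; rewrite mcoeffZ mderivZ mcoeffZ mderiv_mu_xi.
  by rewrite mulrCA [anchor _ _ * _]mulrC.
apply/ffunP => S; rewrite !ffunE; case: eqP => _; last by rewrite scaler0 addr0.
rewrite -mul_mpolyC -mpolyCM -mpolyCD; congr mpolyC.
rewrite /act mulr_suml -big_split; apply: eq_bigr => b _ /=.
by rewrite mulrDr mulrA.
Qed.

Lemma jacobi_bracket_fun_vector f W : ghom 1 0 W ->
  local_jacobi_bracket mu phi (gconst n d f) W = gconst n d (- act (scoef W) f).
Proof.
move=> hW; rewrite /local_jacobi_bracket lbracket_fun_phi gmul0l addr0.
rewrite lbracket_phi_vector // gconst_mull.
set u := lbracket (lbracket _ mu') _.
have hu' : ghom 0 1 (lbracket (gconst n d f) mu').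
  by apply: ghom_lbracket (@ghom_gconst _ _ _ f) ghom_mu'.
have hu : ghom 0 0 u by apply: ghom_lbracket hu' hW.
have -> : u = gconst n d (- \sum_b scoef W b * \sum_a anchor a b * pderiv a f).
  rewrite (ghom00E hu); congr gconst; rewrite /u (lbracket_vectorr _ hW) ffunE.
  rewrite [X in X + _]sum_ffunE [X in X + _]big1 ?add0r => [|a _]; last first.
    by rewrite gmul_set0 (set0_eq0 (ghom_dx (a := a) hW)) // mulr0.
  rewrite sum_ffunE mcoeff_sum -sumrN; apply: eq_bigr => b _.
  rewrite ffunE dright_set0 lbracket_gconstl mu'_xi mcoeffZ mcoeffN mulrN.
  congr (- (_ * _)); rewrite mcoeff_sum; apply: eq_bigr => a _.
  by rewrite mcoeffZ mderiv_mu_xi mulrC.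
apply/ffunP => S; rewrite !ffunE; case: eqP => _; last by rewrite scaler0 oppr0 addr0.
rewrite -mul_mpolyC -mpolyCM -mpolyCB; congr mpolyC.
rewrite /act -opprD; congr (- _); rewrite mulr_sumr -big_split; apply: eq_bigr => b _ /=.
by rewrite mulrDr [f * _]mulrC mulrA.
Qed.

(** The contribution of [id_A phi] to the structure functions. *)
Lemma dleft_id_phi e b c :
  mcoeff mnm0 (dleft (xi e) (local_id ** phi) [set xi b; th c]) =
  cocycle e *+ (b == c) - cocycle b *+ (e == c).
Proof.
have [->|eb] := eqVneq e b.
  by rewrite ffunE !inE eqxx mcoeff0 subrr.
rewrite ffunE !inE !eq_oddE (negPf eb) /=.
rewrite gmul_odd1r; last exact: odd_degree_phi.
set W := xi e |: _.
have phith k : phi [set th k] = 0.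
  by apply: (ghom_set0 hphi); rewrite !weightE.
have WE : W = [set xi e; xi b; th c].
  by rewrite /W finset.setUA.
have We : W :\ xi e = [set xi b; th c].
  by rewrite /W finset.setU1K // !inE !eq_oddE negb_or eb.
have Wb : W :\ xi b = [set xi e; th c].
  apply/finset.setP => s; rewrite !inE; case: (eqVneq s (xi b)) => [->|_] /=.
    by rewrite !eq_oddE eq_sym (negPf eb).
  by [].
rewrite (bigD1 (xi e)) /= ?inE ?eqxx // (bigD1 (xi b)) /=; last first.
  by rewrite !inE eqxx orbT eq_lshift eq_sym eb.
rewrite big1 ?addr0 => [|s /andP[/andP[sW se] sb]]; last first.
  move: sW; rewrite !inE (negPf se) (negPf sb) /= => /eqP ->.
  by rewrite phith !mulr0.
rewrite We Wb !local_id_set2 !phi_xi.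
have dbc : [disjoint [set xi b] & [set th c]].
  by rewrite disjoints1 inE eq_oddE.
have dec : [disjoint [set xi e] & [set th c]].
  by rewrite disjoints1 inE eq_oddE.
rewrite !inversionsUl // inversionsUr // !inversions11 !lt_xi_theta.
rewrite [(th c < xi e)%N]ltnNge (ltnW (lt_xi_theta _ _)) addn0 !addn1 !exprS.
transitivity (mcoeff mnm0 (mpolyC n (cocycle e *+ (b == c) - cocycle b *+ (e == c)))).
  move: eb; rewrite -(inj_eq (@lshift_inj d d)) -(inj_eq val_inj) neq_ltn => eb.
  congr (mcoeff _ _); rewrite mpolyCB !mpolyCMn.
  rewrite -[X in _ = X - _]mulr_natl -[X in _ = _ - X]mulr_natl; move: eb; move: ((b == c)%:R) ((e == c)%:R) => p q.
  case: (ltngtP (val (xi e)) (val (xi b))) => // _ _; rewrite expr0 expr1; ring.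
by rewrite mcoeffC eqxx mulr1.
Qed.

(** The terms in [phi] that come from [id_A phi] cancel those of
  [- P {phi, Q} + {P, phi} Q]: on sections the bracket is the one of [mu]. *)
Lemma jacobi_bracket_vectors V W : ghom 1 0 V -> ghom 1 0 W ->
  ghom 1 0 (local_jacobi_bracket mu phi V W) /\
  forall c, scoef (local_jacobi_bracket mu phi V W) c =
    \sum_b (scoef V b * (\sum_a anchor a b * pderiv a (scoef W c)) -
            scoef W b * (\sum_a anchor a b * pderiv a (scoef V c))) -
    \sum_e \sum_b scoef V e * scoef W b * structure_fun c e b.
Proof.
move=> hV hW; have hu : ghom 1 1 (lbracket V mu') by apply: ghom_lbracket hV ghom_mu'.
have hphiW := lbracket_phi_vector hW; have hVphi := lbracket_vector_phi hV.
split.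
  apply: ghomD; first apply: ghomB.
  - by apply: ghom_lbracket hu hW.
  - by rewrite hphiW gconst_mulr; exact: ghomZ.
  - by rewrite hVphi gconst_mull; exact: ghomZ.
move=> c; rewrite /local_jacobi_bracket hphiW hVphi gconst_mull gconst_mulr.
rewrite scoefD scoefD scoefN !scoefZ [scoef (lbracket _ _) _]/scoef.
have U2 b : mcoeff mnm0 (dright (xi b) (lbracket V mu') [set th c]) =
    - (\sum_e scoef V e * (structure_fun c e b + cocycle e *+ (b == c) - cocycle b *+ (e == c))
       + \sum_a pderiv a (scoef V c) * anchor a b).
  rewrite ffunE !inE eq_oddE inversions11 lt_xi_theta expr1 mulN1r mcoeffN.
  congr (- _); rewrite (lbracket_vectorl _ hV) ffunE mcoeffD.
  rewrite sum_ffunE mcoeff_sum; congr (_ + _).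
    apply: eq_bigr => e _; rewrite ffunE mcoeffZ; congr (_ * _).
    rewrite -addrA -dleft_id_phi -mcoeffD; congr (mcoeff _ _).
    by rewrite !ffunE; case: ifP => _; rewrite ?addr0 ?mulrDr.
  rewrite ffunE sum_ffunE mcoeffN mcoeff_sum -sumrN; apply: eq_bigr => a _.
  rewrite gmul_set2 ?lt_xi_theta // (set0_eq0 (ghom_dx (a := a) hV)) // mul0r add0r.
  rewrite (ghom_set0 (ghom_dx (a := a) hV) (S := [set xi b])) ?weightE // mul0r add0r.
  rewrite (ghom_set0 (ghom_dx (a := a) hV) (S := [set xi b; th c])); last first.
    by rewrite !odd_weightU1 ?inE ?eq_oddE // !weightE.
  rewrite mul0r addr0 mcoeffN opprK (ghom10_theta _ (ghom_dx (a := a) hV)) scoef_dx.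
  rewrite mul_mpolyC mcoeffZ; congr (_ * _).
  by rewrite ffunE mu'_xi mderiv_mu_xi.
rewrite (lbracket_vectorr _ hW) ffunE mcoeffD !sum_ffunE !mcoeff_sum.
have -> : \sum_a mcoeff mnm0 ((dp a (lbracket V mu') ** dx a W) [set th c]) =
    \sum_b scoef V b * \sum_a anchor a b * pderiv a (scoef W c).
  under [RHS]eq_bigr => b _ do rewrite mulr_sumr.
  rewrite exchange_big; apply: eq_bigr => a _.
  rewrite gmul_set1 (set0_eq0 (ghom_dx (a := a) hW)) // mulr0 addr0.
  rewrite (ghom10_theta _ (ghom_dx (a := a) hW)) scoef_dx mulrC mul_mpolyC mcoeffZ.
  rewrite ffunE lbracket_vector_mu0 // mderiv_sum mcoeff_sum mulr_sumr.
  apply: eq_bigr => b _; rewrite mderivZ mcoeffZ mderiv_mu_xi.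
  by rewrite mulrCA [pderiv _ _ * _]mulrC.
have -> : \sum_b mcoeff mnm0 ((scoef W b *: dright (xi b) (lbracket V mu')) [set th c]) =
    - (\sum_b scoef W b * \sum_a anchor a b * pderiv a (scoef V c) +
       \sum_e \sum_b scoef V e * scoef W b * structure_fun c e b +
       scoef W c * (\sum_b scoef V b * cocycle b) -
       scoef V c * (\sum_b scoef W b * cocycle b)).
  transitivity (- \sum_b (scoef W b * \sum_a anchor a b * pderiv a (scoef V c) +
      (\sum_e scoef V e * scoef W b * structure_fun c e b +
      (scoef W b *+ (b == c) * (\sum_e scoef V e * cocycle e) -
       scoef V c * (scoef W b * cocycle b))))).
    rewrite -sumrN; apply: eq_bigr => b _; rewrite ffunE mcoeffZ U2 mulrN mulrDr.
    congr (- _); rewrite addrC; congr (_ + _).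
      by congr (_ * _); apply: eq_bigr => a _; rewrite mulrC.
    rewrite [LHS]mulr_sumr; under [LHS]eq_bigr => e _ do
      rewrite mulrA -addrA mulrDr mulrBr [scoef W b * scoef V e]mulrC.
    rewrite big_split; congr (_ + _); rewrite /= sumrB; congr (_ - _).
      rewrite mulr_sumr; apply: eq_bigr => e _.
      by case: (b == c); rewrite ?mulr0n ?mulr1n ?mulr0 ?mul0r // mulrAC mulrC.
    rewrite (bigD1 c) //= eqxx mulr1n big1 ?addr0 => [|e /negPf ->].
      by rewrite mulrA.
    by rewrite mulr0n mulr0.
  rewrite !big_split /= sumrN -mulr_sumr -mulr_suml exchange_big /=.
  rewrite [\sum_b _ *+ _](bigD1 c) //= eqxx mulr1n.
  rewrite [X in scoef W c + X]big1 ?addr0 => [|b /negPf ->]; last by rewrite mulr0n.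
  by rewrite !addrA.
rewrite [X in _ = X - _]sumrB.
set s1 := \sum_b _ * \sum_a _; set s2 := \sum_b scoef W b * \sum_a _.
move: (\sum_e _) (\sum_b scoef V b * cocycle b) (\sum_b scoef W b * cocycle b).
by move=> x y z; ring.
Qed.

End Algebroid.
End JacobiBracket.

Section GenericSet2.
Variables (K : comNzRingType) (n d : nat).
Local Notation L := (galg K n d).
Implicit Types (u v w : L) (S : {set 'I_(d + d)}) (s t : 'I_(d + d)).

Lemma galgDE u v S : (u + v) S = u S + v S. Proof. by rewrite ffunE. Qed.
Lemma galgBE u v S : (u - v) S = u S - v S. Proof. by rewrite !ffunE. Qed.

(** The shape of a bracket [{w, w}] at a pair of odd generators: the two products
  in each summand are exchanged by the symmetry of the bracket and contribute
  equally, hence the factor 2. *)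
Lemma gmul_pairs_set2 (Dp Dx : 'I_n -> L) (Rt Lx Rx Lt : 'I_d -> L)
    (z y : 'I_d -> mpoly n K) s t : (s < t)%N ->
  (forall a, Dp a finset.set0 = 0) -> (forall a, Dx a finset.set0 = 0) ->
  (forall b, Rt b finset.set0 = 0) -> (forall b, Rt b [set s] = 0) ->
  (forall b, Rt b [set t] = 0) -> (forall b, Rt b [set s; t] = z b) ->
  (forall b, Lt b finset.set0 = 0) -> (forall b, Lt b [set s] = 0) ->
  (forall b, Lt b [set t] = 0) -> (forall b, Lt b [set s; t] = z b) ->
  (forall b, Lx b finset.set0 = y b) -> (forall b, Rx b finset.set0 = y b) ->
  (\sum_(a < n) (Dp a ** Dx a - Dx a ** Dp a) +
   \sum_(b < d) (Rt b ** Lx b + Rx b ** Lt b)) [set s; t] =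
  (\sum_(a < n) (Dp a [set s] * Dx a [set t] - Dp a [set t] * Dx a [set s]) +
   \sum_(b < d) z b * y b) *+ 2.
Proof.
move=> st p0 x0 rt0 rts rtt rtz lt0 lts ltt ltz lxy rxy.
rewrite galgDE !sum_ffunE mulrnDl -!sumrMnl; congr (_ + _); apply: eq_bigr => a _.
  rewrite galgBE !(gmul_set2 _ _ st) p0 x0 !mul0r !mulr0 !add0r !addr0.
  move: (Dp a _) (Dp a _) (Dx a _) (Dx a _) => p q r w.
  by rewrite mulr2n; ring.
rewrite galgDE !(gmul_set2 _ _ st) rt0 rts rtt rtz lt0 lts ltt ltz lxy rxy.
by rewrite !mul0r !mulr0 !subr0 !add0r !addr0 mulr2n [y a * _]mulrC.
Qed.

End GenericSet2.

Section SelfBracket.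
Variables (R : realType) (n d : nat).
Local Notation L := (lfun R n d).
Local Notation xi := (lshift d).
Local Notation th := (rshift d).
Implicit Types (u v w : L) (S : {set 'I_(d + d)}).

Lemma lbracket_self_xi2 w (e f : 'I_d) : (e < f)%N -> w finset.set0 = 0 ->
  (forall b, w [set th b] = 0) -> (forall b c, w (th b |: [set xi c]) = 0) ->
  lbracket w w [set xi e; xi f] =
  (\sum_a (dp a w [set xi e] * dx a w [set xi f] - dp a w [set xi f] * dx a w [set xi e]) +
   \sum_b w (th b |: [set xi e; xi f]) * w [set xi b]) *+ 2.
Proof.
move=> ef w0 wth wthxi; have ef' : (xi e < xi f)%N by [].
have dp0 a : dp a w finset.set0 = 0 by rewrite ffunE w0 raddf0.
have dx0 a : dx a w finset.set0 = 0 by rewrite ffunE w0 msupp0 big_nil.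
have inv1 b : inversions [set xi e; xi f] [set th b] = 0%N.
  rewrite inversionsUl ?disjoints1 ?inE ?eq_oddE ?neq_ltn ?ef // !inversions11.
  by rewrite !ltnNge !(ltnW (lt_xi_theta _ _)).
have inv2 b : inversions [set th b] [set xi e; xi f] = 2.
  by rewrite inversionsUr ?disjoints1 ?inE ?eq_oddE ?neq_ltn ?ef // !inversions11 !lt_xi_theta.
apply: gmul_pairs_set2 => // b; rewrite ?dleft_set0 ?dright_set0 // ffunE !inE !eq_oddE.
- by rewrite wthxi mulr0.
- by rewrite wthxi mulr0.
- by rewrite inv1 expr0 mul1r.
- by rewrite wthxi mulr0.
- by rewrite wthxi mulr0.
- by rewrite inv2 sqrrN expr1n mul1r.
Qed.

End SelfBracket.

Section StructureEquation.
Variables (R : realType) (n d : nat).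
Local Notation K := ('rV[R]_n -> R).
Local Notation L := (lfun R n d).
Local Notation xi := (lshift d).
Local Notation th := (rshift d).
Variables (mu phi : L).
Hypotheses (hmu : ghom 1 2 mu) (hphi : ghom 0 1 phi).
Implicit Types (a : 'I_n) (b c e f : 'I_d) (m : multinom n).

Local Notation w := (mu + phi).

Lemma structure_fun_mono c e f : structure_fun mu c e f =
  if e == f then 0 else
  (-1) ^+ (f < e)%N * mcoeff mnm0 (mu (xi e |: [set xi f; th c])).
Proof.
rewrite /structure_fun ffunE !inE !eq_oddE orbF; case: eqP => [_|/eqP ef].
  by rewrite mcoeff0.
rewrite inversionsUr; last by rewrite disjoints1 inE eq_oddE.
rewrite !inversions11 /= [(d + c < e)%N]ltnNge (ltnW (ltn_addr _ _)) // addn0.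
by rewrite -scale_signE mcoeffZ.
Qed.

Lemma structure_fun_anti c e f : structure_fun mu c e f = - structure_fun mu c f e.
Proof.
rewrite !structure_fun_mono [f == e]eq_sym; case: eqP => [_|/eqP ef].
  by rewrite oppr0.
rewrite finset.setUCA; case: (ltngtP (val e) (val f)) => //= [ef'|fe|/val_inj E].
- by rewrite expr0 expr1 mulN1r mul1r opprK.
- by rewrite expr0 expr1 mulN1r mul1r.
by rewrite E eqxx in ef.
Qed.

Lemma mu_phi_set0 : w finset.set0 = 0.
Proof. by rewrite ffunE (set0_eq0 hmu) // (set0_eq0 hphi) // addr0. Qed.

Lemma mu_phi_theta b : w [set th b] = 0.
Proof.
by rewrite ffunE (ghom_set0 hmu) ?(ghom_set0 hphi) ?weightE // addr0.
Qed.

Lemma mu_phi_theta_xi b e : w (th b |: [set xi e]) = 0.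
Proof.
apply/mpolyP => m; rewrite ffunE mcoeffD mcoeff0.
by rewrite (ghom_coef0 hmu) ?(ghom_coef0 hphi) ?addr0 //
  odd_weightU1 ?inE ?eq_oddE // odd_weightU1 ?inE ?eq_oddE // !weightE; lia.
Qed.

Lemma lbracket_mu_phi m e f : (e < f)%N ->
  mcoeff m (lbracket w w [set xi e; xi f]) =
  (\sum_a (anchor mu a e * pderiv a (mcoeff m (w [set xi f])) -
           anchor mu a f * pderiv a (mcoeff m (w [set xi e]))) +
   \sum_c structure_fun mu c e f * mcoeff m (w [set xi c])) *+ 2.
Proof.
move=> ef; have nef : e != f by rewrite neq_ltn ef.
have dpE a b : dp a w [set xi b] = mpolyC n (anchor mu a b).
  have hdp : ghom 0 1 (dp a mu) by exact: ghom_dp.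
  rewrite ffunE ffunE raddfD /=; have /ffunP/(_ [set xi b]) := dp_eq0 a hphi isT.
  rewrite !ffunE => ->; rewrite addr0.
  have := ghom_mpolyC hdp (S := [set xi b]); rewrite !weightE ffunE => -> //.
  by rewrite mderiv_mu_xi.
have three b : w (th b |: [set xi e; xi f]) = mpolyC n (structure_fun mu b e f).
  have n1 : th b \notin [set xi e; xi f] by rewrite !inE !eq_oddE.
  have n2 : xi e \notin [set xi f] by rewrite !inE eq_oddE.
  have wtE : odd_weight (@rshift d d) (th b |: [set xi e; xi f]) = 1%N.
    by rewrite odd_weightU1 // odd_weightU1 // !weightE.
  have wxE : odd_weight (@lshift d d) (th b |: [set xi e; xi f]) = 2.
    by rewrite odd_weightU1 // odd_weightU1 // !weightE.
  rewrite ffunE (odd_degree_eq0 (odd_degree_phi hphi)) ?odd_weight_card ?wtE ?wxE // addr0.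
  rewrite (ghom_mpolyC hmu) ?wtE ?wxE // structure_fun_mono (negPf nef).
  by rewrite ltnNge (ltnW ef) /= expr0 mul1r finset.setUC -finset.setUA.
rewrite (lbracket_self_xi2 ef mu_phi_set0 mu_phi_theta mu_phi_theta_xi).
rewrite mcoeffMn mcoeffD !mcoeff_sum; congr ((_ + _) *+ _).
  apply: eq_bigr => a _; rewrite mcoeffB !dpE !mul_mpolyC !mcoeffZ.
  by rewrite !mcoeff_dx.
by apply: eq_bigr => b _; rewrite three mul_mpolyC mcoeffZ.
Qed.

(** These are the coefficients of [{mu + phi, mu + phi}] at two [xi], those linear
  in the momenta and those without momenta.  The first family says that the
  anchor is a morphism of Lie algebras, the second one that the cocycle is
  closed. *)
Lemma structure_equation (U : set 'rV[R]_n) y e f : eq_over U (lbracket w w) 0 -> U y ->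
  (forall k, \sum_a (anchor mu a e y * pderiv a (anchor mu k f) y -
           anchor mu a f y * pderiv a (anchor mu k e) y) +
   \sum_c structure_fun mu c e f y * anchor mu k c y = 0) /\
  \sum_a (anchor mu a e y * pderiv a (cocycle phi f) y -
           anchor mu a f y * pderiv a (cocycle phi e) y) +
   \sum_c structure_fun mu c e f y * cocycle phi c y = 0.
Proof.
move=> w0 Uy.
pose Z m b := mcoeff m (w [set xi b]).
have Zk k : Z (mnm1 k) = anchor mu k.
  apply/funext => b; rewrite /Z ffunE mcoeffD (phi_xi hphi) mcoeffC.
  by rewrite (negPf (_ : mnm1 k != mnm0)) ?mulr0 ?addr0 // mnm1_eq0.
have Z0 : Z mnm0 = cocycle phi.
  apply/funext => b; rewrite /Z ffunE mcoeffD (ghom_coef0 hmu) ?add0r //.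
  by rewrite !weightE mdeg0.
pose T m e' f' := \sum_a (anchor mu a e' y * pderiv a (Z m f') y -
           anchor mu a f' y * pderiv a (Z m e') y) +
   \sum_c structure_fun mu c e' f' y * Z m c y.
suff main m : T m e f = 0.
  by split=> [k|]; [have := main (mnm1 k)|have := main mnm0]; rewrite /T ?Zk ?Z0.
have anti e' f' : T m e' f' = - T m f' e'.
  rewrite /T opprD -!sumrN; congr (_ + _); apply: eq_bigr => k _.
    by rewrite opprB.
  by rewrite structure_fun_anti -mulNr.
have lt0 e' f' : (e' < f')%N -> T m e' f' = 0.
  move=> ef; have := (gevalP _ _ _).1 (w0 y Uy) [set xi e'; xi f'] m.
  rewrite lbracket_mu_phi // [X in _ = X -> _](_ : _ = 0); last by rewrite ffunE mcoeff0.
  rewrite mulr2n => /eqP; rewrite -[X in X == _]/((_ : K) y + (_ : K) y).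
  rewrite -mulr2n mulrn_eq0 /= => /eqP TE; rewrite /T -[RHS]TE.
  rewrite -[in RHS]/((_ : K) y + (_ : K) y) !fct_sumE; congr (_ + _).
case: (ltngtP (val e) (val f)) => [|fe|/val_inj ->]; first exact: lt0.
  by rewrite anti lt0 // oppr0.
by have := anti f f; lra.
Qed.

End StructureEquation.

(** * The action of sections on functions *)

Section ActionAlgebra.
Variables (K : comPzRingType) (n d : nat).
Implicit Types (a k : 'I_n) (b c e : 'I_d).

(** The pointwise content of the fact that the anchor is a morphism of Lie
  algebras; [z] stands for a row of the anchor or for the cocycle, and [dV],
  [dW], [dz] for the derivatives of [V], [W], [z]. *)
Lemma bracket_contraction (r : 'I_n -> 'I_d -> K) (C : 'I_d -> 'I_d -> 'I_d -> K)
    (V W z : 'I_d -> K) (dV dW dz : 'I_n -> 'I_d -> K) :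
  (forall e b, \sum_a (r a e * dz a b - r a b * dz a e) + \sum_c C c e b * z c = 0) ->
  \sum_c (\sum_b (V b * (\sum_a r a b * dW a c) - W b * (\sum_a r a b * dV a c)) -
          \sum_e \sum_b V e * W b * C c e b) * z c =
  \sum_a ((\sum_b V b * r a b) * (\sum_b (dW a b * z b + W b * dz a b)) -
          (\sum_b W b * r a b) * (\sum_b (dV a b * z b + V b * dz a b))).
Proof.
move=> Cz.
have half (V' W' : 'I_d -> K) (dW' : 'I_n -> 'I_d -> K) :
    \sum_a (\sum_b V' b * r a b) * (\sum_b (dW' a b * z b + W' b * dz a b)) =
    \sum_c (\sum_b V' b * (\sum_a r a b * dW' a c)) * z c +
    \sum_e \sum_b V' e * W' b * (\sum_a r a e * dz a b).
  under eq_bigr => a _ do rewrite big_split mulrDr.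
  rewrite big_split; congr (_ + _).
    under [RHS]eq_bigr => c _.
      under eq_bigr => b _ do rewrite mulr_sumr.
      rewrite exchange_big mulr_suml; over.
    rewrite [RHS]exchange_big; apply: eq_bigr => a _ /=.
    rewrite mulr_sumr; apply: eq_bigr => c _; rewrite mulrA; congr (_ * _).
    by rewrite mulr_suml; apply: eq_bigr => b _; rewrite mulrA.
  under [RHS]eq_bigr => e _.
    under eq_bigr => b _ do rewrite mulr_sumr.
    rewrite exchange_big; over.
  rewrite [RHS]exchange_big; apply: eq_bigr => a _ /=.
  rewrite mulr_suml; apply: eq_bigr => e _; rewrite mulr_sumr; apply: eq_bigr => b _.
  by rewrite mulrACA.
rewrite [RHS]sumrB !half.
have CE : \sum_c (\sum_e \sum_b V e * W b * C c e b) * z c =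
    \sum_e \sum_b V e * W b * (\sum_a r a b * dz a e) -
    \sum_e \sum_b V e * W b * (\sum_a r a e * dz a b).
  under eq_bigr => c _ do rewrite mulr_suml.
  rewrite exchange_big -sumrB; apply: eq_bigr => e _ /=.
  under eq_bigr => c _ do rewrite mulr_suml.
  rewrite exchange_big -sumrB; apply: eq_bigr => b _ /=.
  rewrite -mulrBr -sumrB; under eq_bigr => c _ do rewrite -mulrA.
  rewrite -mulr_sumr; congr (_ * _).
  have /eqP := Cz e b; rewrite addrC addr_eq0 -sumrN => /eqP ->.
  by apply: eq_bigr => a _; rewrite opprB.
under eq_bigr => c _ do rewrite sumrB !mulrBl.
rewrite !sumrB CE [X in _ = _ - (_ + X)]exchange_big /=.
have -> : \sum_b \sum_e W e * V b * (\sum_a r a e * dz a b) =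
    \sum_e \sum_b V e * W b * (\sum_a r a b * dz a e).
  by apply: eq_bigr => e _; apply: eq_bigr => b _; rewrite [W b * _]mulrC.
by ring.
Qed.

(** The commutator of the first order operators [v + vq] and [w + wq], evaluated at
  a point where the function has value [g0], gradient [G] and Hessian [H]: the
  terms in the Hessian cancel because it is symmetric. *)
Lemma commutator_contraction (G v w : 'I_n -> K) (H dv dw : 'I_n -> 'I_n -> K)
    (g0 vq wq : K) (dvq dwq : 'I_n -> K) :
  (forall a k, H a k = H k a) ->
  (\sum_a v a * (\sum_k (dw a k * G k + w k * H a k) + (dwq a * g0 + wq * G a)) +
   vq * (\sum_k w k * G k + wq * g0)) -
  (\sum_a w a * (\sum_k (dv a k * G k + v k * H a k) + (dvq a * g0 + vq * G a)) +
   wq * (\sum_k v k * G k + vq * g0)) =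
  \sum_k (\sum_a (v a * dw a k - w a * dv a k)) * G k +
  (\sum_a (v a * dwq a - w a * dvq a)) * g0.
Proof.
move=> Hs.
have half (v' w' : 'I_n -> K) (dw' : 'I_n -> 'I_n -> K) (wq' vq' : K) (dwq' : 'I_n -> K) :
  \sum_a v' a * (\sum_k (dw' a k * G k + w' k * H a k) + (dwq' a * g0 + wq' * G a)) +
   vq' * (\sum_k w' k * G k + wq' * g0) =
  \sum_k (\sum_a v' a * dw' a k) * G k + \sum_a \sum_k v' a * w' k * H a k +
  (\sum_a v' a * dwq' a) * g0 + (wq' * (\sum_k v' k * G k) + vq' * (\sum_k w' k * G k))
  + vq' * wq' * g0.
  rewrite mulrDr mulrA !addrA; congr (_ + _ + _).
  under eq_bigr => a _ do rewrite big_split !mulrDr.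
  rewrite !big_split /= -!addrA; congr (_ + _).
    under [RHS]eq_bigr => k _ do rewrite mulr_suml.
    rewrite [RHS]exchange_big; apply: eq_bigr => a _; rewrite mulr_sumr.
    by apply: eq_bigr => k _; rewrite mulrA.
  congr (_ + (_ + _)).
  - by apply: eq_bigr => a _; rewrite mulr_sumr; apply: eq_bigr => k _; rewrite mulrA.
  - by rewrite mulr_suml; apply: eq_bigr => a _; rewrite mulrA.
  by rewrite mulr_sumr; apply: eq_bigr => a _; rewrite mulrCA.
rewrite !half.
have -> : \sum_a \sum_k w a * v k * H a k = \sum_a \sum_k v a * w k * H a k.
  rewrite exchange_big; apply: eq_bigr => a _; apply: eq_bigr => k _ /=.
  by rewrite Hs [w k * _]mulrC.
rewrite sumrB mulrBl; under [X in _ = X + _]eq_bigr => k _ do rewrite sumrB mulrBl.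
rewrite sumrB.
by ring.
Qed.

End ActionAlgebra.

Section Action.
Variables (R : realType) (n d : nat).
Local Notation K := ('rV[R]_n -> R).
Variables (U : set 'rV[R]_n) (mu phi : lfun R n d).
Hypotheses (oU : open U) (s_anchor : forall a b, smooth_on U (anchor mu a b))
  (s_cocycle : forall b, smooth_on U (cocycle phi b)).
Implicit Types (V W : 'I_d -> K) (g : K).

Lemma actE V g y : act mu phi V g y =
  \sum_k (\sum_b V b y * anchor mu k b y) * pderiv k g y +
  (\sum_b V b y * cocycle phi b y) * g y.
Proof.
rewrite /act fct_sumE.
transitivity (\sum_b (\sum_k V b y * anchor mu k b y * pderiv k g y +
    V b y * cocycle phi b y * g y)).
  apply: eq_bigr => b _; rewrite -[LHS]/(V b y * ((\sum_a anchor mu a b * pderiv a g) y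
    + cocycle phi b y * g y)) fct_sumE mulrDr mulrA; congr (_ + _).
  by rewrite mulr_sumr; apply: eq_bigr => k _; rewrite mulrA.
rewrite big_split exchange_big /= -mulr_suml; congr (_ + _).
by apply: eq_bigr => k _; rewrite mulr_suml.
Qed.

Lemma act_funE V g : act mu phi V g =
  \sum_k (\sum_b V b * anchor mu k b) * pderiv k g + (\sum_b V b * cocycle phi b) * g.
Proof.
apply/funext => y; rewrite actE.
rewrite -[RHS]/((\sum_k (\sum_b V b * anchor mu k b) * pderiv k g) y +
  ((\sum_b V b * cocycle phi b) y) * g y) !fct_sumE; congr (_ + _).
by apply: eq_bigr => k _; rewrite -[RHS]/(((\sum_b V b * anchor mu k b) y) * pderiv k g y)
  fct_sumE.
Qed.

Lemma smooth_on_pairing V (z : 'I_d -> K) : (forall b, smooth_on U (V b)) ->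
  (forall b, smooth_on U (z b)) -> smooth_on U (\sum_b V b * z b).
Proof. by move=> sV sz; apply: smooth_on_sum => // b _; exact: smooth_onM. Qed.

Lemma pderiv_pairing V (z : 'I_d -> K) a y : U y -> (forall b, smooth_on U (V b)) ->
  (forall b, smooth_on U (z b)) ->
  pderiv a (\sum_b V b * z b) y =
  \sum_b (pderiv a (V b) y * z b y + V b y * pderiv a (z b) y).
Proof.
move=> Uy sV sz; have dV b := smooth_on_diff (sV b) Uy.
have dz b := smooth_on_diff (sz b) Uy.
rewrite pderiv_sum => [|b]; last exact: differentiableM (dV b) (dz b).
by apply: eq_bigr => b _; rewrite (pderivM a (dV b) (dz b)).
Qed.

Lemma pderiv_act W g a y : U y -> (forall b, smooth_on U (W b)) -> smooth_on U g ->
  pderiv a (act mu phi W g) y =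
  \sum_k (pderiv a (\sum_b W b * anchor mu k b) y * pderiv k g y +
    (\sum_b W b y * anchor mu k b y) * pderiv a (pderiv k g) y) +
  (pderiv a (\sum_b W b * cocycle phi b) y * g y +
   (\sum_b W b y * cocycle phi b y) * pderiv a g y).
Proof.
move=> Uy sW sg; rewrite act_funE.
have dv k : differentiable (\sum_b W b * anchor mu k b) y.
  exact: smooth_on_diff (smooth_on_pairing sW (s_anchor k)) Uy.
have dq : differentiable (\sum_b W b * cocycle phi b) y.
  exact: smooth_on_diff (smooth_on_pairing sW s_cocycle) Uy.
have dg := smooth_on_diff sg Uy.
have dpg k : differentiable (pderiv k g) y := sg [:: k] y Uy.
have dm k := differentiableM (dv k) (dpg k).
rewrite pderivD; first last.
- exact: differentiableM dq dg.
- exact: differentiable_sum.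
rewrite pderiv_sum //; congr (_ + _).
  by apply: eq_bigr => k _; rewrite (pderivM a (dv k) (dpg k)) fct_sumE.
by rewrite (pderivM a dq dg) fct_sumE.
Qed.

(** Functions form a representation of the Lie algebra of sections: by
  [commutator_contraction] this amounts to the structure equation. *)
Lemma act_bracket V W (T : 'I_d -> K) g y : ghom 1 2 mu -> ghom 0 1 phi ->
  eq_over U (lbracket (mu + phi) (mu + phi)) 0 -> U y ->
  (forall b, smooth_on U (V b)) -> (forall b, smooth_on U (W b)) -> smooth_on U g ->
  (forall c, T c y =
    (\sum_b (V b * (\sum_a anchor mu a b * pderiv a (W c)) -
            W b * (\sum_a anchor mu a b * pderiv a (V c))) -
    \sum_e \sum_b V e * W b * structure_fun mu c e b) y) ->
  act mu phi T g y =
  act mu phi V (act mu phi W g) y - act mu phi W (act mu phi V g) y.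
Proof.
move=> hmu hphi w0 Uy sV sW sg TE; rewrite !actE.
under [X in _ = (X + _) - _]eq_bigr => a _ do rewrite (pderiv_act a Uy sW sg).
under [X in _ = _ - (X + _)]eq_bigr => a _ do rewrite (pderiv_act a Uy sV sg).
rewrite (@commutator_contraction R n _ _ _ (fun a k => pderiv a (pderiv k g) y)); last first.
  by move=> a k; exact: pderivC sg Uy.
have TyE c : T c y = \sum_b (V b y * (\sum_a anchor mu a b y * pderiv a (W c) y) -
            W b y * (\sum_a anchor mu a b y * pderiv a (V c) y)) -
    \sum_e \sum_b V e y * W b y * structure_fun mu c e b y.
  rewrite TE -[LHS]/((_ : K) y - (_ : K) y) !fct_sumE; congr (_ - _).
    apply: eq_bigr => b _.
    rewrite -[LHS]/(V b y * (\sum_a _) y - W b y * (\sum_a _) y).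
    by rewrite !fct_sumE.
  by apply: eq_bigr => e _; rewrite fct_sumE.
have row (z : 'I_d -> K) : (forall b, smooth_on U (z b)) ->
    (forall e f, \sum_a (anchor mu a e y * pderiv a (z f) y -
           anchor mu a f y * pderiv a (z e) y) +
       \sum_c structure_fun mu c e f y * z c y = 0) ->
    \sum_b T b y * z b y =
    \sum_a ((\sum_b V b y * anchor mu a b y) * pderiv a (\sum_b W b * z b) y -
            (\sum_b W b y * anchor mu a b y) * pderiv a (\sum_b V b * z b) y).
  move=> sz zE; under [RHS]eq_bigr => a _ do
    rewrite (pderiv_pairing a Uy sW sz) (pderiv_pairing a Uy sV sz).
  by under [LHS]eq_bigr => c _ do rewrite TyE; apply: bracket_contraction.
congr (_ + _ * _).
  apply: eq_bigr => k _; congr (_ * _); apply: row => // e f.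
  by have [] := structure_equation hmu hphi e f w0 Uy.
by apply: row => // e f; have [] := structure_equation hmu hphi e f w0 Uy.
Qed.

End Action.

(** * Local consequences of the bialgebroid axioms *)

Section LocalDifferential.
Variables (R : realType) (n d : nat).
Local Notation K := ('rV[R]_n -> R).
Local Notation L := (lfun R n d).
Local Notation xi := (lshift d).
Local Notation th := (rshift d).
Implicit Types (u v P Q : L) (f g : K) (a : 'I_n) (b c : 'I_d).

Definition local_diff (nu X P : L) : L := lbracket nu P + X ** P.

Definition dual_anchor (nu : L) a b : K := mcoeff (mnm1 a) (nu [set th b]).

(** The components of the differential of a function. *)
Definition diff_coef (nu X : L) g b : K :=
  \sum_a dual_anchor nu a b * pderiv a g + scoef X b * g.

Lemma gconst0 : gconst n d (0 : K) = 0.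
Proof.
by apply/ffunP => S; rewrite !ffunE mpolyC0 if_same.
Qed.

Lemma lbracket0r u : lbracket u 0 = 0.
Proof.
apply/ffunP => S; rewrite -[in LHS]gconst0 lbracket_gconstr [RHS]ffunE big1 // => a _.
rewrite (_ : pderiv a (0 : K) = 0) ?scale0r //.
by apply/funext => y; exact: pderiv_cst.
Qed.

Lemma lbracket0l u : lbracket 0 u = 0.
Proof.
apply/ffunP => S; rewrite -[in LHS]gconst0 lbracket_gconstl [RHS]ffunE big1 ?oppr0 // => a _.
rewrite (_ : pderiv a (0 : K) = 0) ?scale0r //.
by apply/funext => y; exact: pderiv_cst.
Qed.

Lemma mderiv_nu_theta (nu : L) a b :
  mcoeff mnm0 (mderiv a (nu [set th b])) = dual_anchor nu a b.
Proof.
rewrite mcoeff_mderiv mnm0E mulr1n /dual_anchor; congr (mcoeff _ _).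
by apply/mnmP => k; rewrite mnmDE mnm0E.
Qed.

Lemma scoef_lbracket_fun (nu : L) g b :
  scoef (lbracket nu (gconst n d g)) b = \sum_a dual_anchor nu a b * pderiv a g.
Proof.
rewrite /scoef lbracket_gconstr mcoeff_sum; apply: eq_bigr => a _.
by rewrite mcoeffZ mderiv_nu_theta mulrC.
Qed.

Section Diff.
Variables (nu X : L).
Hypotheses (hnu : ghom 2 1 nu) (hX : ghom 1 0 X).

Lemma ghom_local_diff g : ghom 1 0 (local_diff nu X (gconst n d g)).
Proof.
apply: ghomD; first by apply: ghom_lbracket hnu (@ghom_gconst _ _ _ g).
by rewrite gconst_mulr; exact: ghomZ.
Qed.

Lemma scoef_local_diff g : scoef (local_diff nu X (gconst n d g)) = diff_coef nu X g.
Proof.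
apply/funext => b; rewrite scoefD scoef_lbracket_fun gconst_mulr scoefZ.
by rewrite /diff_coef [g * _]mulrC.
Qed.

End Diff.

Lemma eq_over_local_diff U nu nu' X X' P P' : open U ->
  eq_over U nu nu' -> eq_over U X X' -> eq_over U P P' ->
  eq_over U (local_diff nu X P) (local_diff nu' X' P').
Proof.
move=> oU en eX eP.
exact: (eq_overD (eq_over_lbracket oU en eP) (eq_over_gmul eX eP)).
Qed.

Lemma eq_over_local_jacobi_bracket U mu mu' phi phi' P P' Q Q' : open U ->
  eq_over U mu mu' -> eq_over U phi phi' -> eq_over U P P' -> eq_over U Q Q' ->
  eq_over U (local_jacobi_bracket mu phi P Q) (local_jacobi_bracket mu' phi' P' Q').
Proof.
move=> oU em ep eP eQ.
have em' := eq_overD em (eq_over_gmul (@eq_over_refl _ _ _ U (local_id R n d)) ep).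
have e1 := eq_over_lbracket oU (eq_over_lbracket oU eP em') eQ.
have e2 := eq_over_gmul eP (eq_over_lbracket oU ep eQ).
have e3 := eq_over_gmul (eq_over_lbracket oU eP ep) eQ.
exact: (eq_overD (eq_overB e1 e2) e3).
Qed.

Lemma jacobi_bracket_funs mu phi f g : ghom 1 2 mu -> ghom 0 1 phi ->
  local_jacobi_bracket mu phi (gconst n d f) (gconst n d g) = 0.
Proof.
move=> hmu hphi; rewrite /local_jacobi_bracket (lbracket_phi_fun hphi).
rewrite (lbracket_fun_phi hphi) gmul0l gmul0r subr0 addr0.
have hu : ghom 0 1 (lbracket (gconst n d f) (mu + local_id R n d ** phi)).
  by apply: ghom_lbracket (@ghom_gconst _ _ _ f) (ghom_mu' hmu hphi).
apply/ffunP => S; rewrite lbracket_gconstr [RHS]ffunE big1 // => a _.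
have /ffunP/(_ S) := dp_eq0 a hu isT; rewrite ffunE [RHS]ffunE => ->.
by rewrite scaler0.
Qed.

Lemma jacobi_bracket0l mu phi Q : local_jacobi_bracket mu phi 0 Q = 0.
Proof.
by rewrite /local_jacobi_bracket !lbracket0l !gmul0l subr0 addr0.
Qed.

End LocalDifferential.

Section BialgebroidLocal.
Variables (R : realType) (n : nat) (M : manifold R n) (d : nat) (A : vbundle M d).
Variables (mu phi nu X : lfamily A).
Hypothesis bialg : jacobi_bialgebroid mu phi nu X.
Local Notation K := ('rV[R]_n -> R).

Let hmu : bihom 1 2 mu. Proof. by have [[[]]] := bialg. Qed.
Let hphi : bihom 0 1 phi. Proof. by have [[[]]] := bialg. Qed.
Let hnu : bihom 2 1 nu. Proof. by have [_ []] := bialg. Qed.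
Let hX : bihom 1 0 X. Proof. by have [_ []] := bialg. Qed.

Lemma ghom_cutoff_family k l (F : lfamily A) (i : chart_index M) :
  bihom k l F -> ghom k l (cutoff (chart_img i) (F i)).
Proof. by move=> [_ _ hF]; apply: ghom_cutoff => y S m; exact: hF. Qed.

Lemma bihom0 k l : bihom k l (0 : lfamily A).
Proof.
split.
- by move=> i S m; rewrite ffunE mcoeff0; exact: smooth_on_cst.
- move=> i j x xi xj; rewrite !raddf0 gsubstE big1 // => S _.
  by rewrite ffunE gsubst_part0.
by move=> i y S m _; rewrite ffunE mcoeff0 eqxx.
Qed.

Lemma multisection_bihom k (F : lfamily A) : bihom k 0 F -> multisection F.
Proof.
move=> hF; exists k.+1, (fun j => if j == k then F else 0); split.
  by move=> j; case: eqP => [->//|_]; exact: bihom0.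
rewrite (bigD1 ord_max) //= eqxx big1 ?addr0 // => j jk.
by rewrite ifN.
Qed.

Definition diff_fun (f : M -> R) : lfamily A := jacobi_diff nu X (of_fun A f).

Lemma diff_fun_cutoff f i : eq_over (chart_img i) (diff_fun f i)
  (local_diff (cutoff (chart_img i) (nu i)) (cutoff (chart_img i) (X i))
    (gconst n d (f \o chart_inv i))).
Proof.
apply: eq_over_local_diff => //; first exact: chart_img_open.
  by apply: eq_over_sym; exact: eq_over_cutoff.
by apply: eq_over_sym; exact: eq_over_cutoff.
Qed.

Definition gradient (f : K) (y : 'rV[R]_n) : 'rV[R]_n := \row_a pderiv a f y.

Lemma gradient_trans (f : M -> R) i j x : smooth f -> chart_dom i x -> chart_dom j x ->
  gradient (f \o chart_inv j) (chart j x) =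
  gradient (f \o chart_inv i) (chart i x) *m (Defs.jacobian j i x)^T.
Proof.
move=> sf xi xj; apply/rowP => a; rewrite !mxE.
have nj : \forall z \near chart j x,
    (chart j @` (chart_dom i `&` chart_dom j))%classic z.
  by apply: open_nbhs_nbhs; split; [exact: open_chart_overlap|exists x].
rewrite (@near_eq_pderiv _ _ _ _
    ((f \o chart_inv i) \o (fun y => chart i (chart_inv j y)))); last first.
  by apply: filterS nj => _ [z [zi zj] <-] /=; rewrite !chartK.
rewrite pderiv_comp.
- by apply: eq_bigr => b _; rewrite !mxE chartK // mulrC.
- move=> b; apply: (@chart_smooth _ _ M j i b [::]); by exists x.
by rewrite chartK //; apply: (sf i [::]); exists x.
Qed.

Lemma vector_coef_diff_fun f i y : vector_coef (diff_fun f i) y =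
  gradient (f \o chart_inv i) y *m theta_symbol (nu i) y +
  f (chart_inv i y) *: vector_coef (X i) y.
Proof.
apply/rowP => b; rewrite !mxE.
have := scoef_local_diff (nu i) (X i) (f \o chart_inv i).
move=> /(congr1 (fun F => F b y)); rewrite /scoef => ->.
rewrite /diff_coef -[LHS]/((_ : K) y + (scoef (X i) b y * (f \o chart_inv i) y)).
rewrite fct_sumE [in RHS]mulrC; congr (_ + _); apply: eq_bigr => a _.
by rewrite !mxE mulrC.
Qed.

Lemma bihom_diff_fun f : smooth f -> bihom 1 0 (diff_fun f).
Proof.
move=> sf; have gh i y : chart_img i y -> ghom 1 0 (geval y (diff_fun f i)).
  move=> yi S m; rewrite (diff_fun_cutoff f yi) /has_coef mcoeff_geval => nz.
  have hl := ghom_local_diff (ghom_cutoff_family (i := i) hnu) (ghom_cutoff_family (i := i) hX)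
    (g := f \o chart_inv i).
  by apply: (hl S m); apply: contra nz => /eqP h0; rewrite h0.
split.
- move=> i S m; have oU := @chart_img_open _ _ M i.
  have [snu _ _] := hnu; have [sX _ _] := hX.
  rewrite /diff_fun /jacobi_diff -[X in mcoeff _ X]/((lbracket (nu i) (gconst n d (f \o chart_inv i)) +
    X i ** gconst n d (f \o chart_inv i)) S).
  rewrite galgDE mcoeffD gconst_mulr lbracket_gconstr ffunE mcoeffZ mcoeff_sum.
  apply: smooth_onD => //; last by apply: smooth_onM => //; exact: sf.
  apply: smooth_on_sum => // a _; rewrite mcoeffZ mcoeff_mderiv.
  apply: smooth_onM => //; first by apply: smooth_on_pderiv; exact: sf.
  by apply: smooth_onMn => //; exact: snu.
- apply/compatible_vectorP => // i j x xi xj.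
  have Ei := vector_coef_diff_fun f i (chart i x).
  have Ej := vector_coef_diff_fun f j (chart j x).
  rewrite (chartK xi) in Ei; rewrite (chartK xj) in Ej.
  apply: (etrans Ei); apply/esym/(etrans (congr1 (fun r => r *m _) Ej))/esym.
  rewrite mulmxDl -scalemxAl.
  have [_ cX _] := hX.
  have := (compatible_vectorP (fun i y yi => ghom_bihom hX yi)).1 cX i j x xi xj.
  move=> ->; congr (_ + _).
  rewrite (theta_symbol_trans hnu xi xj) (gradient_trans sf xi xj).
  by rewrite !mulmxA.
by move=> i y S m yi; rewrite -mcoeff_geval => /(gh i y yi).
Qed.

End BialgebroidLocal.

Section FunctionBracket.
Variables (R : realType) (n : nat) (M : manifold R n) (d : nat) (A : vbundle M d).
Variables (mu phi nu X : lfamily A).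
Hypothesis bialg : jacobi_bialgebroid mu phi nu X.
Variable i : chart_index M.
Local Notation K := ('rV[R]_n -> R).
Local Notation U := (chart_img i).
Local Notation m := (cutoff (chart_img i) (mu i)).
Local Notation p := (cutoff (chart_img i) (phi i)).
Local Notation nn := (cutoff (chart_img i) (nu i)).
Local Notation xx := (cutoff (chart_img i) (X i)).

Let hmu : bihom 1 2 mu. Proof. by have [[[]]] := bialg. Qed.
Let hphi : bihom 0 1 phi. Proof. by have [[[]]] := bialg. Qed.
Let hnu : bihom 2 1 nu. Proof. by have [_ []] := bialg. Qed.
Let hX : bihom 1 0 X. Proof. by have [_ []] := bialg. Qed.
Let oU : open U. Proof. exact: chart_img_open. Qed.

Let hm : ghom 1 2 m. Proof. exact: ghom_cutoff_family. Qed.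
Let hp : ghom 0 1 p. Proof. exact: ghom_cutoff_family. Qed.
Let hn : ghom 2 1 nn. Proof. exact: ghom_cutoff_family. Qed.
Let hx : ghom 1 0 xx. Proof. exact: ghom_cutoff_family. Qed.

Lemma smooth_on_cutoff k l (F : lfamily A) S q : bihom k l F ->
  smooth_on U (mcoeff q (cutoff U (F i) S)).
Proof.
move=> [sF _ _]; apply: (eq_smooth_on (f := mcoeff q (F i S))) => // y Uy.
by rewrite mcoeff_cutoff.
Qed.

Lemma smooth_on_anchor a b : smooth_on U (anchor m a b).
Proof. exact: smooth_on_cutoff hmu. Qed.
Lemma smooth_on_cocycle b : smooth_on U (cocycle p b).
Proof. exact: smooth_on_cutoff hphi. Qed.
Lemma smooth_on_dual_anchor a b : smooth_on U (dual_anchor nn a b).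
Proof. exact: smooth_on_cutoff hnu. Qed.
Lemma smooth_on_scoef b : smooth_on U (scoef xx b).
Proof. exact: smooth_on_cutoff hX. Qed.

Lemma smooth_on_diff_coef f b : smooth_on U f -> smooth_on U (diff_coef nn xx f b).
Proof.
move=> sf; apply: smooth_onD => //; last first.
  by apply: smooth_onM => //; exact: smooth_on_scoef.
apply: smooth_on_sum => // a _; apply: smooth_onM => //.
  exact: smooth_on_dual_anchor.
exact: smooth_on_pderiv.
Qed.

(** The bracket [df, g], which turns out to be a Lie bracket on functions. *)
Definition fun_bracket (f g : K) : K := act m p (diff_coef nn xx f) g.

Lemma jacobi_bracket_cutoff (P Q : lfamily A) P' Q' :
  eq_over U (P i) P' -> eq_over U (Q i) Q' ->
  eq_over U (jacobi_bracket mu phi P Q i) (local_jacobi_bracket m p P' Q').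
Proof.
move=> eP eQ.
exact: (eq_over_local_jacobi_bracket oU (eq_over_sym (@eq_over_cutoff _ _ _ U (mu i)))
  (eq_over_sym (@eq_over_cutoff _ _ _ U (phi i))) eP eQ).
Qed.

Lemma jacobi_diff_cutoff (P : lfamily A) P' : eq_over U (P i) P' ->
  eq_over U (jacobi_diff nu X P i) (local_diff nn xx P').
Proof.
move=> eP.
exact: (eq_over_local_diff oU (eq_over_sym (@eq_over_cutoff _ _ _ U (nu i)))
  (eq_over_sym (@eq_over_cutoff _ _ _ U (X i))) eP).
Qed.

Let df (f : M -> R) := local_diff nn xx (gconst n d (f \o chart_inv i)).
Let hdf f : ghom 1 0 (df f). Proof. exact: ghom_local_diff hn hx _. Qed.
Let dfE f : scoef (df f) = diff_coef nn xx (f \o chart_inv i).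
Proof. exact: scoef_local_diff. Qed.

Let jacobi_bracket_df_fun f g : local_jacobi_bracket m p (df f) (gconst n d g) =
  gconst n d (fun_bracket (f \o chart_inv i) g).
Proof. by rewrite (jacobi_bracket_vector_fun hm hp _ (@hdf f)) dfE. Qed.

Let jacobi_bracket_fun_df f g : local_jacobi_bracket m p (gconst n d f) (df g) =
  gconst n d (- fun_bracket (g \o chart_inv i) f).
Proof. by rewrite (jacobi_bracket_fun_vector hm hp _ (@hdf g)) dfE. Qed.

Lemma eq_over_fun_diff (f : M -> R) :
  eq_over U (jacobi_diff nu X (of_fun A f) i) (df f).
Proof. exact: jacobi_diff_cutoff. Qed.

(** As [f, g] = 0, the compatibility of the differential with the bracket reads
  [0 = [df, g] - [f, dg]], where [- [f, dg] = [dg, f]]. *)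
Lemma fun_bracket_anti_global (f g : M -> R) y : smooth f -> smooth g -> U y ->
  fun_bracket (f \o chart_inv i) (g \o chart_inv i) y +
  fun_bracket (g \o chart_inv i) (f \o chart_inv i) y = 0.
Proof.
move=> sf sg Uy; have [_ _ _ ax] := bialg.
have := ax _ _ _ (bihom_of_fun A sf) (multisection_bihom (bihom_of_fun A sg)).
move=> /(_ i y Uy); rewrite expr1 mulrN1z.
have lhs0 : geval y (jacobi_diff nu X (jacobi_bracket mu phi (of_fun A f) (of_fun A g)) i) = 0.
  rewrite (jacobi_diff_cutoff (jacobi_bracket_cutoff (@eq_over_refl _ _ _ U _)
    (@eq_over_refl _ _ _ U _))) //.
  rewrite -[of_fun A f i]/(gconst n d (f \o chart_inv i)).
  rewrite -[of_fun A g i]/(gconst n d (g \o chart_inv i)).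
  by rewrite jacobi_bracket_funs // /local_diff lbracket0r gmul0r addr0 raddf0.
have e1 := jacobi_bracket_cutoff (eq_over_fun_diff f) (@eq_over_refl _ _ _ U (of_fun A g i)).
have e2 := jacobi_bracket_cutoff (@eq_over_refl _ _ _ U (of_fun A f i)) (eq_over_fun_diff g).
move=> key; have := etrans (esym (eq_overB e1 e2 Uy)) (etrans (esym key) lhs0).
rewrite (congr2 (fun u v => u - v) (jacobi_bracket_df_fun f (g \o chart_inv i))
  (jacobi_bracket_fun_df (f \o chart_inv i) g)).
move=> /(congr1 (fun u : galg R n d => mcoeff mnm0 (u finset.set0))) /=.
rewrite mcoeff_geval galgBE !ffunE eqxx mcoeffB !mcoeffC eqxx !mulr1.
by rewrite opprK.
Qed.

(** As [ddf = 0], the compatibility of the differential with the bracket of [df] and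
  [g] reads [d [df, g] = [df, dg]]; the action on functions of the right-hand side
  is a commutator. *)
Lemma fun_bracket_jacobi_global (f g : M -> R) h y : smooth f -> smooth g ->
  smooth_on U h -> U y ->
  fun_bracket (fun_bracket (f \o chart_inv i) (g \o chart_inv i)) h y =
  fun_bracket (f \o chart_inv i) (fun_bracket (g \o chart_inv i) h) y -
  fun_bracket (g \o chart_inv i) (fun_bracket (f \o chart_inv i) h) y.
Proof.
move=> sf sg sh Uy; have [[_ alg] _ dd ax] := bialg.
have w0 : eq_over U (lbracket (m + p) (m + p)) 0.
  have e := eq_overD (@eq_over_cutoff _ _ _ U (mu i)) (@eq_over_cutoff _ _ _ U (phi i)).
  by move=> z Uz; rewrite (eq_over_lbracket oU e e Uz); exact: alg.
have sdf k b : smooth k -> smooth_on U (diff_coef nn xx (k \o chart_inv i) b).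
  by move=> sk; apply: smooth_on_diff_coef; exact: sk.
apply: (act_bracket oU smooth_on_anchor smooth_on_cocycle hm hp w0 Uy) => //.
- by move=> b; exact: sdf.
- by move=> b; exact: sdf.
move=> c.
have [hT TE] := jacobi_bracket_vectors hm hp (@hdf f) (@hdf g).
rewrite -!dfE -TE.
have := ax _ _ _ (bihom_diff_fun bialg sf) (multisection_bihom (bihom_of_fun A sg)).
move=> /(_ i y Uy); rewrite sqrrN expr1n mulr1z.
have e1 : eq_over U (jacobi_bracket mu phi (diff_fun nu X f) (of_fun A g) i)
    (gconst n d (fun_bracket (f \o chart_inv i) (g \o chart_inv i))).
  have := jacobi_bracket_cutoff (eq_over_fun_diff f) (@eq_over_refl _ _ _ U (of_fun A g i)).
  by rewrite jacobi_bracket_df_fun.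
have e2 : eq_over U (jacobi_bracket mu phi (jacobi_diff nu X (diff_fun nu X f)) (of_fun A g) i) 0.
  rewrite -(jacobi_bracket0l m p (of_fun A g i)).
  apply: jacobi_bracket_cutoff => // z Uz.
  exact: dd (multisection_bihom (bihom_of_fun A sf)) i z Uz.
have e3 := jacobi_bracket_cutoff (eq_over_fun_diff f) (eq_over_fun_diff g).
move=> key; have := etrans (esym (jacobi_diff_cutoff e1 Uy))
  (etrans key (eq_overD e2 e3 Uy)); rewrite add0r => H.
have S := congr1 (fun F => F c y)
  (scoef_local_diff nn xx (fun_bracket (f \o chart_inv i) (g \o chart_inv i))).
exact (etrans (esym S) (eq_geval_scoef c H)).
Qed.

Lemma near_fun_bracket f f' g g' (y : 'rV[R]_n) : (\forall z \near y, f z = f' z) ->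
  (\forall z \near y, g z = g' z) ->
  \forall z \near y, fun_bracket f g z = fun_bracket f' g' z.
Proof.
move=> /nbhs_interior ff /nbhs_interior gg; move: ff gg; apply: filterS2 => z ffz ggz.
have fz := nbhs_singleton ffz; have gz := nbhs_singleton ggz.
rewrite /fun_bracket !actE gz.
have dE b : diff_coef nn xx f b z = diff_coef nn xx f' b z.
  rewrite /diff_coef -[LHS]/((_ : K) z + _ * f z) -[RHS]/((_ : K) z + _ * f' z) fz.
  congr (_ + _); rewrite !fct_sumE; apply: eq_bigr => a _.
  by rewrite -[LHS]/(_ * pderiv a f z) (near_eq_pderiv a ffz).
congr (_ + _ * _); last by apply: eq_bigr => b _; rewrite dE.
apply: eq_bigr => k _; rewrite (near_eq_pderiv k ggz); congr (_ * _).
by apply: eq_bigr => b _; rewrite dE.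
Qed.

(** Since every germ of a smooth function extends to the manifold, the identities
  hold for the functions of the coordinate domain. *)
Lemma fun_bracket_anti f g y : smooth_on U f -> smooth_on U g -> U y ->
  fun_bracket f g y + fun_bracket g f y = 0.
Proof.
move=> sf sg Uy.
have [F sF FE] := smooth_extension Uy sf; have [G sG GE] := smooth_extension Uy sg.
have <- := fun_bracket_anti_global sF sG Uy.
rewrite (nbhs_singleton (near_fun_bracket FE GE)).
by rewrite (nbhs_singleton (near_fun_bracket GE FE)).
Qed.

Lemma fun_bracket_jacobi f g h y : smooth_on U f -> smooth_on U g -> smooth_on U h -> U y ->
  fun_bracket (fun_bracket f g) h y =
  fun_bracket f (fun_bracket g h) y - fun_bracket g (fun_bracket f h) y.
Proof.
move=> sf sg sh Uy.
have [F sF FE] := smooth_extension Uy sf; have [G sG GE] := smooth_extension Uy sg.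
have hh : \forall z \near y, h z = h z by near=> z.
have := fun_bracket_jacobi_global sF sG sh Uy.
rewrite (nbhs_singleton (near_fun_bracket (near_fun_bracket FE GE) hh)).
rewrite (nbhs_singleton (near_fun_bracket FE (near_fun_bracket GE hh))).
by rewrite (nbhs_singleton (near_fun_bracket GE (near_fun_bracket FE hh))).
Unshelve. all: by end_near. Qed.

End FunctionBracket.

(** * The bivector and the vector field on the base *)

Section BaseStructure.
Variables (R : realType) (n : nat) (M : manifold R n) (d : nat) (A : vbundle M d).
Variables (mu phi nu X : lfamily A).
Hypothesis bialg : jacobi_bialgebroid mu phi nu X.
Variable i : chart_index M.
Local Notation K := ('rV[R]_n -> R).
Local Notation U := (chart_img i).
Local Notation m := (cutoff (chart_img i) (mu i)).
Local Notation p := (cutoff (chart_img i) (phi i)).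
Local Notation nn := (cutoff (chart_img i) (nu i)).
Local Notation xx := (cutoff (chart_img i) (X i)).
Local Notation "{< f , g >}" := (fun_bracket mu phi nu X i f g).
Implicit Types (f g h : K) (a k l : 'I_n) (y : 'rV[R]_n).

Let oU : open U. Proof. exact: chart_img_open. Qed.

(** The transpose of the anchor of the dual algebroid followed by the anchor, and
  the image of [X] by the anchor. *)
Definition base_pi a k : K := \sum_b anchor m a b * dual_anchor nn k b.
Definition base_E k : K := \sum_b scoef xx b * anchor m k b.

Lemma smooth_on_base_pi a k : smooth_on U (base_pi a k).
Proof.
apply: smooth_on_sum => [|b _]; first exact: oU.
apply: smooth_onM.
- exact: oU.
- exact (smooth_on_anchor bialg a b).
- exact (smooth_on_dual_anchor bialg k b).
Qed.

Lemma smooth_on_base_E k : smooth_on U (base_E k).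
Proof.
apply: smooth_on_sum => [|b _]; first exact: oU.
apply: smooth_onM.
- exact: oU.
- exact (smooth_on_scoef bialg b).
- exact (smooth_on_anchor bialg k b).
Qed.

Lemma base_piE a k y : base_pi a k y = \sum_b anchor m a b y * dual_anchor nn k b y.
Proof. by rewrite /base_pi /base_E fct_sumE. Qed.

Lemma base_EE k y : base_E k y = \sum_b scoef xx b y * anchor m k b y.
Proof. by rewrite /base_pi /base_E fct_sumE. Qed.

(** The image of [phi] by the anchor of the dual algebroid. *)
Definition dual_E a y : R := \sum_b dual_anchor nn a b y * cocycle p b y.
Let const_term y : R := \sum_b scoef xx b y * cocycle p b y.

Lemma diff_coefE f b y : diff_coef nn xx f b y =
  \sum_a dual_anchor nn a b y * pderiv a f y + scoef xx b y * f y.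
Proof.
rewrite /diff_coef -[LHS]/((_ : K) y + scoef xx b y * f y) fct_sumE.
by [].
Qed.

(** Both differentials are first order operators, hence so is the bracket in each
  argument. *)
Lemma fun_bracketE f g y : {< f, g >} y =
  \sum_k \sum_a base_pi k a y * (pderiv a f y * pderiv k g y) +
  f y * (\sum_k base_E k y * pderiv k g y) +
  g y * (\sum_a dual_E a y * pderiv a f y) + f y * g y * const_term y.
Proof.
rewrite /fun_bracket actE.
have pairE (z : 'I_d -> R) : \sum_b diff_coef nn xx f b y * z b =
    \sum_a (\sum_b dual_anchor nn a b y * z b) * pderiv a f y +
    f y * \sum_b scoef xx b y * z b.
  under eq_bigr => b _ do rewrite diff_coefE mulrDl.
  rewrite big_split; congr (_ + _).
    under eq_bigr => b _ do rewrite mulr_suml.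
    rewrite exchange_big; apply: eq_bigr => a _ /=; rewrite mulr_suml.
    by apply: eq_bigr => b _; rewrite mulrAC.
  by rewrite mulr_sumr; apply: eq_bigr => b _; rewrite [_ * f y]mulrC mulrA.
rewrite pairE mulrDl; under eq_bigr => k _ do rewrite pairE mulrDl.
rewrite big_split /= -!addrA; congr (_ + (_ + (_ + _))).
- apply: eq_bigr => k _; rewrite mulr_suml; apply: eq_bigr => a _.
  rewrite base_piE mulrA; congr (_ * _ * _); apply: eq_bigr => b _.
  by rewrite mulrC.
- by rewrite mulr_sumr; apply: eq_bigr => k _; rewrite base_EE mulrA.
- by rewrite mulrC.
by rewrite mulrAC.
Qed.

Definition centred_coord y a : K := fun z => z 0 a - y 0 a.

Lemma centred_coordE y a : centred_coord y a = (fun z : 'rV[R]_n => z 0 a) - (fun=> y 0 a).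
Proof. by []. Qed.

Lemma smooth_on_coord_at y a : smooth_on U (centred_coord y a).
Proof.
rewrite centred_coordE; apply: smooth_onB => //; first exact: smooth_on_coord.
exact: smooth_on_cst.
Qed.

Lemma pderiv_coord_at y a k z : pderiv k (centred_coord y a) z = (a == k)%:R.
Proof.
rewrite centred_coordE pderivD; last exact: differentiable_cst.
  by rewrite pderiv_coord pderivN ?pderiv_cst ?oppr0 ?addr0 //; exact: differentiable_cst.
exact: differentiable_coord.
Qed.

Lemma sum_delta (F : 'I_n -> R) a : \sum_k F k * (a == k)%:R = F a.
Proof.
rewrite (bigD1 a) //= eqxx mulr1 big1 ?addr0 // => k ka.
by rewrite eq_sym (negPf ka) mulr0.
Qed.

Lemma sum_delta2 (F : 'I_n -> 'I_n -> R) a (b : 'I_n) :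
  \sum_k \sum_l F k l * ((a == l)%:R * (b == k)%:R) = F b a.
Proof.
under eq_bigr => k _ do (under eq_bigr => l _ do rewrite mulrA mulrAC; rewrite sum_delta).
by rewrite sum_delta.
Qed.

Lemma smooth_on_one : smooth_on U (fun=> 1).
Proof. exact: smooth_on_cst. Qed.

Lemma base_pi_skew a k y : U y -> base_pi a k y = - base_pi k a y.
Proof.
move=> Uy.
have := fun_bracket_anti bialg (smooth_on_coord_at y a) (smooth_on_coord_at y k) Uy.
rewrite !fun_bracketE /centred_coord !subrr !mul0r !addr0.
under eq_bigr => l _ do under eq_bigr => l' _ do
  rewrite -!/(centred_coord _ _) !pderiv_coord_at.
under [X in _ + X]eq_bigr => l _ do under eq_bigr => l' _ do
  rewrite -!/(centred_coord _ _) !pderiv_coord_at.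
by rewrite !sum_delta2 => /eqP; rewrite addrC addr_eq0 => /eqP.
Qed.

Let fun_bracket1l g y : {< fun=> 1, g >} y =
  \sum_k base_E k y * pderiv k g y + g y * const_term y.
Proof.
have z k : pderiv k (fun=> 1 : R) y = 0 := pderiv_cst k 1 y.
rewrite fun_bracketE; under [X in g y * X]eq_bigr => k _ do rewrite z mulr0.
rewrite [X in X + _ + _ + _ = _]big1 => [|k _]; last first.
  by rewrite big1 // => l _; rewrite z mul0r mulr0.
by rewrite [X in _ + g y * X + _]big1 // mulr0 addr0 !mul1r add0r.
Qed.

Let fun_bracket1r f y : {< f, fun=> 1 >} y =
  \sum_k dual_E k y * pderiv k f y + f y * const_term y.
Proof.
have z k : pderiv k (fun=> 1 : R) y = 0 := pderiv_cst k 1 y.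
rewrite fun_bracketE; under [X in f y * X]eq_bigr => k _ do rewrite z mulr0.
rewrite [X in X + _ + _ + _ = _]big1 => [|k _]; last first.
  by rewrite big1 // => l _; rewrite z !mulr0.
by rewrite [X in _ + f y * X + _]big1 // mulr0 addr0 mulr1 mul1r add0r.
Qed.

(** The pairing of [X] with [phi] is [{< 1, 1 >}], which vanishes by skew symmetry. *)
Lemma const_term0 y : U y -> const_term y = 0.
Proof.
move=> Uy; have := fun_bracket_anti bialg smooth_on_one smooth_on_one Uy.
rewrite !fun_bracket1l mul1r big1 ?add0r => [|k _]; last by rewrite pderiv_cst mulr0.
by lra.
Qed.

Lemma base_E_dual k y : U y -> base_E k y = - dual_E k y.
Proof.
move=> Uy.
have := fun_bracket_anti bialg smooth_on_one (smooth_on_coord_at y k) Uy.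
rewrite fun_bracket1l fun_bracket1r (const_term0 Uy) !mulr0 !addr0.
under eq_bigr => l _ do rewrite pderiv_coord_at.
under [X in _ + X]eq_bigr => l _ do rewrite pderiv_coord_at.
by rewrite !sum_delta => /eqP; rewrite addr_eq0 => /eqP.
Qed.

(** The general form of a Jacobi bracket on functions. *)
Lemma fun_bracket_base f g y : U y -> {< f, g >} y =
  - (\sum_k \sum_l base_pi k l y * (pderiv k f y * pderiv l g y)) +
  f y * (\sum_k base_E k y * pderiv k g y) -
  g y * (\sum_k base_E k y * pderiv k f y).
Proof.
move=> Uy; rewrite fun_bracketE const_term0 // mulr0 addr0; congr (_ + _ + _).
  rewrite exchange_big -sumrN; apply: eq_bigr => k _; rewrite -sumrN.
  by apply: eq_bigr => l _; rewrite (base_pi_skew l k Uy) mulNr.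
rewrite -mulrN -sumrN; congr (_ * _); apply: eq_bigr => k _.
by rewrite base_E_dual // mulNr opprK.
Qed.

Lemma fun_bracket_coordl y a g : U y -> {< centred_coord y a, g >} y =
  - (\sum_l base_pi a l y * pderiv l g y) - g y * base_E a y.
Proof.
move=> Uy; rewrite fun_bracket_base // {2}/centred_coord subrr mul0r addr0.
congr (- _ - _ * _).
  rewrite exchange_big; apply: eq_bigr => l _ /=.
  under eq_bigr => k _ do rewrite pderiv_coord_at [_ * pderiv l g y]mulrC mulrA.
  exact: (sum_delta (fun k => base_pi k l y * pderiv l g y)).
by under eq_bigr => k _ do rewrite pderiv_coord_at; rewrite sum_delta.
Qed.

End BaseStructure.

Section BaseJacobi_alg.
Variable R : comPzRingType.

Lemma bracket_coord_alg (S p q r e : R) :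
  - (- S + p - q) - - r * e = S - p + q + r * e.
Proof. by ring. Qed.

Lemma jacobi_alg (S1 S2 S3 pab pac pbc pba pca pcb Ea Eb Ec : R) :
  pca = - pac -> pcb = - pbc -> pba = - pab ->
  - (S3 - pca * Eb + pcb * Ea + pab * Ec) =
    S1 - pab * Ec + pac * Eb + pbc * Ea - (S2 - pba * Ec + pbc * Ea + pac * Eb) ->
  S1 - S2 + S3 = pab * Ec - pac * Eb + pbc * Ea.
Proof.
move=> -> -> -> /eqP; rewrite -subr_eq0 => /eqP H.
apply/eqP; rewrite -subr_eq0; apply/eqP; rewrite -[RHS]oppr0 -H.
ring.
Qed.

Lemma base_E_alg (S S1 S2 a b f : R) :
  - 0 + f * 0 - 1 * (- S + a * b - b * a) = S1 + b * a - (S2 + a * b) -> S = S1 - S2.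
Proof.
move=> /eqP; rewrite -subr_eq0 => /eqP H.
apply/eqP; rewrite -subr_eq0; apply/eqP; rewrite -[RHS]H.
ring.
Qed.

End BaseJacobi_alg.

Section BaseJacobi.
Variables (R : realType) (n : nat) (M : manifold R n) (d : nat) (A : vbundle M d).
Variables (mu phi nu X : lfamily A).
Hypothesis bialg : jacobi_bialgebroid mu phi nu X.
Variable i : chart_index M.
Local Notation K := ('rV[R]_n -> R).
Local Notation U := (chart_img i).
Local Notation "{< f , g >}" := (fun_bracket mu phi nu X i f g).
Local Notation pi := (base_pi mu nu i).
Local Notation E := (base_E mu X i).
Implicit Types (f g h : K) (a b c k l : 'I_n) (y : 'rV[R]_n).

Let oU : open U. Proof. exact: chart_img_open. Qed.
Let spi a b : smooth_on U (pi a b). Proof. exact (smooth_on_base_pi bialg a b). Qed.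
Let sE a : smooth_on U (E a). Proof. exact (smooth_on_base_E bialg a). Qed.
Let sx y a : smooth_on U (centred_coord y a). Proof. exact (smooth_on_coord_at y a). Qed.

Let coord_bracket y a b : K := - pi a b + centred_coord y a * E b - centred_coord y b * E a.

Let smooth_on_coord_bracket y a b : smooth_on U (coord_bracket y a b).
Proof.
apply: (smooth_onB oU); last exact (smooth_onM oU (sx y b) (sE a)).
apply: (smooth_onD oU); first exact (smooth_onN oU (@spi a b)).
exact (smooth_onM oU (sx y a) (sE b)).
Qed.

Let coord_bracketE y a b : U y -> coord_bracket y a b y = - pi a b y.
Proof.
move=> Uy; rewrite -[LHS]/(- pi a b y + (y 0 a - y 0 a) * E b y - (y 0 b - y 0 b) * E a y).
by rewrite !subrr !mul0r addr0 subr0.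
Qed.

Let pderiv_coord_bracket y a b k : U y -> pderiv k (coord_bracket y a b) y =
  - pderiv k (pi a b) y + (a == k)%:R * E b y - (b == k)%:R * E a y.
Proof.
move=> Uy.
have dpi := smooth_on_diff (@spi a b) Uy.
have dE c := smooth_on_diff (@sE c) Uy.
have dx c := smooth_on_diff (@sx y c) Uy.
have dm c e := smooth_on_diff (smooth_onM oU (@sx y c) (@sE e)) Uy.
have dN := smooth_on_diff (smooth_onN oU (@spi a b)) Uy.
have dD := smooth_on_diff (smooth_onD oU (smooth_onN oU (@spi a b)) (smooth_onM oU (@sx y a) (@sE b))) Uy.
have dMN := smooth_on_diff (smooth_onN oU (smooth_onM oU (@sx y b) (@sE a))) Uy.
have eM c e : pderiv k (centred_coord y c * E e) y = (c == k)%:R * E e y.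
  rewrite (pderivM k (dx c) (dE e)) pderiv_coord_at.
  by rewrite /centred_coord subrr mul0r addr0.
rewrite (pderivD k dD dMN) (pderivD k dN (dm a b)) (pderivN k dpi).
by rewrite (pderivN k (dm b a)) !eM.
Qed.

Let near_coord_bracket y a b : U y ->
  \forall z \near y, {< centred_coord y a, centred_coord y b >} z = coord_bracket y a b z.
Proof.
move=> Uy; have := open_nbhs_nbhs (conj oU Uy); apply: filterS => z Uz.
rewrite (fun_bracket_base bialg _ _ Uz).
rewrite -[RHS]/(- pi a b z + centred_coord y a z * E b z - centred_coord y b z * E a z).
congr (- _ + _ * _ - _ * _).
- under eq_bigr => k _ do under eq_bigr => l _ do
    rewrite !pderiv_coord_at [_ * (b == l)%:R]mulrC.
  exact: (sum_delta2 (fun k l => pi k l z)).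
- by under eq_bigr => k _ do rewrite pderiv_coord_at; rewrite sum_delta.
by under eq_bigr => k _ do rewrite pderiv_coord_at; rewrite sum_delta.
Qed.

Let near_refl f y : \forall z \near y, f z = f z.
Proof. by near=> z. Unshelve. all: by end_near. Qed.

Let bracket_coord y a b c : U y -> {< centred_coord y a, {< centred_coord y b, centred_coord y c >} >} y =
  \sum_l pi a l y * pderiv l (pi b c) y - pi a b y * E c y + pi a c y * E b y
  + pi b c y * E a y.
Proof.
move=> Uy.
rewrite (nbhs_singleton (near_fun_bracket mu phi nu X i (near_refl (centred_coord y a) y) (near_coord_bracket b c Uy))).
rewrite (fun_bracket_coordl bialg _ _ Uy) coord_bracketE //.
under eq_bigr => l _ do rewrite (pderiv_coord_bracket b c l Uy) mulrDr mulrDr !mulrN !mulrA.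
rewrite !big_split /= !sumrN.
under [X in - (_ + X + _)]eq_bigr => l _ do rewrite mulrAC.
under [X in - (_ + _ - X)]eq_bigr => l _ do rewrite mulrAC.
rewrite (sum_delta (fun l => pi a l y * E c y)) (sum_delta (fun l => pi a l y * E b y)).
exact (bracket_coord_alg _ _ _ _ _).
Qed.

(** The Jacobi identity of the bracket for three coordinate functions. *)
Lemma base_pi_jacobi y a b c : U y ->
  \sum_k (pi a k y * pderiv k (pi b c) y - pi b k y * pderiv k (pi a c) y
          + pi c k y * pderiv k (pi a b) y) =
  pi a b y * E c y - pi a c y * E b y + pi b c y * E a y.
Proof.
move=> Uy.
have := fun_bracket_jacobi bialg (sx y a) (sx y b) (sx y c) Uy.
have sb := smooth_on_coord_bracket y a b.
have e1 : {< {< centred_coord y a, centred_coord y b >}, centred_coord y c >} y =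
    - {< centred_coord y c, {< centred_coord y a, centred_coord y b >} >} y.
  have := fun_bracket_anti bialg sb (sx y c) Uy.
  rewrite -(nbhs_singleton (near_fun_bracket mu phi nu X i
    (near_coord_bracket a b Uy) (near_refl (centred_coord y c) y))).
  rewrite -(nbhs_singleton (near_fun_bracket mu phi nu X i
    (near_refl (centred_coord y c) y) (near_coord_bracket a b Uy))).
  by move/eqP; rewrite addr_eq0 => /eqP.
rewrite e1 !(bracket_coord _ _ _ Uy) => H.
rewrite big_split /= big_split /= sumrN.
exact (jacobi_alg (base_pi_skew bialg c a Uy) (base_pi_skew bialg c b Uy)
  (base_pi_skew bialg b a Uy) H).
Qed.

Let bracket_coord1 y a z : U z -> {< centred_coord y a, fun=> 1 >} z = - E a z.
Proof.
move=> Uz; rewrite (fun_bracket_base bialg _ _ Uz).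
rewrite big1 => [|k _]; last by rewrite big1 // => l _; rewrite pderiv_cst !mulr0.
rewrite big1 => [|k _]; last by rewrite pderiv_cst mulr0.
under eq_bigr => k _ do rewrite pderiv_coord_at.
by rewrite (sum_delta (fun k => E k z)) mulr0 oppr0 !add0r mul1r.
Qed.

Let near_bracket_coord1 y a : U y ->
  \forall z \near y, {< centred_coord y a, fun=> 1 >} z = (- E a) z.
Proof.
move=> Uy; have := open_nbhs_nbhs (conj oU Uy); apply: filterS => z Uz.
exact (bracket_coord1 y a Uz).
Qed.

(** The Jacobi identity for two coordinate functions and the constant 1. *)
Lemma base_E_jacobi y a b : U y ->
  \sum_k E k y * pderiv k (pi a b) y =
  \sum_k (pi a k y * pderiv k (E b) y - pi b k y * pderiv k (E a) y).
Proof.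
move=> Uy; have s1 : smooth_on U (fun=> 1 : R) := @smooth_on_cst R n U 1.
have := fun_bracket_jacobi bialg (sx y a) (sx y b) s1 Uy.
have sb := smooth_on_coord_bracket y a b.
have dE c := smooth_on_diff (@sE c) Uy.
have bE c e : {< centred_coord y c, {< centred_coord y e, fun=> 1 >} >} y =
    \sum_k pi c k y * pderiv k (E e) y + E e y * E c y.
  rewrite (nbhs_singleton (near_fun_bracket mu phi nu X i
    (near_refl (centred_coord y c) y) (near_bracket_coord1 e Uy))).
  rewrite (fun_bracket_coordl bialg _ _ Uy).
  under eq_bigr => k _ do rewrite (pderivN k (dE e)) mulrN.
  by rewrite sumrN opprK -[(- E e) y]/(- E e y) mulNr opprK.
rewrite !bE.
rewrite (nbhs_singleton (near_fun_bracket mu phi nu X i (near_coord_bracket a b Uy)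
  (near_refl (fun=> 1) y))).
rewrite (fun_bracket_base bialg _ _ Uy).
rewrite big1 => [|k _]; last by rewrite big1 // => l _; rewrite pderiv_cst !mulr0.
rewrite big1 => [|k _]; last by rewrite pderiv_cst mulr0.
under eq_bigr => k _ do rewrite (pderiv_coord_bracket a b k Uy) mulrDr mulrDr !mulrN !mulrA.
rewrite !big_split /= !sumrN.
under [X in _ - _ * (_ + X + _)]eq_bigr => l _ do rewrite mulrAC.
under [X in _ - _ * (_ + _ - X)]eq_bigr => l _ do rewrite mulrAC.
rewrite (sum_delta (fun l => E l y * E b y)) (sum_delta (fun l => E l y * E a y)).
exact: (base_E_alg (f := coord_bracket y a b y)).
Qed.

End BaseJacobi.

(** * The vector field and the bivector field as brackets *)

Section FunctionBrackets.
Variables (R : realType) (n d : nat).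
Local Notation K := ('rV[R]_n -> R).
Local Notation L := (lfun R n d).
Local Notation xi := (lshift d).
Local Notation th := (rshift d).
Implicit Types (u v V mu nu phi : L) (f g : K) (a : 'I_n) (b : 'I_d).

Lemma mcoeff_lbracket_fun u f S : mcoeff mnm0 (lbracket u (gconst n d f) S) =
  \sum_a pderiv a f * mcoeff (mnm1 a) (u S).
Proof.
rewrite lbracket_gconstr mcoeff_sum; apply: eq_bigr => a _.
rewrite mcoeffZ mcoeff_mderiv mnm0E mulr1n; congr (_ * mcoeff _ _).
by apply/mnmP => k; rewrite mnmDE mnm0E.
Qed.

Lemma lbracket11_fun u f : ghom 1 1 u -> lbracket u (gconst n d f) =
  gconst n d (\sum_a pderiv a f * mcoeff (mnm1 a) (u finset.set0)).
Proof.
move=> hu; have h0 : ghom 0 0 (lbracket u (gconst n d f)).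
  by apply: ghom_lbracket hu (@ghom_gconst _ _ _ f).
by rewrite (ghom00E h0) mcoeff_lbracket_fun.
Qed.

Lemma symbol_mu_vector mu V a : ghom 1 2 mu -> ghom 1 0 V ->
  mcoeff (mnm1 a) (lbracket mu V finset.set0) = \sum_b scoef V b * anchor mu a b.
Proof.
move=> hmu hV; rewrite (lbracket_vectorr _ hV) galgDE sum_ffunE.
rewrite big1 ?add0r => [|k _]; last first.
  by rewrite gmul_set0 (set0_eq0 (ghom_dp (a := k) hmu) isT) mul0r.
rewrite sum_ffunE mcoeff_sum; apply: eq_bigr => b _.
by rewrite ffunE mcoeffZ dright_set0.
Qed.

Lemma symbol_nu_covector nu phi a : ghom 2 1 nu -> ghom 0 1 phi ->
  mcoeff (mnm1 a) (lbracket nu phi finset.set0) =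
  \sum_b dual_anchor nu a b * cocycle phi b.
Proof.
move=> hnu hphi.
have mulD (u v u' v' : L) : (u ** v + u' ** v') finset.set0 =
    u finset.set0 * v finset.set0 + u' finset.set0 * v' finset.set0.
  by rewrite galgDE !gmul_set0.
have mulB (u v u' v' : L) : u finset.set0 = 0 -> v' = 0 ->
    (u ** v - u' ** v') finset.set0 = 0.
  by move=> u0 ->; rewrite galgBE gmul_set0 u0 mul0r gmul0r ffunE subrr.
rewrite /lbracket galgDE sum_ffunE big1 ?add0r => [|k _]; last first.
  exact (mulB _ _ _ _ (set0_eq0 (ghom_dp (a := k) hnu) isT) (dp_eq0 k hphi isT)).
rewrite sum_ffunE mcoeff_sum; apply: eq_bigr => b _.
rewrite mulD (dright_set0 (th b) nu) (dleft_set0 (xi b) phi) (dleft_set0 (th b) phi).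
have -> : phi [set th b] = 0 by apply: (ghom_set0 hphi); rewrite !weightE.
rewrite mulr0 addr0 (phi_xi hphi) mulrC mul_mpolyC mcoeffZ.
by rewrite mulrC.
Qed.

Lemma lbracket_mu_nu_funs mu nu f g : ghom 1 2 mu -> ghom 2 1 nu ->
  lbracket (lbracket mu (gconst n d f)) (lbracket nu (gconst n d g)) =
  gconst n d (\sum_b (\sum_k dual_anchor nu k b * pderiv k g) *
                     (\sum_a anchor mu a b * pderiv a f)).
Proof.
move=> hmu hnu.
have h1 : ghom 0 1 (lbracket mu (gconst n d f)).
  by apply: ghom_lbracket hmu (@ghom_gconst _ _ _ f).
have h2 : ghom 1 0 (lbracket nu (gconst n d g)).
  by apply: ghom_lbracket hnu (@ghom_gconst _ _ _ g).
rewrite (lbracket_phi_vector h1 h2); congr gconst; apply: eq_bigr => b _.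
rewrite scoef_lbracket_fun; congr (_ * _); rewrite /cocycle mcoeff_lbracket_fun.
by apply: eq_bigr => a _; rewrite mulrC.
Qed.

Lemma gconst_opp f : gconst n d (- f) = - gconst n d f.
Proof.
by apply/ffunP => S; rewrite !ffunE; case: ifP => _; rewrite ?raddfN ?oppr0.
Qed.

Lemma geval_gconst f g (y : 'rV[R]_n) : f y = g y ->
  geval y (gconst n d f) = geval y (gconst n d g).
Proof.
move=> fg; apply/gevalP => S m; rewrite !ffunE; case: ifP => // _.
rewrite !mcoeffC -[LHS]/(f y * _) -[RHS]/(g y * _) fg //.
Qed.

Lemma geval_gconst_inj f g (y : 'rV[R]_n) :
  geval y (gconst n d f) = geval y (gconst n d g) -> f y = g y.
Proof.
move=> /gevalP/(_ finset.set0 mnm0); rewrite !ffunE eqxx !mcoeffC eqxx.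
by rewrite !mulr1.
Qed.

End FunctionBrackets.

Section BaseTensors.
Variables (R : realType) (n : nat) (M : manifold R n) (d : nat) (A : vbundle M d).
Variables (mu phi nu X : lfamily A).
Hypothesis bialg : jacobi_bialgebroid mu phi nu X.
Local Notation K := ('rV[R]_n -> R).
Local Notation TM := (tangent_bundle M).
Local Notation pi := (base_pi mu nu).
Local Notation E := (base_E mu X).
Implicit Types (i j : chart_index M) (a k : 'I_n) (y : 'rV[R]_n).

Let hmu : bihom 1 2 mu. Proof. by have [[[]]] := bialg. Qed.
Let hphi : bihom 0 1 phi. Proof. by have [[[]]] := bialg. Qed.
Let hnu : bihom 2 1 nu. Proof. by have [_ []] := bialg. Qed.
Let hX : bihom 1 0 X. Proof. by have [_ []] := bialg. Qed.

Let base_E_matrix i y : chart_img i y ->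
  \row_k E i k y = vector_coef (X i) y *m (xi_symbol (mu i) y)^T.
Proof.
move=> yi; apply/rowP => k; rewrite !mxE base_EE; apply: eq_bigr => b _.
by rewrite !mxE /scoef /anchor !mcoeff_cutoff.
Qed.

Let base_pi_matrix i y : chart_img i y ->
  \matrix_(a, k) pi i a k y = xi_symbol (mu i) y *m (theta_symbol (nu i) y)^T.
Proof.
move=> yi; apply/matrixP => a k; rewrite !mxE base_piE; apply: eq_bigr => b _.
by rewrite !mxE /dual_anchor /anchor !mcoeff_cutoff.
Qed.

Let vb_trans_inv i j x : chart_dom i x -> chart_dom j x ->
  vb_trans A j i x *m vb_trans A i j x = 1%:M.
Proof. by move=> xi xj; rewrite -vb_trans_cocycle // vb_trans_id. Qed.

Lemma base_E_trans i j x k : chart_dom i x -> chart_dom j x ->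
  E i k (chart i x) = \sum_a E j a (chart j x) * vb_trans TM j i x a k.
Proof.
move=> xi xj.
have ei := base_E_matrix (chart_imgT xi); have ej := base_E_matrix (chart_imgT xj).
have [_ cX _] := hX.
have tX := (compatible_vectorP (fun i y yi => ghom_bihom hX yi)).1 cX i j x xi xj.
have : \row_k E i k (chart i x) = (\row_k E j k (chart j x)) *m Defs.jacobian j i x.
  rewrite ei ej tX (xi_symbol_trans hmu xi xj) !trmx_mul !trmxK.
  by rewrite !mulmxA -[_ *m _ *m vb_trans A i j x]mulmxA vb_trans_inv // mulmx1.
move=> /rowP/(_ k); rewrite !mxE => ->.
by apply: eq_bigr => a _; rewrite mxE.
Qed.

(** The transition matrices of the bundle and of its dual are contragredient, so
  they cancel in the product of the two anchors. *)
Lemma base_pi_trans i j x a b : chart_dom i x -> chart_dom j x ->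
  pi i a b (chart i x) = \sum_c \sum_e pi j c e (chart j x) *
    (vb_trans TM j i x c a * vb_trans TM j i x e b).
Proof.
move=> xi xj.
have ei := base_pi_matrix (chart_imgT xi); have ej := base_pi_matrix (chart_imgT xj).
have : \matrix_(a, k) pi i a k (chart i x) = (Defs.jacobian j i x)^T *m
    (\matrix_(a, k) pi j a k (chart j x)) *m Defs.jacobian j i x.
  rewrite ei ej (xi_symbol_trans hmu xi xj) (theta_symbol_trans hnu xi xj).
  rewrite !trmx_mul !trmxK !mulmxA; congr (_ *m _ *m _).
  rewrite -[_ *m (vb_trans A i j x)^T *m _]mulmxA -trmx_mul.
  by rewrite vb_trans_inv // trmx1 mulmx1.
move=> /matrixP/(_ a b); rewrite !mxE => ->.
under eq_bigr => e _ do rewrite mxE mulr_suml.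
rewrite exchange_big; apply: eq_bigr => c _; apply: eq_bigr => e _.
by rewrite !mxE mulrCA mulrA mulrAC mulrC mulrCA mulrA.
Qed.

Lemma bihom_base_E : bihom (A := TM) 1 0 (fun i => vector n (E i)).
Proof.
apply: bihom_vector => [i b|]; first exact (smooth_on_base_E bialg b).
exact: base_E_trans.
Qed.

Lemma bihom_base_pi : bihom (A := TM) 2 0 (fun i => bivector n (pi i)).
Proof.
apply: bihom_bivector => [i a b|i a b y yi|].
- exact (smooth_on_base_pi bialg a b).
- exact (base_pi_skew bialg a b yi).
exact: base_pi_trans.
Qed.

Lemma mu_X_bracket f i y : chart_img i y ->
  geval y (<{ <{ mu, X }>, of_fun A f }> i) =
  geval y (gconst n d (fun z => \sum_k E i k z * pderiv k (f \o chart_inv i) z)).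
Proof.
move=> yi; have oU := @chart_img_open _ _ M i.
have hm := ghom_cutoff_family (i := i) hmu; have hx := ghom_cutoff_family (i := i) hX.
have e := eq_over_lbracket oU (eq_over_lbracket oU (@eq_over_cutoff _ _ _ (chart_img i) (mu i))
  (@eq_over_cutoff _ _ _ (chart_img i) (X i)))
  (@eq_over_refl _ _ _ (chart_img i) (of_fun A f i)).
have h1 : ghom 1 1 (lbracket (cutoff (chart_img i) (mu i)) (cutoff (chart_img i) (X i))).
  by apply: ghom_lbracket hm hx.
apply: (etrans (esym (e y yi))); rewrite (lbracket11_fun _ h1).
apply: geval_gconst; rewrite fct_sumE; apply: eq_bigr => k _.
rewrite (symbol_mu_vector k hm hx) mulrC.
by [].
Qed.

Lemma nu_phi_bracket f i y : chart_img i y ->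
  geval y ((- <{ <{ nu, phi }>, of_fun A f }>) i) =
  geval y (gconst n d (fun z => \sum_k E i k z * pderiv k (f \o chart_inv i) z)).
Proof.
move=> yi; have oU := @chart_img_open _ _ M i.
have hn := ghom_cutoff_family (i := i) hnu; have hp := ghom_cutoff_family (i := i) hphi.
have e := eq_over_lbracket oU (eq_over_lbracket oU (@eq_over_cutoff _ _ _ (chart_img i) (nu i))
  (@eq_over_cutoff _ _ _ (chart_img i) (phi i)))
  (@eq_over_refl _ _ _ (chart_img i) (of_fun A f i)).
have h1 : ghom 1 1 (lbracket (cutoff (chart_img i) (nu i)) (cutoff (chart_img i) (phi i))).
  by apply: ghom_lbracket hn hp.
have e' := eq_overN e.
apply: (etrans (esym (e' y yi))); rewrite (lbracket11_fun _ h1).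
rewrite -gconst_opp; apply: geval_gconst; rewrite -[LHS]/(- (_ : K) y) fct_sumE -sumrN.
apply: eq_bigr => k _; rewrite (base_E_dual bialg k yi) (symbol_nu_covector k hn hp).
rewrite mulNr mulrC -[LHS]/(- (_ y * _ y)) fct_sumE; congr (- (_ * _)).
Qed.

Lemma mu_nu_bracket f g i y : chart_img i y ->
  geval y (<{ <{ mu, of_fun A f }>, <{ nu, of_fun A g }> }> i) =
  geval y (gconst n d (fun z => \sum_a \sum_k pi i a k z *
    (pderiv a (f \o chart_inv i) z * pderiv k (g \o chart_inv i) z))).
Proof.
move=> yi; have oU := @chart_img_open _ _ M i.
have hm := ghom_cutoff_family (i := i) hmu; have hn := ghom_cutoff_family (i := i) hnu.
have e := eq_over_lbracket oU
  (eq_over_lbracket oU (@eq_over_cutoff _ _ _ (chart_img i) (mu i))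
    (@eq_over_refl _ _ _ (chart_img i) (of_fun A f i)))
  (eq_over_lbracket oU (@eq_over_cutoff _ _ _ (chart_img i) (nu i))
    (@eq_over_refl _ _ _ (chart_img i) (of_fun A g i))).
apply: (etrans (esym (e y yi))); rewrite (lbracket_mu_nu_funs _ _ hm hn).
apply: geval_gconst; rewrite fct_sumE.
under eq_bigr => b _ do
  rewrite -[(_ * _) y]/(_ y * _ y) !fct_sumE mulrC mulr_suml.
rewrite exchange_big; apply: eq_bigr => a _ /=.
under eq_bigr => b _ do rewrite mulr_sumr.
rewrite exchange_big; apply: eq_bigr => k _ /=.
rewrite base_piE mulr_suml; apply: eq_bigr => b _.
by rewrite -[(_ * _) y]/(_ y * _ y) -[X in _ * X]/(_ y * _ y) mulrACA.
Qed.

End BaseTensors.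

Section BaseFields.
Variables (R : realType) (n : nat) (M : manifold R n) (d : nat) (A : vbundle M d).
Local Notation K := ('rV[R]_n -> R).
Local Notation TM := (tangent_bundle M).
Implicit Types (i j : chart_index M) (a b k : 'I_n) (y : 'rV[R]_n).

Lemma vf_apply_vector (V : chart_index M -> 'I_n -> K) f i y :
  vf_apply (fun i => vector n (V i) : lfun R n n) f i y =
  \sum_a V i a y * pderiv a (f \o chart_inv i) y.
Proof.
apply: eq_bigr => a _; congr (_ * _).
by rewrite vectorE mcoeffC eqxx mulr1.
Qed.

Lemma sum_skew (P : 'I_n -> 'I_n -> R) (w : 'I_n -> 'I_n -> R) :
  (forall a b, P a b = - P b a) ->
  \sum_a \sum_b P a b * w a b =
  \sum_(a < n) \sum_(b < n | (a < b)%N) P a b * (w a b - w b a).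
Proof.
move=> skP; apply: (@mulr2n_inj R R^o).
have := @sum_skew_skew R R^o n P (fun a b => w a b - w b a) skP.
move=> E; rewrite /= -[RHS]E => [|a b]; last by rewrite opprB.
under [RHS]eq_bigr => a _ do (under eq_bigr => b _ do
  rewrite -[_ *: _]/(P a b * (w a b - w b a)) mulrBr; rewrite sumrB).
rewrite sumrB mulr2n; congr (_ + _); rewrite exchange_big -sumrN /=.
apply: eq_bigr => a _; rewrite -sumrN; apply: eq_bigr => b _.
by rewrite skP mulNr.
Qed.

Lemma bivf_apply_bivector (P : chart_index M -> 'I_n -> 'I_n -> K) f g i y :
  (forall a b, P i a b y = - P i b a y) ->
  bivf_apply (fun i => bivector n (P i) : lfun R n n) f g i y =
  \sum_a \sum_b P i a b y *
    (pderiv a (f \o chart_inv i) y * pderiv b (g \o chart_inv i) y).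
Proof.
move=> skP; rewrite (sum_skew _ skP).
apply: eq_bigr => a _; apply: eq_bigr => b ab; congr (_ * _).
  by rewrite bivectorE // mcoeffC eqxx mulr1.
by rewrite [X in _ - X]mulrC.
Qed.

Variables (E : chart_index M -> 'I_n -> K) (pi : chart_index M -> 'I_n -> 'I_n -> K).
Variables (T1 : (M -> R) -> lfamily A) (T2 : (M -> R) -> (M -> R) -> lfamily A).
Hypothesis T1E : forall f i y, chart_img i y -> geval y (T1 f i) =
  geval y (gconst n d (fun z => \sum_k E i k z * pderiv k (f \o chart_inv i) z)).
Hypothesis T2E : forall f g i y, chart_img i y -> geval y (T2 f g i) =
  geval y (gconst n d (fun z => \sum_a \sum_k pi i a k z *
    (pderiv a (f \o chart_inv i) z * pderiv k (g \o chart_inv i) z))).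
Hypothesis pi_skew : forall i a b y, chart_img i y -> pi i a b y = - pi i b a y.

Lemma is_vector_field_vector : bihom (A := TM) 1 0 (fun i => vector n (E i)) ->
  is_vector_field T1 (fun i => vector n (E i) : lfun R n n).
Proof.
move=> hE; split=> // f _ i y yi; rewrite (T1E f yi); apply: geval_gconst.
by rewrite vf_apply_vector.
Qed.

Lemma is_bivector_field_bivector : bihom (A := TM) 2 0 (fun i => bivector n (pi i)) ->
  is_bivector_field T2 (fun i => bivector n (pi i) : lfun R n n).
Proof.
move=> hpi; split=> // f g _ _ i y yi; rewrite (T2E f g yi); apply: geval_gconst.
rewrite bivf_apply_bivector // => a b; exact: pi_skew.
Qed.

Let test_coord i y a : chart_img i y -> exists2 f : M -> R, smooth f &
  forall k, pderiv k (f \o chart_inv i) y = (a == k)%:R.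
Proof.
move=> yi.
have [f sf fE] := smooth_extension yi (@smooth_on_coord R n (chart_img i) a).
by exists f => // k; rewrite (near_eq_pderiv k fE) pderiv_coord.
Qed.

(** Testing against the coordinate functions recovers the components. *)
Lemma vector_field_unique (V : lfamily TM) i : is_vector_field T1 V ->
  eq_over (chart_img i) (V i) (vector n (E i)).
Proof.
move=> [hV TV] y yi; have hy := ghom_bihom hV yi.
have -> : geval y (vector n (E i)) = vector n (fun k => E i k y) :> galg R n n.
  rewrite raddf_sum /=; apply: eq_bigr => b _.
  by rewrite geval_scale geval_godd.
rewrite (ghom10E hy); congr vector; apply/funext => a.
have [f sf fE] := test_coord a yi.
have /geval_gconst_inj := etrans (esym (TV f sf i y yi)) (T1E f yi).
rewrite /vf_apply; under eq_bigr => k _ do rewrite fE.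
under [in RHS]eq_bigr => k _ do rewrite fE.
by rewrite !sum_delta mcoeff_geval => ->.
Qed.

Lemma bivector_field_unique (P : lfamily TM) i : is_bivector_field T2 P ->
  eq_over (chart_img i) (P i) (bivector n (pi i)).
Proof.
move=> [hP TP] y yi; have hy := ghom_bihom hP yi.
rewrite geval_bivector (ghom20E hy).
apply: eq_bigr => a _; apply: eq_bigr => b ab; congr (_ *: _).
have [f sf fE] := test_coord a yi; have [g sg gE] := test_coord b yi.
have /geval_gconst_inj := etrans (esym (TP f g sf sg i y yi)) (T2E f g yi).
rewrite mcoeff_geval.
under [in RHS]eq_bigr => k _ do under eq_bigr => l _ do rewrite fE gE [_%:R * _]mulrC.
rewrite (sum_delta2 (fun k l => pi i k l y) b a) => <-.
rewrite /bivf_apply (bigD1 a) //= [X in _ + X]big1 ?addr0 => [|k ka]; last first.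
  rewrite big1 // => l kl; rewrite !fE !gE.
  rewrite [a == k]eq_sym (negPf ka) mul0r sub0r.
  have [bk|] := eqVneq b k; last by rewrite mul0r oppr0 mulr0.
  have [al|] := eqVneq a l; last by rewrite mulr0 oppr0 mulr0.
  by move: kl ab; rewrite bk al => kl lk; have := ltn_trans kl lk; rewrite ltnn.
rewrite (bigD1 b) //= [X in _ + X]big1 ?addr0 => [|l /andP[al lb]]; last first.
  rewrite !fE !gE [b == l]eq_sym (negPf lb) mulr0 sub0r.
  by rewrite (_ : b == a = false) ?mul0r ?oppr0 ?mulr0 //; apply/eqP => ba; move: ab; rewrite ba ltnn.
rewrite !fE !gE !eqxx (_ : b == a = false) ?mul0r ?subr0 ?mulr1 //.
by apply/eqP => ba; move: ab; rewrite ba ltnn.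
Qed.

End BaseFields.

(** * The Schouten bracket *)

Section Schouten.
Variables (R : realType) (n : nat).
Local Notation K := ('rV[R]_n -> R).
Local Notation L := (lfun R n n).
Local Notation xi := (lshift n).
Local Notation th := (rshift n).
Implicit Types (u v P Q : L) (f g : K) (a b c l : 'I_n).

Local Notation liouville := (liouville K n).

Lemma dleft_xi_liouville b : dleft (xi b) liouville = gp _ n b.
Proof.
apply/ffunP => S; rewrite !ffunE; case: ifP => bS.
  by rewrite ifN //; apply: contraTneq bS => ->; rewrite inE.
case: eqP => [->|/eqP S0].
  by rewrite inversions0r mul1r finset.setU0 liouville_xi.
rewrite liouville_neq ?mulr0 // => c; apply: contraNneq S0 => E.
have bc : b = c.
  have : xi b \in [set xi c] by rewrite -E !inE eqxx.
  by rewrite inE eq_lshift => /eqP.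
apply/eqP/finset.setP => s; rewrite inE; apply/negP => sS.
have : s \in [set xi c] by rewrite -E inE sS orbT.
by rewrite inE -bc => /eqP sb; rewrite -sb sS in bS.
Qed.

Lemma dleft_theta_liouville b : dleft (th b) liouville = 0.
Proof.
apply/ffunP => S; rewrite !ffunE; case: ifP => // bS.
rewrite liouville_neq ?mulr0 // => c; apply/eqP => E.
have : th b \in [set xi c] by rewrite -E !inE eqxx.
by rewrite inE eq_oddE.
Qed.

Lemma dright_theta_liouville b : dright (th b) liouville = 0.
Proof.
apply/ffunP => S; rewrite !ffunE; case: ifP => // bS.
rewrite liouville_neq ?mulr0 // => c; apply/eqP => E.
have : th b \in [set xi c] by rewrite -E !inE eqxx.
by rewrite inE eq_oddE.
Qed.

Lemma dx_liouville a : dx a liouville = 0.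
Proof.
apply/ffunP => S; apply/mpolyP => m; rewrite mcoeff_dx [in RHS]ffunE mcoeff0.
have [k ->] : exists k, mcoeff m (liouville S) = fun=> k%:R : R.
  have [[b ->]|no] := pselect (exists b, S = [set xi b]).
    rewrite liouville_xi mcoeffX; exists (mnm1 b == m : nat).
    by apply/funext => y; case: eqP.
  exists 0%N; rewrite liouville_neq ?mcoeff0 // => b.
  by apply/eqP => Sb; apply: no; exists b.
by apply/funext => y; exact: pderiv_cst.
Qed.

Lemma mderiv_mnm1 a b : mderiv b (mpolyX K (mnm1 a)) = mpolyC n ((a == b)%:R : K).
Proof.
rewrite mderivX mnm1E; have [->|_] := eqVneq a b; last by rewrite scale0r mpolyC0.
rewrite scale1r (_ : mnm_sub _ _ = mnm0) ?mpolyX0 ?mpolyC1 //.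
by apply/mnmP => k; rewrite mnmBE mnm0E subnn.
Qed.

Lemma dp_liouville a : dp a liouville = gxi _ n a.
Proof.
apply/ffunP => S; rewrite [LHS]ffunE.
have [[b ->]|no] := pselect (exists b, S = [set xi b]).
  by rewrite liouville_xi mderiv_mnm1 godd_set1 eq_lshift eq_sym mpolyC_nat.
have ne b : S != [set xi b] by apply/eqP => Sb; apply: no; exists b.
by rewrite liouville_neq // mderiv0 ffunE (negPf (ne a)).
Qed.

Lemma lbracket_liouville : lbracket liouville liouville = 0.
Proof.
rewrite /lbracket big1 => [|a _]; last by rewrite dx_liouville gmul0r gmul0l subrr.
rewrite add0r big1 // => a _.
by rewrite dright_theta_liouville dleft_theta_liouville gmul0l gmul0r addr0.
Qed.

Lemma dp_gmul a u v : dp a (u ** v) = dp a u ** v + u ** dp a v.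
Proof.
apply/ffunP => S; rewrite [RHS]ffunE [LHS]ffunE !gmulE mderiv_sum -big_split /=.
apply: eq_bigr => T _; rewrite -scale_signE mderivZ mderivM !ffunE scale_signE.
by rewrite mulrDr.
Qed.

Lemma ghom_xi_eq0 k u (S : {set 'I_(n + n)}) b : ghom k 0 u -> xi b \in S -> u S = 0.
Proof.
move=> hu bS; apply/mpolyP => m; rewrite mcoeff0; apply/eqP; apply: contraTT bS.
by move=> /hu[_ w0]; apply: xi_weight0; lia.
Qed.

Lemma dright_xi_gmul_gxi k u a b : ghom k 0 u ->
  dright (xi b) (u ** gxi _ n a) = (a == b)%:R *: u.
Proof.
move=> hu; apply/ffunP => S; rewrite ffunE [RHS]ffunE; case: ifP => [bS|/negbT bS].
  by rewrite (ghom_xi_eq0 hu bS) scaler0.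
rewrite gmul_odd1r; last exact: odd_degree_godd.
have [->|ab] := eqVneq a b.
  rewrite (bigD1 (xi b)) /=; last by rewrite !inE eqxx.
  rewrite big1 ?addr0 => [|t /andP[_ ta]]; last first.
    by rewrite godd_set1 eq_sym (negPf ta) !mulr0.
  have -> : (xi b |: S) :\ xi b = S.
    by exact: (finset.setU1K bS).
  by rewrite godd_set1 eqxx mulr1 mulrA -expr2 sqrr_sign mul1r scale1r.
rewrite scale0r big1 ?mulr0 // => t _; rewrite godd_set1.
case: (xi a =P t) => [<-|_]; last by rewrite !mulr0.
rewrite (ghom_xi_eq0 (b := b) hu) ?mul0r ?mulr0 // !inE eqxx andbT.
by rewrite eq_lshift eq_sym.
Qed.

Lemma dright_xi_gmul_gp k u a b : ghom k 0 u -> dright (xi b) (u ** gp _ n a) = 0.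
Proof.
move=> hu; apply/ffunP => S; rewrite ffunE [RHS]ffunE; case: ifP => // bS.
rewrite (gpoly_mulr (mpolyX K (mnm1 a))) (ghom_xi_eq0 (b := b) hu) ?mulr0 //.
by rewrite !inE eqxx.
Qed.

Lemma dp_gp a b : dp b (gp _ n a) = gconst n n ((a == b)%:R : K).
Proof.
apply/ffunP => S; rewrite !ffunE; case: ifP => _; last exact: mderiv0.
exact: mderiv_mnm1.
Qed.

Lemma ghom_dright_theta k u a : ghom k.+1 0 u -> ghom k 0 (dright (th a) u).
Proof.
move=> hu S m /has_coef_dright[nS /hu]; rewrite !odd_weightU1 // !weightE; lia.
Qed.

Lemma ghom_dleft_theta k u a : ghom k.+1 0 u -> ghom k 0 (dleft (th a) u).
Proof.
move=> hu S m /has_coef_dleft[nS /hu]; rewrite !odd_weightU1 // !weightE; lia.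
Qed.

Lemma dp_gxi a b : dp b (gxi K n a) = 0 :> L.
Proof.
apply/ffunP => S; rewrite !ffunE; case: (S == _); last exact: mderiv0.
by rewrite -[1%:R]mpolyC1 mderivC.
Qed.

Lemma lbracket_multivector_liouville k P : ghom k.+1 0 P ->
  lbracket P liouville =
  \sum_a (dright (th a) P ** gp _ n a - dx a P ** gxi _ n a).
Proof.
move=> hP; rewrite /lbracket -big_split /=; apply: eq_bigr => a _.
rewrite dx_liouville dp_liouville dleft_xi_liouville dleft_theta_liouville.
by rewrite !gmul0r sub0r addr0 addrC.
Qed.

Lemma dp_schouten_hamiltonian k P b : ghom k.+1 0 P ->
  dp b (lbracket P liouville) = dright (th b) P.
Proof.
move=> hP; rewrite (lbracket_multivector_liouville hP).
have dpD u v : dp b (u - v) = dp b u - dp b v.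
  by apply/ffunP => S; rewrite [RHS]galgBE !ffunE raddfB.
have dp_sum (F : 'I_n -> L) : dp b (\sum_a F a) = \sum_a dp b (F a).
  by apply/ffunP => S; rewrite sum_ffunE ffunE sum_ffunE mderiv_sum; apply: eq_bigr => a _; rewrite ffunE.
rewrite dp_sum (bigD1 b) //= [X in _ + X]big1 => [|a ab].
  rewrite addr0 dpD !dp_gmul dp_gp (dp_eq0 b (ghom_dright_theta (a := b) hP)) ?orbT //.
  rewrite (dp_eq0 b (ghom_dx (a := b) hP)) ?orbT // gmul0l add0r gmul0l add0r.
  rewrite (_ : dp b (gxi _ n b) = 0) ?gmul0r ?subr0 ?eqxx ?gmul1r //.
  exact: dp_gxi.
rewrite dpD !dp_gmul dp_gp (dp_eq0 b (ghom_dright_theta (a := a) hP)) ?orbT //.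
rewrite (dp_eq0 b (ghom_dx (a := a) hP)) ?orbT // gmul0l add0r gmul0l add0r.
by rewrite dp_gxi (negPf ab) gconst0 !gmul0r subrr.
Qed.

Lemma dright_schouten_hamiltonian k P b : ghom k.+1 0 P ->
  dright (xi b) (lbracket P liouville) = - dx b P.
Proof.
move=> hP; rewrite (lbracket_multivector_liouville hP).
have dD u v : dright (xi b) (u - v) = dright (xi b) u - dright (xi b) v.
  by apply/ffunP => S; rewrite galgBE !ffunE; case: ifP => _; rewrite ?subrr // -mulrBr.
have d_sum (F : 'I_n -> L) : dright (xi b) (\sum_a F a) = \sum_a dright (xi b) (F a).
  apply/ffunP => S; rewrite sum_ffunE ffunE; case: ifP => bS.
    by rewrite big1 // => a _; rewrite ffunE bS.
  by rewrite sum_ffunE mulr_sumr; apply: eq_bigr => a _; rewrite ffunE bS.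
rewrite d_sum (bigD1 b) //= [X in _ + X]big1 => [|a ab].
  rewrite addr0 dD (dright_xi_gmul_gp b b (ghom_dright_theta (a := b) hP)) sub0r.
  by rewrite (dright_xi_gmul_gxi b b (ghom_dx (a := b) hP)) eqxx scale1r.
rewrite dD (dright_xi_gmul_gp a b (ghom_dright_theta (a := a) hP)) sub0r.
by rewrite (dright_xi_gmul_gxi a b (ghom_dx (a := a) hP)) (negPf ab) scale0r oppr0.
Qed.

(** A multivector field involves neither the momenta nor the [xi], so the derived
  bracket only pairs the derivatives along [theta] of one argument with those
  along [x] of the other. *)
Lemma schoutenE k k' P Q : ghom k.+1 0 P -> ghom k' 0 Q ->
  lbracket (lbracket P liouville) Q =
  \sum_a (dright (th a) P ** dx a Q - dx a P ** dleft (th a) Q).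
Proof.
move=> hP hQ; rewrite {1}/lbracket -big_split /=; apply: eq_bigr => a _.
rewrite (dp_eq0 a hQ) ?orbT // gmul0r subr0 (dleft_xi_eq0 a hQ) gmul0r add0r.
by rewrite (dp_schouten_hamiltonian a hP) (dright_schouten_hamiltonian a hP) gmulNl.
Qed.

End Schouten.

Section SchoutenComponents.
Variables (R : realType) (n : nat).
Local Notation K := ('rV[R]_n -> R).
Local Notation L := (lfun R n n).
Local Notation xi := (lshift n).
Local Notation th := (rshift n).
Local Notation coef u S y := (mcoeff mnm0 (u S) (y : 'rV[R]_n) : R).
Implicit Types (u v P Q V : L) (f g : K) (a b c l : 'I_n) (y : 'rV[R]_n).

Lemma inversions_set2_1 (s t r : 'I_(n + n)) : s != t ->
  inversions [set s; t] [set r] = ((r < s) + (r < t))%N.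
Proof.
move=> st; rewrite inversionsUl ?inversions11 //.
by rewrite finset.disjoints1 inE.
Qed.

Lemma gmul_odd1r_set3 u v (s t r : 'I_(n + n)) : odd_degree 1 v ->
  (s < t)%N -> (t < r)%N ->
  (u ** v) (s |: [set t; r]) =
  u [set t; r] * v [set s] - u [set s; r] * v [set t] + u [set s; t] * v [set r].
Proof.
move=> dv st tr; have sr := ltn_trans st tr.
have ne (x z : 'I_(n + n)) : (x < z)%N -> (x == z = false) * (z == x = false).
  by move=> xz; split; apply/eqP => E; move: xz; rewrite E ltnn.
have nst := ne _ _ st; have ntr := ne _ _ tr; have nsr := ne _ _ sr.
rewrite (gmul_odd1r u _ dv) finset.big_setU1 /=; last by rewrite !inE nst nsr.
rewrite finset.big_setU1 /=; last by rewrite inE ntr.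
rewrite finset.big_set1.
have -> : (s |: [set t; r]) :\ s = [set t; r].
  by apply: finset.setU1K; rewrite !inE nst nsr.
have -> : (s |: [set t; r]) :\ t = [set s; r].
  apply/finset.setP => x; rewrite !inE.
  have [->|_] := eqVneq x t; first by rewrite nst ntr.
  by [].
have -> : (s |: [set t; r]) :\ r = [set s; t].
  apply/finset.setP => x; rewrite !inE.
  have [->|_] := eqVneq x r; first by rewrite nsr ntr.
  by rewrite orbF.
rewrite !inversions_set2_1 ?nst ?ntr ?nsr //.
rewrite st sr tr (ltnNge t s) (ltnW st) (ltnNge r s) (ltnNge r t) (ltnW sr) (ltnW tr) /=.
by rewrite expr1 expr0 sqrrN expr1n !mul1r mulN1r addrA.
Qed.

Lemma ghom_odd_degree k u : ghom k 0 u -> odd_degree k u.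
Proof.
move=> hu S; apply: contraNeq => Sk; apply/eqP/mpolyP => m; rewrite mcoeff0; apply/eqP.
by apply: contraNT Sk => /hu; rewrite odd_weight_card; lia.
Qed.

(** Moving an odd generator across the one that remains costs a sign. *)
Lemma dright_degree2 u e : odd_degree 2 u -> dright e u = - dleft e u.
Proof.
move=> du; apply/ffunP => S; rewrite [RHS]ffunE !ffunE; case: ifP => [_|eS].
  by rewrite oppr0.
have [S1|S1] := eqVneq #|S| 1%N; last first.
  by rewrite (odd_degree_eq0 du) ?mulr0 ?oppr0 // cardsU1 eS add1n eqSS.
have dis : [disjoint [set e] & S] by rewrite finset.disjoints1 eS.
have := inversionsC dis; rewrite cards1 S1 muln1 -mulNr => H; congr (_ * _).
by case: (inversions [set e] S) H => [|[|//]]; case: (inversions S [set e]) => [|[|//]] // _;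
  rewrite ?expr0 ?expr1 ?opprK.
Qed.

(** For a bivector field the two halves of the coordinate formula agree. *)
Lemma schouten_degree2 P : ghom 2 0 P ->
  lbracket (lbracket P (liouville K n)) P = - ((\sum_l dx l P ** dleft (th l) P) *+ 2).
Proof.
move=> hP; rewrite (schoutenE hP hP) -sumrMnl -sumrN; apply: eq_bigr => l _.
have d2 := ghom_odd_degree (ghom_dx (a := l) hP).
have d1 := ghom_odd_degree (ghom_dleft_theta (a := l) hP).
rewrite (dright_degree2 _ (ghom_odd_degree hP)) gmulNl (gmulC d1 d2).
by rewrite mul1n sqrrN expr1n scale1r mulr2n opprD.
Qed.

Lemma mcoeff0_mul (p q : mpoly n K) : mcoeff mnm0 (p * q) = mcoeff mnm0 p * mcoeff mnm0 q.
Proof. exact: (rmorphM (mcoeff mnm0)). Qed.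

Lemma coef_sum (F : 'I_n -> L) S y : coef (\sum_l F l) S y = \sum_l coef (F l) S y.
Proof. by rewrite sum_ffunE mcoeff_sum fct_sumE. Qed.

Lemma coef_dx u l S y : coef (dx l u) S y = pderiv l (mcoeff mnm0 (u S)) y.
Proof. by rewrite mcoeff_dx. Qed.

Lemma geval_eq_degree k u v y : ghom k 0 u -> ghom k 0 v ->
  (forall S, odd_weight (@lshift n n) S = 0%N -> odd_weight (@rshift n n) S = k -> coef u S y = coef v S y) ->
  geval y u = geval y v.
Proof.
move=> hu hv uv; apply: (ghom_eq (ghom_geval hu) (ghom_geval hv)) => S xS tS.
by rewrite !mcoeff_geval; exact: uv.
Qed.

Section Components.
Variables (pi : 'I_n -> 'I_n -> K) (E : 'I_n -> K) (y : 'rV[R]_n).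
Hypothesis pi_skew : forall a b, pi a b y = - pi b a y.
Local Notation P := (bivector n pi : L).
Local Notation V := (vector n E : L).

Lemma coef_bivector a b : (a < b)%N -> mcoeff mnm0 (P [set th a; th b]) = pi a b.
Proof. by move=> ab; rewrite bivectorE // mcoeffC eqxx mulr1. Qed.

Lemma coef_vector b : mcoeff mnm0 (V [set th b]) = E b.
Proof. by rewrite vectorE mcoeffC eqxx mulr1. Qed.

Lemma coef_dleft_bivector l t : coef (dleft (th l) P) [set th t] y = pi l t y.
Proof.
rewrite ffunE inE eq_rshift; have [->|lt] := eqVneq l t.
  have e := pi_skew t t; rewrite mcoeff0 -[LHS]/(0 : R); lra.
rewrite inversions11 /= ltn_add2l -scale_signE mcoeffZ.
have [tl|lt'|/eqP E'] := ltngtP t l.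
- rewrite finset.setUC coef_bivector // (pi_skew l t) expr1.
  by rewrite -[LHS]/((-1) * pi t l y) mulN1r.
- by rewrite coef_bivector // expr0 -[LHS]/(1 * pi l t y) mul1r.
by move: lt; rewrite eq_sym -(inj_eq val_inj) E'.
Qed.

Lemma schouten_bivector_bivector :
  (forall a b c,
    \sum_k (pi a k y * pderiv k (pi b c) y - pi b k y * pderiv k (pi a c) y
            + pi c k y * pderiv k (pi a b) y) =
    pi a b y * E c y - pi a c y * E b y + pi b c y * E a y) ->
  geval y (lbracket (lbracket P (liouville K n)) P) = geval y ((V ** P) *+ 2).
Proof.
move=> jac; have hP : ghom 2 0 P := @ghom_bivector _ _ _ pi.
have hV : ghom 1 0 V := @ghom_vector _ _ _ E.
have hl : ghom 3 0 (lbracket (lbracket P (liouville K n)) P).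
  have h1 : ghom 2 1 (lbracket P (liouville K n)) by apply: ghom_lbracket hP (@ghom_liouville K n).
  by apply: ghom_lbracket h1 hP.
have hr : ghom 3 0 ((V ** P) *+ 2).
  by rewrite mulr2n; apply: ghomD; exact: (@ghom_gmul _ _ _ 1 0 2 0).
apply: (geval_eq_degree hl hr) => S xS tS.
have [a [b [c [ab bc ->]]]] := theta_set3P xS tS.
rewrite (schouten_degree2 hP) (gmulC (ghom_odd_degree hV) (ghom_odd_degree hP)).
rewrite sqrrN expr1n scale1r.
set W := _ |: _; set D := \sum_l _.
have coefN2 u : coef (- (u *+ 2)) W y = - (coef u W y *+ 2).
  by rewrite mulr2n ffunE mcoeffN ffunE mcoeffD.
have coef2 u : coef (u *+ 2) W y = coef u W y *+ 2.
  by rewrite mulr2n ffunE mcoeffD.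
rewrite coefN2 coef2 -mulNrn; congr (_ *+ 2).
have a_b : (th a < th b)%N by rewrite /= ltn_add2l.
have b_c : (th b < th c)%N by rewrite /= ltn_add2l.
have coef3 u v : odd_degree 1 v -> coef (u ** v) W y =
    coef u [set th b; th c] y * coef v [set th a] y
    - coef u [set th a; th c] y * coef v [set th b] y
    + coef u [set th a; th b] y * coef v [set th c] y.
  move=> dv; rewrite (gmul_odd1r_set3 u dv a_b b_c) mcoeffD mcoeffB !mcoeff0_mul.
  by [].
have ac := ltn_trans ab bc.
rewrite (coef3 _ _ (ghom_odd_degree hV)) !coef_vector !coef_bivector //.
rewrite /D coef_sum -sumrN.
have -> : pi b c y * E a y - pi a c y * E b y + pi a b y * E c y =
  pi a b y * E c y - pi a c y * E b y + pi b c y * E a y by ring.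
rewrite -jac; apply: eq_bigr => l _.
rewrite (coef3 _ _ (ghom_odd_degree (ghom_dleft_theta (a := l) hP))).
rewrite !coef_dleft_bivector !coef_dx !coef_bivector //.
rewrite (pi_skew l a) (pi_skew l b) (pi_skew l c); ring.
Qed.

Lemma schouten_vector_bivector :
  (forall b c, \sum_k E k y * pderiv k (pi b c) y =
    \sum_k (pi b k y * pderiv k (E c) y - pi c k y * pderiv k (E b) y)) ->
  geval y (lbracket (lbracket V (liouville K n)) P) = geval y (0 : L).
Proof.
move=> jac; have hP : ghom 2 0 P := @ghom_bivector _ _ _ pi.
have hV : ghom 1 0 V := @ghom_vector _ _ _ E.
have hl : ghom 2 0 (lbracket (lbracket V (liouville K n)) P).
  have h1 : ghom 1 1 (lbracket V (liouville K n)) by apply: ghom_lbracket hV (@ghom_liouville K n).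
  by apply: ghom_lbracket h1 hP.
apply: (geval_eq_degree hl (@ghom0 _ _ _ 2 0)) => S xS tS.
have [b [c [bc ->]]] := theta_set2P xS tS.
rewrite (schoutenE hV hP) coef_sum.
have b_c : (th b < th c)%N by rewrite /= ltn_add2l.
have coef2 u v : odd_degree 1 u -> odd_degree 1 v -> coef (u ** v) [set th b; th c] y =
    coef u [set th b] y * coef v [set th c] y - coef u [set th c] y * coef v [set th b] y.
  move=> du dv; rewrite (gmul_set2 _ _ b_c).
  rewrite (odd_degree_eq0 du (S := finset.set0)) ?cards0 //.
  rewrite (odd_degree_eq0 dv (S := finset.set0)) ?cards0 //.
  by rewrite mul0r mulr0 addr0 add0r mcoeffB !mcoeff0_mul.
have coefB u v S' : coef (u - v) S' y = coef u S' y - coef v S' y.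
  by rewrite galgBE mcoeffB.
have -> : coef (0 : L) [set th b; th c] y = 0 by rewrite ffunE mcoeff0.
have /eqP := jac b c; rewrite -subr_eq0 -sumrB => /eqP H; apply: (etrans _ H).
apply: eq_bigr => l _; apply: (etrans (coefB _ _ _)).
have e := coef2 _ _ (ghom_odd_degree (ghom_dx (a := l) hV))
  (ghom_odd_degree (ghom_dleft_theta (a := l) hP)).
apply: (etrans (congr1 (fun r => _ - r) e)).
rewrite !coef_dleft_bivector !coef_dx !coef_vector.
rewrite (dright_theta l hV) gconst_mull ffunE mcoeffZ.
rewrite -[X in X - _]/(scoef V l y * (coef (dx l P) [set th b; th c] y)).
rewrite /scoef coef_vector coef_dx coef_bivector //.
rewrite (pi_skew l b) (pi_skew l c); ring.
Qed.

End Components.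

End SchoutenComponents.

(** * The Jacobi structure on the base *)

Section Conclusion.
Variables (R : realType) (n : nat) (M : manifold R n).

Lemma bihom_vectorN (A : vbundle M n) (E : lfamily A) : bihom 1 0 E -> bihom 1 0 (- E).
Proof.
move=> [sE cE hE]; have hb : bihom 1 0 E by [].
have coefN i S m : mcoeff m ((- E) i S) = - mcoeff m (E i S).
  by rewrite -[(- E) i S]/((- (E i)) S) ffunE mcoeffN.
have hN i y S m : chart_img i y -> mcoeff m ((- E) i S) y != 0 ->
    1%N = (mdeg m + odd_weight (@rshift n n) S)%N /\
    0%N = (mdeg m + odd_weight (@lshift n n) S)%N.
  by move=> yi; rewrite coefN -[(- _) y]/(- (mcoeff m (E i S) y)) oppr_eq0; exact: hE.
split; last exact hN.
  move=> i S m; rewrite coefN; apply: smooth_onN; first exact: chart_img_open.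
  exact: sE.
have gh i y : chart_img i y -> ghom 1 0 (geval y ((- E) i)).
  by move=> yi S m; rewrite /has_coef mcoeff_geval => /(hN _ _ _ _ yi).
have vN i y : vector_coef ((- E) i) y = - vector_coef (E i) y.
  by apply/rowP => b; rewrite !mxE coefN.
apply/(compatible_vectorP gh) => i j x xi xj.
have := (compatible_vectorP (fun i y yi => ghom_bihom hb yi)).1 cE i j x xi xj.
by move=> e; rewrite !vN e mulNmx.
Qed.

Lemma lie_algebroid_tangent_mu : lie_algebroid (tangent_mu M).
Proof.
split; first exact: bihom_tangent_mu.
move=> i y _; congr (geval y _); exact: lbracket_liouville.
Qed.

Lemma vectorN d (E : 'I_d -> 'rV[R]_n -> R) :
  - vector n E = vector n (fun k => - E k) :> lfun R n d.
Proof. by rewrite -sumrN; apply: eq_bigr => k _; rewrite scaleNr. Qed.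

End Conclusion.

Theorem proposition4p3 (R : realType) (n : nat) (M : manifold R n) (d : nat)
  (A : vbundle M d) (mu phi nu X : lfamily A)
  (bialg : jacobi_bialgebroid mu phi nu X) :
  [/\ exists E : lfamily (tangent_bundle M),
        is_vector_field (fun f => <{ <{ mu, X }>, of_fun A f }>) E /\
        is_vector_field (fun f => - <{ <{ nu, phi }>, of_fun A f }>) E,
      exists pi : lfamily (tangent_bundle M),
        is_bivector_field
          (fun f g => <{ <{ mu, of_fun A f }>, <{ nu, of_fun A g }> }>) pi &
      forall E pi : lfamily (tangent_bundle M),
        is_vector_field (fun f => <{ <{ mu, X }>, of_fun A f }>) E ->
        is_bivector_field
          (fun f g => <{ <{ mu, of_fun A f }>, <{ nu, of_fun A g }> }>) pi ->
        jacobi_structure (tangent_mu M) pi (- E)].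
Proof.
have skew i a b y : chart_img i y -> base_pi mu nu i a b y = - base_pi mu nu i b a y.
  by move=> yi; exact (base_pi_skew bialg a b yi).
split.
- exists (fun i => vector n (base_E mu X i)); split.
    apply: is_vector_field_vector (bihom_base_E bialg) => f i y yi.
    exact (mu_X_bracket bialg f yi).
  apply: is_vector_field_vector (bihom_base_E bialg) => f i y yi.
  exact (nu_phi_bracket bialg f yi).
- exists (fun i => bivector n (base_pi mu nu i)).
  apply: (is_bivector_field_bivector _ skew (bihom_base_pi bialg)) => f g i y yi.
  exact (mu_nu_bracket bialg f g yi).
move=> E pi vE vpi.
(* The given fields are only known through their actions on functions. *)
have eE i : eq_over (chart_img i) (E i) (vector n (base_E mu X i)).
  apply: (vector_field_unique _ vE) => f j y yj; exact (mu_X_bracket bialg f yj).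
have epi i : eq_over (chart_img i) (pi i) (bivector n (base_pi mu nu i)).
  apply: (bivector_field_unique _ vpi) => f g j y yj; exact (mu_nu_bracket bialg f g yj).
have eNE i : eq_over (chart_img i) ((- E) i) (vector n (fun k => - base_E mu X i k)).
  by rewrite -vectorN; exact: eq_overN (eE i).
split.
- exact: lie_algebroid_tangent_mu.
- by case: vpi.
- by apply: bihom_vectorN; case: vE.
- move=> i y yi; have oU := @chart_img_open _ _ M i.
  have el := eq_over_lbracket oU (eq_over_lbracket oU (epi i)
    (@eq_over_refl _ _ _ (chart_img i) (liouville ('rV[R]_n -> R) n))) (epi i).
  have er := eq_over_gmul (eNE i) (epi i).
  have er2 := eq_overD (eq_overN er) (eq_overN er).
  apply: (etrans (el y yi)); apply/esym; apply: (etrans (er2 y yi)); apply/esym.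
  have key := schouten_bivector_bivector (E := base_E mu X i)
    (fun a b => skew i a b y yi) (fun a b c => base_pi_jacobi bialg a b c yi).
  apply: (etrans key); congr (geval y _).
  by rewrite -vectorN gmulNl opprK mulr2n.
move=> i y yi; have oU := @chart_img_open _ _ M i.
have el := eq_over_lbracket oU (eq_over_lbracket oU (eNE i)
  (@eq_over_refl _ _ _ (chart_img i) (liouville ('rV[R]_n -> R) n))) (epi i).
apply: (etrans (el y yi)).
apply: (schouten_vector_bivector (fun a b => skew i a b y yi)) => b c.
have dE k : differentiable (base_E mu X i k) y.
  exact: (smooth_on_diff (smooth_on_base_E bialg k) yi).
under eq_bigr => k _ do rewrite -[X in X * _]/(- base_E mu X i k y) mulNr.
under [RHS]eq_bigr => k _ do rewrite !pderivN // !mulrN -opprD.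
rewrite !sumrN; congr (- _); exact (base_E_jacobi bialg b c yi).
Qed.
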